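(* Let $(M,\pi)$ be a Poisson manifold, $(\mathcal G\rightrightarrows M,\Omega)$ a local symplectic groupoid integrating it, $H\in\mathcal C^\infty(M)$ and $k\ge1$. Let $(L_t)_{t\in I}$ be a smooth family of exact Lagrangian bisections of $\mathcal G$ such that $L_0=M$, with variation functions $(h_t)_{t\in I}\in\mathcal C^\infty(M\times I)$. If the Magnus series $\mathcal M_\epsilon(h)$ of $(h_t)_{t\in I}$ coincides with $\epsilon H$ at order $k$, i.e. $\mathcal M_\epsilon(h)=\epsilon H+o(\epsilon^k)$, then the induced family of diffeomorphisms $(\phi_{L_t})_{t\in I}$ is a Hamiltonian Poisson integrator of order $k$ for $H$.
   Context: $I\subset\mathbb R$ is an interval containing $0$. Conventions. On a Poisson manifold, $X_F=\{F,\cdot\}$. On a symplectic manifold $(V,\omega)$ the Poisson bracket is the one for which $\omega(X_F,\cdot)=-dF$ (so $\omega=\sum dp_i\wedge dq_i$ corresponds to $\pi=\sum\partial_{p_i}\wedge\partial_{q_i}$ and $X_F=\sum \partial_{p_i}F\,\partial_{q_i}-\partial_{q_i}F\,\partial_{p_i}$). Symplectic groupoids. A (local) Lie groupoid $\mathcal G\rightrightarrows M$ has source $\alpha$, target $\beta$, and $g_1\cdot g_2$ is defined when $\alpha(g_2)=\beta(g_1)$ (in the local case, for $g_1,g_2$ close enough to units). It is a (local) symplectic groupoid if it carries a symplectic form $\Omega$ such that the graph $\{(g_1,g_2,g_1\cdot g_2)\}\subset\mathcal G^3$ is Lagrangian for $\mathrm{pr}_1^*\Omega+\mathrm{pr}_2^*\Omega-\mathrm{pr}_3^*\Omega$.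 The unit manifold $M$ is then Lagrangian; the groupoid integrates $(M,\pi)$ if $\alpha$ is a Poisson map and $\beta$ an anti-Poisson map onto $(M,\pi)$. Bisections. A bisection is a submanifold $L\subset\mathcal G$ on which both $\alpha$ and $\beta$ restrict to diffeomorphisms onto $M$; it induces the diffeomorphism $\phi_L=\beta|_L\circ(\alpha|_L)^{-1}$ of $M$. A smooth family of submanifolds of $V$ is a family $(L_t)_{t\in I}$ such that $L_I=\{(x,t)\in V\times I: x\in L_t\}$ is a submanifold of $V\times I$ whose projection to $I$ is a surjective submersion. A smooth family of Lagrangian bisections is such a family in $\mathcal G$ with each $L_t$ a Lagrangian bisection. Variation forms. For $x\in L_{t}$, the normal variation $[\partial L_t/\partial t](x)\in T_x\mathcal G/T_xL_t$ is the class of $\dot\gamma(t)$ for any smooth path $\gamma$, defined near $t$, with $\gamma(s)\in L_s$ and $\gamma(t)=x$ (independent of $\gamma$). The variation form is the closed $1$-form on $L_t$ given by $u\mapsto\Omega([\partial L_t/\partial t](x),u)$, $u\in T_xL_t$; it is transported to a closed $1$-form $\xi_t\in\Omega^1(M)$ by $(\alpha|_{L_t}^{-1})^*$. The family is exact if all these forms are exact; variation functions are then a smooth family $(h_t)_{t\in I}$ on $M$ with $dh_t=\xi_t$. Magnus series. For a smooth family $(h_t)$, put $h[[\epsilon]]=\sum_{i\ge0}\frac{\epsilon^i}{i!}\partial_t^ih_t|_{t=0}$. The Magnus series $\mathcal M_\epsilon(h)\in\mathcal C^\infty(M)[[\epsilon]]$ is the unique formal solution of $\mathcal M_0(h)=0$,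 $\partial_\epsilon\mathcal M_\epsilon(h)=\sum_{i\ge0}(-1)^i\frac{B_i}{i!}\mathrm{ad}^i_{\mathcal M_\epsilon(h)}h[[\epsilon]]$, with $\mathrm{ad}_F=\{F,\cdot\}$ and $\frac{x}{e^x-1}=\sum_{i\ge0}\frac{B_i}{i!}x^i$. Hamiltonian Poisson integrator. A smooth family of diffeomorphisms $(\phi_\epsilon)_\epsilon$ of $M$ is a Hamiltonian Poisson integrator of order $k\ge1$ for $H$ if (1) each $\phi_\epsilon$ is a Poisson diffeomorphism, and (2) there is a time-dependent Hamiltonian $(g_t)_t$ on $M$ with $g_t=H+o(t^{k-1})$ (equality of Taylor expansions in $t$ at $0$ up to order $k-1$) and such that $\phi_\epsilon$ is the flow from time $0$ to time $\epsilon$ of the time-dependent vector field $X_{g_t}$. *)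

(* Defs.v *)
From HB Require Import structures.
From mathcomp Require Import all_boot all_order all_algebra.
From mathcomp Require Import all_classical all_reals all_analysis.

Set Implicit Arguments.
Unset Strict Implicit.
Unset Printing Implicit Defensive.

Import Order.TTheory GRing.Theory Num.Theory.
Import numFieldNormedType.Exports.

Local Open Scope classical_set_scope.
Local Open Scope ring_scope.

Section SmoothManifolds.
Context {R : realType}.

(* [Ck k U f] is the usual C^k condition when U is open; the derivative of
   order one is tested along every fixed vector v. *)
Fixpoint Ck (k : nat) {V W : normedModType R} (U : set V) (f : V -> W) : Prop :=
  match k with
  | 0 => forall x, U x -> {for x, continuous f}
  | k'.+1 => (forall x, U x -> differentiable f x) /\
             forall v : V, Ck k' U (fun x => 'd f x v)
  end.

Definition Cinf {V W : normedModType R} (U : set V) (f : V -> W) : Prop :=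
  forall k, Ck k U f.

(* Data of an n-dimensional atlas on a topological space, presented by a chosen
   chart around each point x: [crd x] is the chart, meaningful on the domain
   [dom x], and [icrd x] is its inverse, meaningful on [crd x @` dom x].
   Every atlas can be presented in this way (the chosen charts form a subatlas
   defining the same smooth structure). *)
Record charted_space (n : nat) := ChartedSpace {
  carrier :> topologicalType;
  dom : carrier -> set carrier;
  crd : carrier -> carrier -> 'rV[R]_n;
  icrd : carrier -> 'rV[R]_n -> carrier }.

Record smooth_manifold n (M : charted_space n) : Prop := SmoothManifold {
  _ : hausdorff_space M;
  _ : @second_countable M;
  _ : forall x : M, open (dom x) /\ dom x x;
  _ : forall x : M, open (crd x @` dom x);
  _ : forall x y : M, dom x y -> icrd x (crd x y) = y;
  _ : forall x y : M, dom x y -> {for y, continuous (crd x)};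
  _ : forall x y : M, dom x y -> {for crd x y, continuous (icrd x)};
  _ : forall x y : M, Cinf (crd x @` (dom x `&` dom y)) (crd y \o icrd x) }.

Definition euclid (n : nat) : charted_space n :=
  @ChartedSpace n 'rV[R]_n (fun=> setT) (fun=> id) (fun=> id).

Definition real_line : charted_space 1 :=
  @ChartedSpace 1 R (fun=> setT) (fun _ t => const_mx t) (fun _ v => v 0 0).

Definition prodm m n (M : charted_space m) (N : charted_space n) :
    charted_space (m + n) :=
  @ChartedSpace (m + n) (M * N)%type
    (fun p => dom p.1 `*` dom p.2)
    (fun p q => row_mx (crd p.1 q.1) (crd p.2 q.2))
    (fun p z => (icrd p.1 (lsubmx z), icrd p.2 (rsubmx z))).

(* Smoothness of f on an arbitrary subset A: near every point of A, f is
   continuous on A and its coordinate expression extends to a smooth map.  For A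
   open this is ordinary smoothness; for A of the form M x I with I an interval
   it is smoothness up to the endpoints of I. *)
Definition smooth_on m n (M : charted_space m) (N : charted_space n)
    (A : set M) (f : M -> N) : Prop :=
  forall x, A x ->
    f @ within A (nbhs x) --> f x /\
    exists U (F : 'rV[R]_m -> 'rV[R]_n),
      [/\ open U, U (crd x x), U `<=` crd x @` dom x, Cinf U F &
          forall z, U z -> A (icrd x z) -> crd (f x) (f (icrd x z)) = F z].

Definition smooth m n (M : charted_space m) (N : charted_space n) (f : M -> N) :=
  smooth_on setT f.

Definition smooth_fun m (M : charted_space m) (F : M -> R) : Prop :=
  @smooth m 1 M real_line F.

(* Tangent vectors at x are their coordinate vectors in the chosen chart at x,
   so T_x M is 'rV[R]_m. *)
Definition mdiff m n (M : charted_space m) (N : charted_space n) (f : M -> N)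
    (x : M) (u : 'rV[R]_m) : 'rV[R]_n :=
  'd (crd (f x) \o f \o icrd x : 'rV[R]_m -> 'rV[R]_n) (crd x x) u.

Definition dfun m (M : charted_space m) (F : M -> R) (x : M) (u : 'rV[R]_m) : R :=
  'd (F \o icrd x : 'rV[R]_m -> R) (crd x x) u.

Definition submersion m n (M : charted_space m) (N : charted_space n)
    (f : M -> N) : Prop :=
  smooth f /\ forall x w, exists u, mdiff f x u = w.

Definition diffeo m n (M : charted_space m) (N : charted_space n)
    (f : M -> N) : Prop :=
  smooth f /\ exists g : N -> M, [/\ smooth g, cancel f g & cancel g f].

(* Difference quotients are taken inside the interval I, so that derivatives at
   an endpoint of I are one-sided. *)
Definition dquot (V : normedModType R) (f : R -> V) (t : R) : R -> V :=
  fun s => (s - t)^-1 *: (f s - f t).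

Definition velocity (I : set R) m (M : charted_space m) (c : R -> M) (t : R)
    (v : 'rV[R]_m) : Prop :=
  dquot (crd (c t) \o c) t @ within I t^' --> v.

Fixpoint dt (I : set R) (i : nat) (f : R -> R) : R -> R :=
  if i is i'.+1 then fun t => lim (dquot (dt I i' f) t @ within I t^') else f.

(* S is, in the coordinates Psi on W, the trace on A of R^k x 0.  The set A is
   the ambient manifold: setT, or V x I inside V x R when the interval I may
   contain endpoints. *)
Record slice_chart d (N : charted_space d) (A S : set N) (k : nat)
    (W : set N) (Psi : N -> 'rV[R]_d) (iPsi : 'rV[R]_d -> N) : Prop :=
  SliceChart {
  _ : open W;
  _ : @smooth_on d d N (euclid d) W Psi;
  _ : open (Psi @` W);
  _ : @smooth_on d d (euclid d) N (Psi @` W) iPsi;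
  _ : forall y, W y -> iPsi (Psi y) = y;
  _ : forall y, W y -> A y ->
        (S y <-> forall j : 'I_d, (k <= j)%N -> Psi y 0 j = 0) }.

Definition submanifold_in d (N : charted_space d) (A : set N) (k : nat)
    (S : set N) : Prop :=
  [/\ (k <= d)%N, S `<=` A &
      forall x, S x -> exists W Psi iPsi, W x /\ slice_chart A S k W Psi iPsi].

Definition tangent_in d (N : charted_space d) (A : set N) (k : nat) (S : set N)
    (x : N) (v : 'rV[R]_d) : Prop :=
  exists W Psi iPsi, [/\ W x, slice_chart A S k W Psi iPsi &
    forall j : 'I_d, (k <= j)%N -> @mdiff d d N (euclid d) Psi x v 0 j = 0].

Definition submanifold d (N : charted_space d) := submanifold_in [set: N].
Definition tangent d (N : charted_space d) := tangent_in [set: N].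

(* f restricts to a diffeomorphism from the submanifold L onto N; a map into L
   is smooth iff it is smooth as a map into the ambient manifold. *)
Definition diffeo_from d n (V : charted_space d) (N : charted_space n)
    (L : set V) (f : V -> N) : Prop :=
  smooth_on L f /\
  exists s : N -> V, [/\ smooth s, forall y, L (s y),
    cancel s f & forall x, L x -> s (f x) = x].

(* L_I as a subset of V x R, and smoothness of the family (L_t), t in I: L_I is
   a submanifold of V x I and its projection to I is a surjective submersion. *)
Definition total_set (I : set R) d (V : charted_space d) (L : R -> set V) :
    set (prodm V real_line) :=
  [set p | I p.2 /\ L p.2 p.1].

Definition smooth_family (I : set R) d (V : charted_space d)
    (L : R -> set V) : Prop :=
  let VI : set (prodm V real_line) := [set p | I p.2] in
  exists k,
    [/\ submanifold_in VI k (total_set I L),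
        forall t, I t -> exists x, L t x &
        forall p, total_set I L p -> exists w,
          tangent_in VI k (total_set I L) p w /\
          mdiff (snd : prodm V real_line -> real_line) p w 0 0 != 0].

Definition form2 d (N : charted_space d) := N -> 'rV[R]_d -> 'rV[R]_d -> R.

Definition pullback d e (N : charted_space d) (P : charted_space e)
    (f : N -> P) (omega : form2 P) : form2 N :=
  fun x u v => omega (f x) (mdiff f x u) (mdiff f x v).

Definition form2_coef d (N : charted_space d) (omega : form2 N) (x : N)
    (i j : 'I_d) (z : 'rV[R]_d) : R :=
  @pullback d d (euclid d) N (icrd x) omega z (delta_mx 0 i) (delta_mx 0 j).

Record symplectic d (N : charted_space d) (omega : form2 N) : Prop := Symplectic {
  _ : forall x a u v w,
        omega x (a *: u + v) w = a * omega x u w + omega x v w;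
  _ : forall x u, omega x u u = 0;
  _ : forall x u, (forall v, omega x u v = 0) -> u = 0;
  _ : forall x i j, Cinf (crd x @` dom x) (form2_coef omega x i j);
  (* closedness, in the chart at x *)
  _ : forall x i j l z, (crd x @` dom x) z ->
        'D_(delta_mx 0 i) (form2_coef omega x j l) z +
        'D_(delta_mx 0 j) (form2_coef omega x l i) z +
        'D_(delta_mx 0 l) (form2_coef omega x i j) z = 0 }.

Definition lagrangian d (N : charted_space d) (omega : form2 N)
    (S : set N) : Prop :=
  exists k, submanifold k S /\
    forall x, S x -> forall u,
      tangent k S x u <-> (forall v, tangent k S x v -> omega x u v = 0).

(* The Hamiltonian vector X_F(x), with omega(X_F, .) = - dF. *)
Definition symp_ham d (N : charted_space d) (omega : form2 N) (F : N -> R)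
    (x : N) : 'rV[R]_d :=
  xget 0 [set u | forall v, omega x u v = - dfun F x v].

(* {F, K} = X_F K *)
Definition symp_bracket d (N : charted_space d) (omega : form2 N)
    (F K : N -> R) : N -> R :=
  fun x => dfun K x (symp_ham omega F x).

Definition grad n (M : charted_space n) (F : M -> R) (x : M) : 'rV[R]_n :=
  \row_j dfun F x (delta_mx 0 j).

(* pi x is the matrix of the bivector in the coordinates of T_x M, and
   {F, K} = pi(dF, dK). *)
Definition pbracket n (M : charted_space n) (pi : M -> 'M[R]_n)
    (F K : M -> R) : M -> R :=
  fun x => (grad F x *m pi x *m (grad K x)^T) 0 0.

Record poisson n (M : charted_space n) (pi : M -> 'M[R]_n) : Prop := Poisson {
  _ : forall x, (pi x)^T = - pi x;
  (* smoothness of the components {z_i, z_j} in the chart at x *)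
  _ : forall x i j, Cinf (crd x @` dom x)
        (pbracket pi (fun y => crd x y 0 i) (fun y => crd x y 0 j) \o icrd x);
  _ : forall F G H : M -> R, smooth_fun F -> smooth_fun G -> smooth_fun H ->
        forall x, pbracket pi F (pbracket pi G H) x +
                  pbracket pi G (pbracket pi H F) x +
                  pbracket pi H (pbracket pi F G) x = 0 }.

(* X_F = {F, .} *)
Definition ham n (M : charted_space n) (pi : M -> 'M[R]_n) (F : M -> R)
    (x : M) : 'rV[R]_n :=
  grad F x *m pi x.

(* Poisson (e = 1) and anti-Poisson (e = -1) maps. *)
Definition poisson_map d n (N : charted_space d) (M : charted_space n) (e : R)
    (brN : (N -> R) -> (N -> R) -> N -> R)
    (brM : (M -> R) -> (M -> R) -> M -> R) (f : N -> M) : Prop :=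
  forall F K : M -> R, smooth_fun F -> smooth_fun K ->
    forall x, brN (F \o f) (K \o f) x = e * brM F K (f x).

Record groupoid_data m n (G : charted_space m) (M : charted_space n) :=
  GroupoidData {
  src : G -> M;
  tgt : G -> M;
  uni : M -> G;
  mul : G -> G -> G;
  muldom : set (prodm G G);
  inv : G -> G }.

(* The product g1.g2 is defined on an open part [muldom] of the composable pairs
   that contains all products with a unit; associativity and inverses are only
   required near the units. *)
Record local_lie_groupoid m n (G : charted_space m) (M : charted_space n)
    (D : groupoid_data G M) : Prop := LocalLieGroupoid {
  _ : submersion (src D);
  _ : submersion (tgt D);
  _ : smooth (uni D);
  _ : cancel (uni D) (src D);
  _ : cancel (uni D) (tgt D);
  _ : exists O : set (prodm G G), open O /\
        muldom D = O `&` [set p | src D p.2 = tgt D p.1];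
  _ : forall g, muldom D (uni D (src D g), g) /\ muldom D (g, uni D (tgt D g));
  _ : smooth_on (muldom D)
        ((fun p => mul D p.1 p.2) : prodm G G -> G);
  _ : forall g1 g2, muldom D (g1, g2) ->
        src D (mul D g1 g2) = src D g1 /\ tgt D (mul D g1 g2) = tgt D g2;
  _ : forall g, mul D (uni D (src D g)) g = g /\ mul D g (uni D (tgt D g)) = g;
  _ : exists U : set G, [/\ open U, range (uni D) `<=` U &
        forall g1 g2 g3, U g1 -> U g2 -> U g3 ->
          muldom D (g1, g2) -> muldom D (g2, g3) ->
          muldom D (mul D g1 g2, g3) -> muldom D (g1, mul D g2 g3) ->
          mul D (mul D g1 g2) g3 = mul D g1 (mul D g2 g3)];
  _ : exists U : set G, [/\ open U, range (uni D) `<=` U,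
        smooth_on U (inv D) &
        forall g, U g ->
          [/\ muldom D (g, inv D g), muldom D (inv D g, g),
              mul D g (inv D g) = uni D (src D g) &
              mul D (inv D g) g = uni D (tgt D g)]] }.

Definition mul_graph m n (G : charted_space m) (M : charted_space n)
    (D : groupoid_data G M) : set (prodm (prodm G G) G) :=
  [set p | muldom D p.1 /\ p.2 = mul D p.1.1 p.1.2].

Definition form_cube m (G : charted_space m) (Omega : form2 G) :
    form2 (prodm (prodm G G) G) :=
  fun p u v =>
    pullback ((fun q => q.1.1) : prodm (prodm G G) G -> G) Omega p u v +
    pullback ((fun q => q.1.2) : prodm (prodm G G) G -> G) Omega p u v -
    pullback ((fun q => q.2) : prodm (prodm G G) G -> G) Omega p u v.

Record local_symplectic_groupoid m n (G : charted_space m)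
    (M : charted_space n) (D : groupoid_data G M) (Omega : form2 G) : Prop :=
  LocalSymplecticGroupoid {
  _ : local_lie_groupoid D;
  _ : symplectic Omega;
  _ : lagrangian (form_cube Omega) (mul_graph D) }.

Definition integrates m n (G : charted_space m) (M : charted_space n)
    (D : groupoid_data G M) (Omega : form2 G) (pi : M -> 'M[R]_n) : Prop :=
  poisson_map 1 (symp_bracket Omega) (pbracket pi) (src D) /\
  poisson_map (-1) (symp_bracket Omega) (pbracket pi) (tgt D).

Section Bisections.
Context {m n : nat} {G : charted_space m} {M : charted_space n}.
Variables (D : groupoid_data G M) (Omega : form2 G) (I : set R).

Definition bisection (L : set G) : Prop :=
  [/\ (exists k, submanifold k L), diffeo_from L (src D) & diffeo_from L (tgt D)].

(* (alpha|_L)^-1; the unit is only a default value *)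
Definition src_section (L : set G) (y : M) : G :=
  xget (uni D y) [set g | L g /\ src D g = y].

Definition induced_map (L : set G) : M -> M := tgt D \o src_section L.

Definition smooth_lagrangian_bisections (L : R -> set G) : Prop :=
  smooth_family I L /\
  forall t, I t -> bisection (L t) /\ lagrangian Omega (L t).

(* The class [dL_t/dt](x) in T_x G / T_x L_t, as a subset of T_x G. *)
Definition normal_variation (L : R -> set G) (t : R) (x : G) :
    set 'rV[R]_m :=
  [set v | exists (J : set R) (c : R -> G),
    [/\ open J /\ J t, @smooth_on 1 m real_line G (J `&` I) c,
        (forall s, J s -> I s -> L s (c s)), c t = x & velocity I c t v]].

(* The form u |-> Omega([dL_t/dt](x), u) on T_x L_t, computed with a
   representative of the class: L_t being Lagrangian, the choice of the
   representative does not matter. *)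
Definition variation_form (L : R -> set G) (t : R) (x : G) (u : 'rV[R]_m) : R :=
  Omega x (xget 0 (normal_variation L t x)) u.

(* xi_t, the pullback of the variation form by (alpha|_{L_t})^-1 *)
Definition xi (L : R -> set G) (t : R) (y : M) (w : 'rV[R]_n) : R :=
  variation_form L t (src_section (L t) y) (mdiff (src_section (L t)) y w).

Definition exact_family (L : R -> set G) : Prop :=
  forall t, I t -> exists2 F : M -> R, smooth_fun F & dfun F =2 xi L t.

End Bisections.

(* A smooth family (h_t), t in I, of functions, i.e. a smooth function on M x I. *)
Definition smooth_fun_family (I : set R) n (M : charted_space n)
    (h : R -> M -> R) : Prop :=
  @smooth_on (n + 1) 1 (prodm M real_line) real_line [set p | I p.2]
    (fun p => h p.2 p.1).

Definition variation_functions (I : set R) m n (G : charted_space m)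
    (M : charted_space n) (D : groupoid_data G M) (Omega : form2 G)
    (L : R -> set G) (h : R -> M -> R) : Prop :=
  smooth_fun_family I h /\
  forall t, I t -> dfun (h t) =2 xi D Omega I L t.

(* An element of C^oo(M)[[eps]] is the sequence of its coefficients. *)

(* h[[eps]], the Taylor series of t |-> h_t at 0 *)
Definition taylor (I : set R) (T : Type) (h : R -> T -> R) (i : nat) (x : T) : R :=
  dt I i (fun t => h t x) 0 / (i`!)%:R.

(* B_0, ..., B_(n-1), from B_n = - (n+1)^-1 \sum_(i < n) 'C(n+1, i) B_i *)
Fixpoint bernoulli_seq (n : nat) : seq R :=
  if n is n'.+1 then
    let s := bernoulli_seq n' in
    rcons s ((n' == 0%N)%:R -
             n'.+1%:R^-1 * \sum_(i < n') 'C(n'.+1, i)%:R * s`_i)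
  else [::].

Definition bernoulli (n : nat) : R := (bernoulli_seq n.+1)`_n.

(* ad_S applied to the series f, for the bracket extended to series *)
Definition ad_series n (M : charted_space n) (pi : M -> 'M[R]_n)
    (S f : nat -> M -> R) : nat -> M -> R :=
  fun j x => \sum_(a < j.+1) pbracket pi (S a) (f (j - a)%N) x.

(* S is the Magnus series of h.  As S has no constant term, only the
   terms i <= j of the sum over i >= 0 contribute to the coefficient of eps^j. *)
Definition magnus_series (I : set R) n (M : charted_space n)
    (pi : M -> 'M[R]_n) (h : R -> M -> R) (S : nat -> M -> R) : Prop :=
  [/\ forall j, smooth_fun (S j),
      forall x, S 0%N x = 0 &
      forall j x, j.+1%:R * S j.+1 x =
        \sum_(i < j.+1) (-1) ^+ i * (bernoulli i / (i`!)%:R) *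
          iter i (ad_series pi S) (taylor I h) j x].

(* f = g + o(eps^k) *)
Definition series_eq_upto (T : Type) (k : nat) (f g : nat -> T -> R) : Prop :=
  forall j, (j <= k)%N -> forall x, f j x = g j x.

(* the series eps^i F *)
Definition monomial (T : Type) (i : nat) (F : T -> R) : nat -> T -> R :=
  fun j x => if j == i then F x else 0.

Record hamiltonian_poisson_integrator (I : set R) n (M : charted_space n)
    (pi : M -> 'M[R]_n) (H : M -> R) (k : nat) (phi : R -> M -> M) : Prop :=
  HamiltonianPoissonIntegrator {
  _ : @smooth_on (n + 1) n (prodm M real_line) M [set p | I p.2]
        (fun p => phi p.2 p.1);
  _ : forall t, I t -> diffeo (phi t);
  _ : forall t, I t -> poisson_map 1 (pbracket pi) (pbracket pi) (phi t);
  _ : exists g : R -> M -> R,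
        [/\ smooth_fun_family I g,
            series_eq_upto k.-1 (taylor I g) (monomial 0%N H),
            (* phi is the flow of X_{g_t} starting from time 0 *)
            forall x, phi 0 x = x &
            forall t x, I t ->
              velocity I (fun s => phi s x) t (ham pi (g t) (phi t x))] }.

End SmoothManifolds.

Lemma bernoulli_seqE (R : realType) n i : (i < n)%N ->
  (bernoulli_seq n : seq R)`_i = bernoulli i.
Proof.
have size_bern k : size (bernoulli_seq k : seq R) = k.
  by elim: k => //= k IH; rewrite size_rcons IH.
elim: n => // n IH; rewrite ltnS leq_eqVlt => /predU1P[->//|ltin].
by rewrite [bernoulli_seq _]/= nth_rcons size_bern ltin IH.
Qed.

(* The generating identity (e^x - 1) * \sum_i B_i / i! x^i = x, coefficient by
   coefficient. *)
Lemma bernoulli_generating (R : realType) (n : nat) :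
  \sum_(i < n.+1) bernoulli i / (i`!)%:R / (n - i).+1`!%:R = (n == 0%N)%:R :> R.
Proof.
have fact_neq0 (k : nat) : k`!%:R != 0 :> R.
  by rewrite pnatr_eq0 -lt0n fact_gt0.
have sizeb k : size (bernoulli_seq k : seq R) = k.
  by elim: k => //= k IH; rewrite size_rcons IH.
have binE (i : nat) : (i <= n)%N ->
    (i`!)%:R^-1 / (n - i).+1`!%:R = 'C(n.+1, i)%:R / n.+1`!%:R :> R.
  move=> le_in; have := bin_fact (leqW le_in).
  rewrite subSn // => /(congr1 (fun k => k%:R : R)); rewrite !natrM => <-.
  rewrite !invfM !mulrA mulfV ?mul1r // pnatr_eq0 -lt0n bin_gt0.
  exact: leqW.
have -> : \sum_(i < n.+1) bernoulli i / (i`!)%:R / (n - i).+1`!%:R =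
    (\sum_(i < n.+1) 'C(n.+1, i)%:R * bernoulli i) / n.+1`!%:R :> R.
  rewrite mulr_suml; apply: eq_bigr => i _.
  by rewrite -mulrA binE -1?ltnS // mulrA; congr (_ / _); rewrite mulrC.
rewrite big_ord_recr /= {2}/bernoulli [bernoulli_seq _]/= nth_rcons sizeb.
rewrite ltnn eqxx binSn mulrBr mulrA mulfV ?pnatr_eq0 // mul1r.
under [X in _ - X]eq_bigr => i _ do rewrite bernoulli_seqE //.
rewrite addrC subrK.
by case: n {binE} => [|n]; rewrite ?mulr0 ?mul0r ?mulr1 ?divff.
Qed.

(* Main.v *)
From HB Require Import structures.
Require Import Defs.
From mathcomp Require Import all_boot all_order all_algebra.
From mathcomp Require Import all_classical all_reals all_analysis.
From mathcomp Require Import ring lra zify.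

(** Let [s_t] be the section of the source with image [L_t], so that the induced
    diffeomorphism is [phi_t = tgt o s_t], and put [g_t = h_t o phi_t^-1].  The
    claim is that [phi_t] is the flow of [X_(g_t)] and that [g_t] agrees with [H]
    up to order [k - 1] in time.

    The differential geometry of the groupoid enters through one fact, read off
    from the isotropy of the multiplication graph at the points [(g, 1, g)] and
    [(1, g, g)]: a vector tangent to the source fibre pairs under [Omega] only
    with the image of a vector under [d tgt], and symmetrically for the target
    ([src_kernel], [tgt_kernel]).  Since the source of [s_t y] is constant in
    time, the velocity [v] of [t |-> s_t y] is tangent to the source fibre.  On
    vectors tangent to [L_t], [Omega (v, .)] is the variation form, that is,
    [dh_t] ([variation_velocity]).  By the previous fact this determines
    [Omega (v, .)] on all vectors: it is the differential of [g_t o tgt]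
    ([src_fibre_form]).  So [- v] is the Hamiltonian vector of [g_t o tgt], and
    since the target is anti-Poisson, [phi_t y = tgt (s_t y)] moves with velocity
    [X_(g_t)] ([velocity_ham]).  The same fact and the isotropy of [L_t] convert
    the Hamiltonian vector of [F o tgt] into that of [F o phi_t o src] along
    [L_t], so that [phi_t] is a Poisson map ([ham_transfer], [phi_poisson]).

    The order condition is about Taylor coefficients.  The Magnus recursion, read
    upwards in the order, gives [h_t = H + O(t^k)]: all nested brackets that occur
    are brackets of [H] with [H] or 0 ([magnus_taylor]).  Moreover
    [d_t g_t = (d_t h_t) o phi_t^-1], because the remaining term is the bracket of
    [g_t] with itself ([g_time]).  Thus [d_t g_t = O(t^(k-1))], and this estimate
    controls the Taylor coefficients of [g_t] ([taylor_transport]).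

    All this requires that [s_t y] be smooth in [y] and [t] together, up to the
    endpoints of [I], although the family is only given through its total space.
    This follows from the local structure of submersions, hence from the inverse
    function theorem ([joint_section], [submersion_straightening],
    [inverse_function]). *)

Set Implicit Arguments.
Unset Strict Implicit.
Unset Printing Implicit Defensive.

Import Order.TTheory GRing.Theory Num.Theory.
Import numFieldNormedType.Exports.

Local Open Scope classical_set_scope.
Local Open Scope ring_scope.

(** * Calculus of maps of class C^k between normed modules *)

Section Calculus.
Context {R : realType}.
Implicit Types V W : normedModType R.

Lemma diff_eps V W (f : V -> W) x : differentiable f x ->
  forall e, 0 < e ->
    \forall h \near (0 : V), `|f (h + x) - f x - 'd f x h| <= e * `|h|.
Proof.
move=> /diff_locallyP [_ /eqaddoP H] e e0; have := H e e0.
by apply: filter_app; near=> h => /=; rewrite opprD addrA.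
Unshelve. all: by end_near. Qed.

(** This explicit form of differentiability is the one that estimates produce:
the remainder is below any multiple of the increment.  It also identifies the
differential. *)
Lemma diff_epsP V W (f : V -> W) x (L : {linear V -> W}) : continuous L ->
  (forall e, 0 < e ->
    \forall h \near (0 : V), `|f (h + x) - f x - L h| <= e * `|h|) ->
  differentiable f x /\ 'd f x = L :> (V -> W).
Proof.
move=> Lc H.
have E : f \o shift x = cst (f x) + L +o_ (0 : V) id.
  apply/eqaddoP => e e0; have := H e e0.
  by apply: filter_app; near=> h => /=; rewrite opprD addrA.
have dE := diff_unique Lc E; split=> //.
by apply/diff_locallyP; rewrite dE.
Unshelve. all: by end_near. Qed.

Lemma diff_near_eq V W (f g : V -> W) x : (\forall y \near x, f y = g y) ->
  differentiable f x -> differentiable g x /\ 'd g x = 'd f x :> (V -> W).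
Proof.
move=> fg df; apply: diff_epsP => [|e e0]; first exact: diff_continuous.
have fgx : f x = g x by exact: nbhs_singleton fg.
have fg0 : \forall h \near (0 : V), f (h + x) = g (h + x).
  by have := fg; rewrite (near_shift 0 x) /=; apply: filterS => h; rewrite subr0.
have := diff_eps df e0; apply: filterS2 fg0 => h; by rewrite fgx => ->.
Qed.

Lemma open_near (T : topologicalType) (U : set T) x : open U -> U x ->
  \forall y \near x, U y.
Proof. by move=> oU Ux; apply: open_nbhs_nbhs. Qed.

Lemma Ck_sub k V W (U U' : set V) (f : V -> W) :
  U' `<=` U -> Ck k U f -> Ck k U' f.
Proof.
move=> sU; elim: k f => [|k IH] f /=; first by move=> H x /sU /H.
by move=> [H1 H2]; split=> [x /sU /H1//|v]; apply: IH.
Qed.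

Lemma Ck_eq k V W (U : set V) (f g : V -> W) : open U ->
  (forall x, U x -> f x = g x) -> Ck k U f -> Ck k U g.
Proof.
move=> oU; elim: k f g => [|k IH] f g fg /=.
  move=> H x Ux; have := H x Ux; rewrite /prop_for /continuous_at -(fg x Ux) => fx.
  apply: cvg_trans fx; apply: near_eq_cvg.
  by apply: filterS (open_near oU Ux).
have near_fg x : U x -> \forall y \near x, f y = g y.
  by move=> Ux; apply: filterS (open_near oU Ux).
move=> [H1 H2]; split=> [x Ux|v].
  by have [] := diff_near_eq (near_fg _ Ux) (H1 _ Ux).
apply: IH (H2 v) => x Ux.
by have [_ ->] := diff_near_eq (near_fg _ Ux) (H1 _ Ux).
Qed.

Lemma CkW k V W (U : set V) (f : V -> W) : Ck k.+1 U f -> Ck k U f.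
Proof.
elim: k f => [|k IH] f; first by move=> [H _] x /H /differentiable_continuous.
by rewrite [Ck k.+2 _ _]/= => -[H1 H2]; split=> // v; apply: IH.
Qed.

Lemma Ck_cst k V W (U : set V) (a : W) : Ck k U (fun=> a).
Proof.
elim: k a => [|k IH] a; first by move=> x _; exact: cvg_cst.
split=> [x _|v]; first exact: differentiable_cst.
suff -> : (fun x : V => 'd (fun _ : V => a) x v) = fun=> 0 by exact: IH.
by apply/funext => x; rewrite -[fun _ => a]/(cst a) diff_cst.
Qed.

Lemma Ck_lin k V W (U : set V) (L : {linear V -> W}) : continuous L -> Ck k U L.
Proof.
move=> Lc; case: k => [|k]; first by move=> x _; apply: Lc.
split=> [x _|v]; first exact: linear_differentiable.
suff -> : (fun x : V => 'd L x v) = fun=> L v by exact: Ck_cst.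
by apply/funext => x; rewrite diff_lin.
Qed.

Lemma Ck_id k V (U : set V) : Ck k U (@id V).
Proof. by apply: (Ck_lin k U (L := idfun)) => x; exact: cvg_id. Qed.

Lemma CkD k V W (U : set V) (f g : V -> W) : open U ->
  Ck k U f -> Ck k U g -> Ck k U (fun x => f x + g x).
Proof.
move=> oU; elim: k f g => [|k IH] f g.
  by move=> Hf Hg x Ux; apply: cvgD; [exact: Hf|exact: Hg].
move=> [f1 f2] [g1 g2]; split=> [x Ux|v].
  by apply: differentiableD; [exact: f1|exact: g1].
apply: (Ck_eq oU _ (IH _ _ (f2 v) (g2 v))) => x Ux.
exact: (esym (congr1 (@^~ v) (diffD (f1 _ Ux) (g1 _ Ux)))).
Qed.

Lemma Ck_comp_lin k V W W' (U : set V) (L : {linear W -> W'}) (f : V -> W) :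
  open U -> continuous L -> Ck k U f -> Ck k U (fun x => L (f x)).
Proof.
move=> oU Lc; elim: k f => [|k IH] f.
  move=> Hf x Ux; apply: (@continuous_comp _ _ _ f L); [exact: Hf|exact: Lc].
move=> [f1 f2]; split=> [x Ux|v].
  by apply: (@differentiable_comp _ _ _ _ f L) (f1 _ Ux) _; exact: linear_differentiable.
apply: (Ck_eq oU _ (IH _ (f2 v))) => x Ux.
rewrite -[fun x => L (f x)]/(L \o f) (diff_comp (f1 _ Ux)) /=; last exact: linear_differentiable.
by rewrite diff_lin.
Qed.

Lemma Ck_sum k V W (U : set V) J (r : seq J) (f : J -> V -> W) : open U ->
  (forall i, Ck k U (f i)) -> Ck k U (fun x => \sum_(i <- r) f i x).
Proof.
move=> oU Hf; elim: r => [|i r IH].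
  by apply: (Ck_eq oU _ (Ck_cst k U 0)) => x _; rewrite big_nil.
apply: (Ck_eq oU (f := fun x => f i x + \sum_(j <- r) f j x)).
  by move=> x _; rewrite big_cons.
exact: CkD.
Qed.

Fact scale_is_bilinear W :
  bilinear_for (GRing.Scale.Law.clone _ _ *:%R _)
    (GRing.Scale.Law.clone _ _ *:%R _) (@GRing.scale R W).
Proof.
split=> [u'|u] a x y /=.
- by rewrite scalerDl scalerA.
- by rewrite scalerDr !scalerA [a * u]mulrC.
Qed.
HB.instance Definition _ W := bilinear_isBilinear.Build R R W W _ _
  (@GRing.scale R W) (scale_is_bilinear W).

Lemma diff_scale V W (k : V -> R) (f : V -> W) x :
  differentiable k x -> differentiable f x ->
  differentiable (fun z => k z *: f z) x /\
  forall v, 'd (fun z => k z *: f z) x v = k x *: 'd f x v + 'd k x v *: f x.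
Proof.
move=> dk df.
have sc : continuous (fun p : R * W => p.1 *: p.2).
  by move=> p; exact: scale_continuous.
have dp := differentiable_pair dk df.
have ds := @differentiable_bilin _ _ _ _ (@GRing.scale R W) (k x, f x) sc.
have -> : (fun z => k z *: f z) = (fun p : R * W => p.1 *: p.2) \o (fun y => (k y, f y)) by [].
split; first exact: differentiable_comp.
move=> v; rewrite diff_comp //= diff_pair //=.
by rewrite (diff_bilin (f := @GRing.scale R W) _ sc).
Qed.

Lemma CkS k V W (U : set V) (f : V -> R) (g : V -> W) : open U ->
  Ck k U f -> Ck k U g -> Ck k U (fun x => f x *: g x).
Proof.
move=> oU; elim: k f g => [|k IH] f g.
  by move=> Hf Hg x Ux; apply: cvgZ; [exact: Hf|exact: Hg].
move=> Ff Fg; have [f1 f2] := Ff; have [g1 g2] := Fg; split=> [x Ux|v].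
  by have [] := diff_scale (f1 _ Ux) (g1 _ Ux).
have H1 := IH _ _ (CkW Ff) (g2 v); have H2 := IH _ _ (f2 v) (CkW Fg).
apply: (Ck_eq oU _ (CkD oU H1 H2)) => x Ux.
by have [_ ->] := diff_scale (f1 _ Ux) (g1 _ Ux).
Qed.

Lemma CkV k V (U : set V) (f : V -> R) : open U -> (forall x, U x -> f x != 0) ->
  Ck k U f -> Ck k U (fun x => (f x)^-1).
Proof.
move=> oU f0; elim: k => [|k IH].
  by move=> Hf x Ux; apply: cvgV; [exact: f0|exact: Hf].
move=> Ff; have [f1 f2] := Ff; split=> [x Ux|v].
  by apply: differentiableV; [exact: f1|exact: f0].
have H1 := IH (CkW Ff); have H2 := CkS oU (CkS oU H1 H1) (f2 v).
have H3 := CkS oU (Ck_cst k U (-1 : R)) H2.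
apply: (Ck_eq oU _ H3) => x Ux; have dV := diffV (f1 _ Ux) (f0 _ Ux).
transitivity ((- (f x) ^- 2 \*: 'd f x) v); last by rewrite -dV.
by rewrite /= /GRing.scale /= mulN1r mulNr -exprVn expr2.
Qed.

Lemma CkM k V (U : set V) (f g : V -> R) : open U ->
  Ck k U f -> Ck k U g -> Ck k U (fun x => f x * g x).
Proof. exact: CkS. Qed.

Lemma Ck_prod k V (U : set V) J (r : seq J) (f : J -> V -> R) : open U ->
  (forall i, Ck k U (f i)) -> Ck k U (fun x => \prod_(i <- r) f i x).
Proof.
move=> oU Hf; elim: r => [|i r IH].
  by apply: (Ck_eq oU _ (Ck_cst k U (1 : R))) => x _; rewrite big_nil.
apply: (Ck_eq oU (f := fun x => f i x * \prod_(j <- r) f j x)).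
  by move=> x _; rewrite big_cons.
exact: CkM.
Qed.

Lemma Ck_det k V (U : set V) n (A : V -> 'M[R]_n) : open U ->
  (forall i j, Ck k U (fun x => A x i j)) -> Ck k U (fun x => \det (A x)).
Proof.
move=> oU HA; apply: Ck_sum => // s; apply: CkM => //; first exact: Ck_cst.
exact: Ck_prod.
Qed.

(** By Cramer's rule the entries of the inverse are quotients of polynomials in
the entries of the matrix. *)
Lemma Ck_invmx k V (U : set V) n (A : V -> 'M[R]_n) i j : open U ->
  (forall x, U x -> A x \in unitmx) ->
  (forall i j, Ck k U (fun x => A x i j)) -> Ck k U (fun x => invmx (A x) i j).
Proof.
move=> oU uA HA.
have H1 : Ck k U (fun x => (\det (A x))^-1).
  by apply: CkV => // [x /uA|]; rewrite ?unitmxE ?unitfE //; exact: Ck_det.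
have H2 : Ck k U (fun x => cofactor (A x) j i).
  apply: CkM => //; first exact: Ck_cst.
  apply: Ck_det => // a b.
  apply: (Ck_eq oU _ (HA (lift j a) (lift i b))) => x _; by rewrite !mxE.
apply: (Ck_eq oU _ (CkM oU H1 H2)) => x Ux.
by rewrite /invmx (uA x Ux) !mxE.
Qed.

Lemma coord_lin_continuous m n (i : 'I_m) (j : 'I_n) :
  exists2 L : {linear 'M[R]_(m, n) -> R}, continuous L & forall N, L N = N i j.
Proof.
have lin : linear (fun N : 'M[R]_(m, n) => N i j : R).
  by move=> a u v; rewrite !mxE.
pose LM := GRing.isLinear.Build _ _ _ _ _ lin.
pose L : {linear _ -> _} := HB.pack (fun N : 'M[R]_(m, n) => N i j : R) LM.
by exists L => //; exact: coord_continuous.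
Qed.

Lemma Ck_coord k V m n (U : set V) (f : V -> 'M[R]_(m, n)) i j : open U ->
  Ck k U f -> Ck k U (fun x => f x i j).
Proof.
move=> oU Hf; have [L Lc LE] := coord_lin_continuous i j.
by apply: (Ck_eq oU _ (Ck_comp_lin oU Lc Hf)) => x _.
Qed.

Lemma rV_linE W n (L : {linear 'rV[R]_n -> W}) v :
  L v = \sum_(j < n) v 0 j *: L (delta_mx 0 j).
Proof.
rewrite {1}[v]row_sum_delta linear_sum; apply: eq_bigr => j _.
by rewrite linearZ.
Qed.

Lemma lin_rV_continuous W n (L : {linear 'rV[R]_n -> W}) : continuous L.
Proof.
have -> : (L : _ -> W) = fun v => \sum_(j < n) v 0 j *: L (delta_mx 0 j).
  by apply/funext => v; exact: rV_linE.
move=> v; suff /(_ v I) : Ck 0 setT (fun v : 'rV[R]_n => \sum_(j < n) v 0 j *: L (delta_mx 0 j)) by [].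
apply: Ck_sum => [|j]; first exact: openT.
apply: CkS; [exact: openT| |exact: Ck_cst].
by apply: Ck_coord; [exact: openT|exact: Ck_id].
Qed.

Lemma Ck_rV k V n (U : set V) (f : V -> 'rV[R]_n) : open U ->
  (forall j, Ck k U (fun x => f x 0 j)) -> Ck k U f.
Proof.
move=> oU Hf.
apply: (Ck_eq oU (f := fun x => \sum_(j < n) f x 0 j *: delta_mx 0 j)).
  by move=> x _; rewrite -row_sum_delta.
by apply: Ck_sum => // j; apply: CkS => //; exact: Ck_cst.
Qed.

Lemma Ck_cont k V W (U : set V) (f : V -> W) : Ck k U f ->
  forall x, U x -> {for x, continuous f}.
Proof. by elim: k f => // k IH f /CkW; exact: IH. Qed.

(** The differential of the composite at [x] evaluates ['d g] along the vector
['d f x v], which moves with [x], whereas [Ck] only tests differentials along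
fixed vectors.  Expanding that vector in the standard basis turns the
derivative into a sum of products of functions of class C^k, and the induction
goes through. *)
Lemma Ck_comp k V W n (U : set V) (U' : set 'rV[R]_n) (f : V -> 'rV[R]_n)
    (g : 'rV[R]_n -> W) : open U -> (forall x, U x -> U' (f x)) ->
  Ck k U f -> Ck k U' g -> Ck k U (fun x => g (f x)).
Proof.
move=> oU UU'; elim: k g => [|k IH] g.
  move=> Hf Hg x Ux; apply: (@continuous_comp _ _ _ f g); [exact: Hf|].
  exact: Hg (UU' _ Ux).
move=> Ff [g1 g2]; have [f1 f2] := Ff; split=> [x Ux|v].
  by apply: (@differentiable_comp _ _ _ _ f g) (f1 _ Ux) _; exact/g1/UU'.
apply: (Ck_eq oU (f := fun x => \sum_(j < n)
    ('d f x v) 0 j *: 'd g (f x) (delta_mx 0 j))).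
  move=> x Ux; have dgf := diff_comp (f1 _ Ux) (g1 _ (UU' _ Ux)).
  by rewrite -(rV_linE ('d g (f x))); exact: esym (congr1 (@^~ v) dgf).
apply: Ck_sum => // j; apply: CkS => //; first exact: (Ck_coord 0 j oU (f2 v)).
exact: IH (CkW Ff) (g2 _).
Qed.

End Calculus.

(** * The inverse function theorem *)

Section IFT.
Context {R : realType}.

(** The one-variable mean value theorem along the segment from [y] to [x]. *)
Lemma mean_value_le (V : normedModType R) (F : V -> R) (x y : V) (K : R) :
  (forall t : R, 0 <= t <= 1 -> differentiable F (y + t *: (x - y)) /\
     `|'d F (y + t *: (x - y)) (x - y)| <= K) ->
  `|F x - F y| <= K.
Proof.
move=> H; pose c (t : R) := y + t *: (x - y).
have dc (t : R) : is_diff t c (fun s => s *: (x - y)).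
  rewrite /c; apply: is_diff_eq; apply/funext => s /=; by rewrite /GRing.add /= /GRing.zero /= add0r.
have dF (t : R) : 0 <= t <= 1 -> is_derive t (1 : R) (F \o c) ('d F (c t) (x - y)).
  move=> /H [dFt _].
  have dfc : differentiable (F \o c) t by exact: differentiable_comp.
  apply: DeriveDef; first exact: diff_derivable.
  rewrite deriveE // diff_comp //=; congr ('d F (c t) _).
  by rewrite diff_val scale1r.
have [] := @MVT_segment R (F \o c) (fun t => 'd F (c t) (x - y)) 0 1 ler01.
- by move=> t; rewrite in_itv /= => /andP[t0 t1]; apply: dF; rewrite !ltW.
- apply: continuous_in_subspaceT => t; rewrite inE /= in_itv /= => t01.
  exact/differentiable_continuous/derivable1_diffP/ex_derive/dF.
move=> t; rewrite in_itv /= => t01; rewrite /= /c scale1r scale0r addr0 addrCA subrr addr0 => ->.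
by rewrite subr0 mulr1; have [] := H _ t01.
Qed.

Lemma rV_norm_le n (x : 'rV[R]_n) (K : R) : 0 <= K ->
  (forall j, `|x 0 j| <= K) -> `|x| <= K.
Proof.
move=> K0 H; rewrite [`|x|]mx_normrE; apply: bigmax_le => // -[i j] _ /=.
by rewrite ord1.
Qed.

Lemma rV_coord_le n (x : 'rV[R]_n) j : `|x 0 j| <= `|x|.
Proof.
rewrite [leRHS]mx_normrE.
exact: (@le_bigmax _ _ _ _ (fun i : 'I_1 * 'I_n => `|x i.1 i.2|) (0, j)).
Qed.

Lemma lin_rV_bound n m (L : {linear 'rV[R]_n -> 'rV[R]_m}) (c : R) v :
  (forall j, `|L (delta_mx 0 j)| <= c) -> `|L v| <= n%:R * c * `|v|.
Proof.
move=> H; rewrite rV_linE; apply: (le_trans (ler_norm_sum _ _ _)).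
apply: (le_trans (y := \sum_(j < n) c * `|v|)).
  apply: ler_sum => j _; rewrite normrZ mulrC; apply: ler_pM => //.
  exact: rV_coord_le.
by rewrite sumr_const card_ord -[X in X <= _]mulr_natl mulrA.
Qed.

Lemma diff_near_id (V : normedModType R) (U : set V) (f : V -> V) x v (c : R) :
  U x -> Cinf U f -> 'd f x v = v -> 0 < c ->
  \forall y \near x, `|v - 'd f y v| <= c.
Proof.
move=> Ux fC fv c0; have /(_ x Ux) /cvgrPdist_le /(_ c c0) := (fC 1).2 v.
by rewrite fv.
Qed.

Lemma diff_lin_idB (V W : normedModType R) (L : {linear V -> W}) (f : V -> V) x :
  continuous L -> differentiable f x ->
  differentiable (fun w => L (w - f w)) x /\
  forall v, 'd (fun w => L (w - f w)) x v = L (v - 'd f x v).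
Proof.
move=> Lc /differentiableP df.
have dg : is_diff x (fun w => w - f w) (fun w => w - 'd f x w).
  exact: is_diffB.
have dL := linear_differentiable (x - f x) Lc.
split; first by apply: (differentiable_comp (f := fun w => w - f w)).
move=> v; have E := diff_comp (@ex_diff _ _ _ _ _ _ _ dg) dL.
have E2 : 'd L (x - f x) = L :> (V -> W) by exact: diff_lin.
have E3 := @diff_val _ _ _ _ _ _ _ dg.
exact: (etrans (congr1 (@^~ v) E) (etrans (congr1 (@^~ _) E2) (congr1 (fun g => L (g v)) E3))).
Qed.

Lemma closed_norm_ball (V : normedModType R) (z : V) (r : R) :
  closed [set x : V | `|x - z| <= r].
Proof.
have -> : [set x : V | `|x - z| <= r] = closed_ball_ (fun x => `|x|) z r.
  by apply/funext => x; rewrite /closed_ball_ /= distrC.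
exact: closed_closed_ball_.
Qed.

Lemma fixed_point_on (X : completeNormedModType R) (B : set X) (T : X -> X) (q : R) :
  0 <= q < 1 -> closed B -> B !=set0 -> (forall x, B x -> B (T x)) ->
  (forall x y, B x -> B y -> `|T x - T y| <= q * `|x - y|) ->
  exists2 x, B x & x = T x.
Proof.
move=> /andP[q0 q1] cB B0 BT lipT.
have Tfun : set_fun B B T by move=> x; exact: BT.
pose TM := isFun.Build _ _ _ _ T Tfun.
pose TF : {fun B >-> B} := HB.pack T TM.
apply: (@banach_fixed_point R X B TF) => //.
exists (NngNum q0); split=> //= -[x y] [/= Bx By]; exact: lipT.
Qed.

(** A Lipschitz right inverse [s] of [f] is differentiable, with differential any
left inverse [L] of the differential of [f].  With [u = s (y + h) - s y] the
remainder [u - L h] equals [- L (f (s y + u) - f (s y) - df u)], which is small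
compared with [u], and [u] is bounded by a multiple of [h]. *)
Lemma diff_inverse (V : normedModType R) (f s : V -> V) y (L : {linear V -> V}) (K : R) :
  continuous L -> differentiable f (s y) -> (forall v, L ('d f (s y) v) = v) ->
  (\forall h \near (0 : V), `|s (h + y) - s y| <= K * `|h|) ->
  (\forall h \near (0 : V), f (s (h + y)) = h + y) -> f (s y) = y ->
  differentiable s y /\ 'd s y = L :> (V -> V).
Proof.
move=> Lc df LK lips fs fsy; apply: diff_epsP => // e e0.
have [k k0 Lk] := linear_lipschitz Lc.
pose K' := Num.max K 1.
have K'0 : 0 < K' by rewrite lt_max ltr01 orbT.
have e'0 : 0 < e / (k * K') by rewrite divr_gt0 // mulr_gt0.
have lips' : \forall h \near (0 : V), `|s (h + y) - s y| <= K' * `|h|.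
  apply: filterS lips => h /le_trans; apply.
  by rewrite ler_wpM2r // /K' le_max lexx.
have /nbhs_normP [d /= d0 Hd] := diff_eps df e'0.
have small : \forall h \near (0 : V), `|h| < d / K'.
  apply/nbhs_normP; exists (d / K'); first by rewrite /= divr_gt0.
  by move=> h; rewrite /= sub0r normrN.
near=> h.
have lh : `|s (h + y) - s y| <= K' * `|h| by near: h.
have fh : f (s (h + y)) = h + y by near: h.
have sh : `|h| < d / K' by near: h.
set u := s (h + y) - s y.
have -> : u - L h = - L (f (u + s y) - f (s y) - 'd f (s y) u).
  by rewrite /u subrK fh fsy addrK linearB LK opprB.
rewrite normrN; apply: (le_trans (Lk _)).
have /= := Hd u; rewrite sub0r normrN => Hu.
have {Hu} : `|f (u + s y) - f (s y) - 'd f (s y) u| <= e / (k * K') * `|u|.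
  by apply: Hu; apply: (le_lt_trans lh); rewrite mulrC -ltr_pdivlMr.
move=> Hu; apply: (le_trans (y := k * (e / (k * K') * (K' * `|h|)))).
  apply: ler_wpM2l; first exact: ltW.
  by apply: (le_trans Hu); apply: ler_wpM2l; first exact: ltW.
have -> // : k * (e / (k * K') * (K' * `|h|)) = e * `|h|.
by field; rewrite !gt_eqF.
Unshelve. all: by end_near. Qed.

(** The differential at [z0] is normalised to the identity, so [x - f x] is a
contraction near [z0].  Hence [x - f x + y] has a fixed point for [y] near
[f z0], that is, a preimage of [y], and the preimage is Lipschitz in [y].  The
formula [ds = (df)^-1] then raises the class of [s] by induction. *)
Lemma inverse_function n (f : 'rV[R]_n -> 'rV[R]_n) (U : set 'rV[R]_n) z0 :
  open U -> U z0 -> Cinf U f -> (forall v, 'd f z0 v = v) ->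
  exists (V : set 'rV[R]_n) (s : 'rV[R]_n -> 'rV[R]_n),
    [/\ open V, V (f z0), Cinf V s, s (f z0) = z0 &
        forall y, V y -> U (s y) /\ f (s y) = y].
Proof.
move=> oU Uz0 fC df0.
pose c : R := (2 * n.+1%:R)^-1.
have c0 : 0 < c by rewrite invr_gt0 mulr_gt0.
have nc : n%:R * c <= 2^-1.
  rewrite /c invfM mulrCA ger_pMr ?invr_gt0 // ler_pdivrMr // mul1r ler_nat //.
(* on a ball where each column of the derivative of x - f x is at most c, that
   derivative has norm at most n c, hence at most 1/2 *)
have [r r0 Hr] : exists2 r : R, 0 < r & forall x, `|x - z0| <= r ->
    U x /\ forall j, `|delta_mx 0 j - 'd f x (delta_mx 0 j)| <= c.
  have N1 : \forall x \near z0, U x /\ forall j,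
      `|delta_mx 0 j - 'd f x (delta_mx 0 j)| <= c.
    have N2 : \forall x \near z0, forall j,
        `|delta_mx 0 j - 'd f x (delta_mx 0 j)| <= c.
      have FF := @nbhs_filter _ z0.
      have := @filter_forall _ _ (fun (j : 'I_n) (x : 'rV[R]_n) =>
        is_true (`|delta_mx 0 j - 'd f x (delta_mx 0 j)| <= c)) (nbhs z0) FF.
      apply => j; exact: (diff_near_id Uz0 fC (df0 _) c0).
    by apply: filterS2 N2 => [x|]; last exact: open_near oU Uz0.
  have /nbhs_normP [e /= e0 He] := N1.
  exists (e / 2); first by rewrite divr_gt0.
  move=> x xr; apply: He; rewrite /= distrC; apply: (le_lt_trans xr).
  by rewrite ltr_pdivrMr // ltr_pMr // ltr1n.
have dfx x : `|x - z0| <= r -> differentiable f x.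
  by move=> /Hr [Ux _]; exact: (fC 1).1.
have dg x v : `|x - z0| <= r -> `|v - 'd f x v| <= 2^-1 * `|v|.
  move=> xr; have [_ H] := Hr _ xr.
  have lin : linear (fun v => v - 'd f x v).
    by move=> a u w; rewrite linearP scalerBr opprD addrACA.
  pose LM := GRing.isLinear.Build _ _ _ _ _ lin.
  pose L : {linear _ -> _} := HB.pack (fun v => v - 'd f x v) LM.
  apply: (le_trans (lin_rV_bound (L := L) v H)).
  by rewrite ler_wpM2r.
have lip x y : `|x - z0| <= r -> `|y - z0| <= r ->
    `|(x - f x) - (y - f y)| <= 2^-1 * `|x - y|.
  move=> xr yr; apply: rV_norm_le => [|j]; first by rewrite mulr_ge0 ?invr_ge0.
  rewrite !mxE.
  have [Lj Ljc LjE] := coord_lin_continuous (R:=R) (m := 1) (n := n) 0 j.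
  suff : `|Lj (x - f x) - Lj (y - f y)| <= 2^-1 * `|x - y| by rewrite !LjE !mxE.
  apply: (@mean_value_le _ (fun z => Lj (z - f z))) => t t01.
  set z := y + _.
  have zr : `|z - z0| <= r.
    have -> : z - z0 = t *: (x - z0) + (1 - t) *: (y - z0).
      by apply/rowP => i; rewrite /z !mxE; ring.
    have /andP[t0 t1] := t01.
    apply: (le_trans (ler_normD _ _)); rewrite !normrZ.
    rewrite (ger0_norm t0) ger0_norm ?subr_ge0 //.
    apply: (le_trans (y := t * r + (1 - t) * r)); last by rewrite -mulrDl addrC subrK mul1r.
    by apply: lerD; apply: ler_wpM2l => //; rewrite subr_ge0.
  have [D1 D2] := diff_lin_idB Ljc (dfx _ zr); split=> //; rewrite D2.
  by rewrite LjE; apply: (le_trans (rV_coord_le _ _)); exact: dg.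
pose B := [set x : 'rV[R]_n | `|x - z0| <= r].
have Bz0 : B z0 by rewrite /B /= subrr normr0 ltW.
have lip2 x x' : B x -> B x' -> `|x - x'| <= 2 * `|f x - f x'|.
  move=> Bx Bx'; have := lip _ _ Bx Bx'.
  have : `|x - x'| <= `|(x - f x) - (x' - f x')| + `|f x - f x'|.
    have {1}-> : x - x' = ((x - f x) - (x' - f x')) + (f x - f x').
      by apply/rowP => i; rewrite !mxE; ring.
    exact: ler_normD.
  lra.
have ex_s y : `|y - f z0| < r / 2 -> exists2 x, B x & f x = y.
  move=> yr; pose T x := x - f x + y.
  have TB x : B x -> B (T x).
    move=> Bx; have := lip _ _ Bx Bz0; rewrite /B /= /T => H.
    have -> : x - f x + y - z0 = ((x - f x) - (z0 - f z0)) + (y - f z0).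
      by apply/rowP => i; rewrite !mxE; ring.
    apply: (le_trans (ler_normD _ _)); move: H Bx yr; rewrite /B /=.
    lra.
  have Bcl : closed B by exact: closed_norm_ball.
  pose X : completeNormedModType R :=
    HB.pack_for (completeNormedModType R) 'rV[R]_n.
  have [|||x Bx xT] := @fixed_point_on X B T 2^-1 _ Bcl _ TB.
  - by rewrite invr_ge0 invf_lt1 ?ltr1n // andbT.
  - by exists z0.
  - move=> x x' Bx Bx'; rewrite /T.
    have -> : x - f x + y - (x' - f x' + y) = (x - f x) - (x' - f x').
      by apply/rowP => i; rewrite !mxE; ring.
    exact: lip.
  exists x => //; move/rowP: xT => xT; apply/rowP => i.
  by have := xT i; rewrite /T !mxE; lra.
pose V := [set y : 'rV[R]_n | `|y - f z0| < r / 2].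
have oV : open V.
  have -> : V = ball (f z0) (r / 2).
    by rewrite -ball_normE; apply/funext => y; rewrite /V /= distrC.
  exact: ball_open.
have Vfz0 : V (f z0) by rewrite /V /= subrr normr0 divr_gt0.
have [s sE] : exists s : 'rV[R]_n -> 'rV[R]_n, forall y, V y -> B (s y) /\ f (s y) = y.
  have H y : exists x, V y -> B x /\ f x = y.
    have [Vy|nVy] := pselect (V y); last by exists 0.
    by have [x Bx fx] := ex_s y Vy; exists x.
  by exists (fun y => sval (cid (H y))) => y; case: cid.
have lips y y' : V y -> V y' -> `|s y - s y'| <= 2 * `|y - y'|.
  move=> /sE [By fy] /sE [By' fy']; by have := lip2 _ _ By By'; rewrite fy fy'.
have injA x v : B x -> 'd f x v = 0 -> v = 0.
  move=> Bx dv; have := dg x v Bx; rewrite dv subr0 => H.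
  by apply/eqP; rewrite -normr_le0; lra.
pose J x := lin1_mx ('d f x).
have JE x v : v *m J x = 'd f x v by exact: mul_rV_lin1.
have uJ x : B x -> J x \in unitmx.
  move=> Bx; rewrite -row_free_unit; apply: inj_row_free => v.
  by rewrite JE; exact: injA.
have sdiff y : V y -> differentiable s y /\ forall v, 'd s y v = v *m invmx (J (s y)).
  move=> Vy; have [Bs fs] := sE _ Vy.
  pose L : {linear 'rV[R]_n -> 'rV[R]_n} := mulmxr (invmx (J (s y))).
  have Lc : continuous L by exact: lin_rV_continuous.
  have near_h : \forall h \near (0 : 'rV[R]_n), V (h + y).
    have := open_near oV Vy; rewrite (near_shift 0 y) /=.
    by apply: filterS => h; rewrite subr0.
  have LK v : L ('d f (s y) v) = v by rewrite /L /= -JE mulmxK // uJ.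
  have N1 : \forall h \near (0 : 'rV[R]_n), `|s (h + y) - s y| <= 2 * `|h|.
    apply: filterS near_h => h Vh; apply: (le_trans (lips _ _ Vh Vy)).
    rewrite le_eqVlt; apply/orP; left; apply/eqP; congr (2 * `|_|); exact: addrK.
  have N2 : \forall h \near (0 : 'rV[R]_n), f (s (h + y)) = h + y.
    exact: filterS (fun h Vh => (sE _ Vh).2) near_h.
  have [ds dsE] := diff_inverse Lc (dfx _ Bs) LK N1 N2 fs.
  by split; [exact: ds|move=> v; exact: (congr1 (@^~ v) dsE)].
have sC : Cinf V s.
  elim=> [|k IH]; first by move=> y /sdiff [/differentiable_continuous].
  split=> [y /sdiff []//|v].
  apply: (Ck_eq oV (f := fun y => v *m invmx (J (s y)))).
    by move=> y Vy; rewrite (sdiff y Vy).2.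
  apply: Ck_rV => // j.
  apply: (Ck_eq oV (f := fun y => \sum_i v 0 i * invmx (J (s y)) i j)).
    by move=> y Vy; rewrite mxE.
  apply: Ck_sum => // i; apply: CkM => //; first exact: Ck_cst.
  apply: Ck_invmx => // [y /sE [/uJ]//|a b].
  apply: (Ck_eq oV (f := fun y => 'd f (s y) (delta_mx 0 a) 0 b)).
    by move=> y Vy; rewrite /J /lin1_mx mxE.
  apply: Ck_coord => //.
  have sU y : V y -> U (s y) by move=> /sE [/Hr []].
  exact: (Ck_comp oV sU IH ((fC k.+1).2 (delta_mx 0 a))).
exists V, s; split=> //; last by move=> y /sE [/Hr [Us _]].
have [Bs fs] := sE _ Vfz0.
by apply/eqP; rewrite -subr_eq0 -normr_le0; have := lip2 _ _ Bs Bz0; rewrite fs subrr normr0 mulr0.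
Qed.

End IFT.

Section Straight.
Context {R : realType}.

Lemma diff_straightening (V W : normedModType R) (L : {linear W -> V}) (f : V -> W)
    (L' : {linear V -> W}) (w : W) x :
  continuous L -> continuous L' -> differentiable f x ->
  (forall v, 'd f x v + L' v = 0) ->
  forall v, 'd (fun z => z + L (f z + L' z + w)) x v = v.
Proof.
move=> Lc L'c /differentiableP df dE v.
have dL' : is_diff x L' L'.
  by apply: DiffDef; [exact: linear_differentiable|exact: diff_lin].
have d1 : is_diff x (fun z => f z + L' z + w) (fun=> 0).
  apply: is_diff_eq; apply/funext => u.
  by rewrite /GRing.add /= addr0 dE.
have dL : is_diff (f x + L' x + w) L L.
  by apply: DiffDef; [exact: linear_differentiable|exact: diff_lin].
have d2 := is_diff_comp d1 dL.
have d3 := is_diffD (is_diff_id x) d2.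
have E := @diff_val _ _ _ _ _ _ _ d3.
have E2 : (id + (L \o (fun=> 0)) : V -> V) v = v.
  by rewrite /GRing.add /= linear0 addr0.
exact: etrans (congr1 (@^~ v) E) E2.
Qed.

Lemma diff_right_id (V : normedModType R) (f s : V -> V) x :
  differentiable s x -> differentiable f (s x) -> (forall v, 'd f (s x) v = v) ->
  (\forall y \near x, f (s y) = y) -> forall v, 'd s x v = v.
Proof.
move=> ds df dfE fs v.
have dfs : differentiable (f \o s) x by exact: differentiable_comp.
have [_ E] := diff_near_eq fs dfs.
have E2 := diff_comp ds df.
have E3 : 'd (fun z : V => z) x = (fun z => z) :> (V -> V).
  exact: (@diff_val _ _ _ _ _ _ _ (is_diff_id x)).
have E4 : 'd (fun y => f (s y)) x v = 'd f (s x) ('d s x v).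
  exact: (congr1 (@^~ v) E2).
exact: (etrans (esym (dfE _)) (etrans (esym E4) (etrans (congr1 (@^~ v) (esym E)) (congr1 (@^~ v) E3)))).
Qed.

(** Let [B] be a right inverse of [dQ = 'd Q z0] and
[Phi z = z + B (Q z - Q z0 - dQ (z - z0))].  Then [Phi] has differential the
identity at [z0] and [dQ (Phi z - z0) = Q z - Q z0], so the local inverse [s]
of [Phi] makes [Q] affine. *)
Lemma submersion_straightening m n (Q : 'rV[R]_m -> 'rV[R]_n) (U : set 'rV[R]_m) z0 :
  open U -> U z0 -> Cinf U Q -> (forall w, exists u, 'd Q z0 u = w) ->
  exists (V : set 'rV[R]_m) (s : 'rV[R]_m -> 'rV[R]_m),
    [/\ open V, V z0, Cinf V s, s z0 = z0 &
      (forall z, V z -> U (s z) /\ Q (s z) = Q z0 + 'd Q z0 (z - z0)) /\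
      forall v, 'd s z0 v = v].
Proof.
move=> oU Uz0 QC dQs.
have dQ : differentiable Q z0 by exact: (QC 1).1.
pose J := lin1_mx ('d Q z0).
have JE v : v *m J = 'd Q z0 v by exact: mul_rV_lin1.
have [bs bsE] : exists bs : 'I_n -> 'rV[R]_m, forall j, 'd Q z0 (bs j) = delta_mx 0 j.
  by exists (fun j => sval (cid (dQs (delta_mx 0 j)))) => j; case: cid.
pose Bm : 'M[R]_(n, m) := \matrix_j bs j.
have BJ : Bm *m J = 1%:M.
  apply/row_matrixP => j; rewrite row_mul rowK JE bsE.
  by rewrite rowE mulmx1.
pose B : {linear 'rV[R]_n -> 'rV[R]_m} := mulmxr Bm.
pose D : {linear 'rV[R]_m -> 'rV[R]_n} := mulmxr (- J).
pose Phi (z : 'rV[R]_m) := z + B (Q z + D z + (z0 *m J - Q z0)).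
have Bc : continuous B by exact: lin_rV_continuous.
have Dc : continuous D by exact: lin_rV_continuous.
have PhiC : Cinf U Phi.
  move=> k; apply: CkD => //; first exact: Ck_id.
  apply: (Ck_comp_lin oU Bc).
  apply: CkD => //; last exact: Ck_cst.
  by apply: CkD; [exact: oU|exact: QC|exact: Ck_lin].
have PhiE z : Phi z *m J = Q z - Q z0 + z0 *m J.
  rewrite /Phi /B /D /= mulmxDl -mulmxA BJ mulmx1 mulmxN.
  move: (z *m J) (z0 *m J) => a b.
  by apply/rowP => i; rewrite !mxE; ring.
have Phi0 : Phi z0 = z0.
  rewrite /Phi /B /D /= mulmxN.
  have -> : Q z0 - z0 *m J + (z0 *m J - Q z0) = 0.
    by rewrite addrA subrK subrr.
  by rewrite mul0mx addr0.
have dPhi v : 'd Phi z0 v = v.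
  apply: diff_straightening => // u; rewrite /D /= mulmxN JE; exact: subrr.
have [V [s [oV Vz0 sC s0 sE]]] := inverse_function oU Uz0 PhiC dPhi.
rewrite Phi0 in Vz0 s0.
exists V, s; split; [exact: oV|exact: Vz0|exact: sC|exact: s0|split].
  move=> z /sE [Us Phis]; split; first exact: Us.
  have := PhiE (s z); rewrite Phis => E.
  by rewrite -JE mulmxBl E addrK addrC subrK.
have Us0 : U (s z0) by rewrite s0.
apply: (diff_right_id (f := Phi)).
- exact: (sC 1).1.
- exact: (PhiC 1).1.
- by rewrite s0; exact: dPhi.
- by apply: filterS (open_near oV Vz0) => y /sE [].
Qed.

End Straight.

(** * Derivatives of maps between manifolds *)

Section HasDer.
Context {R : realType}.

(** The part of the manifold axioms that concerns one chart at a time.  Products,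
coordinate spaces and the real line satisfy it without any discussion of
changes of charts, and it suffices for the chain rule below. *)
Record atlas n (M : @charted_space R n) : Prop := Atlas {
  open_dom : forall x : M, open (dom x);
  dom_self : forall x : M, dom x x;
  open_crd_dom : forall x : M, open (crd x @` dom x);
  crdK : forall x y : M, dom x y -> icrd x (crd x y) = y;
  crd_continuous : forall x y : M, dom x y -> {for y, continuous (crd x)};
  icrd_continuous : forall x y : M, dom x y -> {for crd x y, continuous (icrd x)} }.

Lemma smooth_manifold_atlas n (M : @charted_space R n) : smooth_manifold M -> atlas M.
Proof. by case=> _ _ H1 H2 H3 H4 H5 _; split=> // x; have [] := H1 x. Qed.

Lemma euclid_atlas n : atlas (@euclid R n).
Proof.
split=> //=; [by move=> _; exact: openT|move=> x|by move=> x y _; exact: cvg_id..].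
by rewrite image_id; exact: openT.
Qed.

Lemma cst_mx11 (v : 'rV[R]_1) : const_mx (v 0 0) = v.
Proof. by apply/rowP => i; rewrite mxE ord1. Qed.

Lemma const_mx1_continuous : continuous (fun t : R => const_mx t : 'rV[R]_1).
Proof.
move=> t.
suff /(_ t I) : Ck 0 setT (fun t : R => const_mx t : 'rV[R]_1) by [].
apply: Ck_rV => [|j]; first exact: openT.
by apply: (Ck_eq openT _ (Ck_id 0 setT)) => x _; rewrite mxE.
Qed.

Lemma real_line_atlas : atlas (@real_line R).
Proof.
split=> //=.
- by move=> _; exact: openT.
- move=> _; suff -> : (fun t : R => const_mx t : 'rV[R]_1) @` setT = setT by exact: openT.
  by apply/seteqP; split=> // v _; exists (v 0 0) => //; exact: cst_mx11.
- by move=> _ y _; rewrite mxE.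
- by move=> _ y _; exact: const_mx1_continuous.
- by move=> _ y _; exact: coord_continuous.
Qed.

Lemma row_mx_cvg (T : Type) (F : set_system T) (FF : Filter F) m n
    (f : T -> 'rV[R]_m) (g : T -> 'rV[R]_n) a b :
  f @ F --> a -> g @ F --> b -> (fun x => row_mx (f x) (g x) : 'rV[R]_(m + n)) @ F --> (row_mx a b : 'rV[R]_(m + n)).
Proof.
move=> fa gb.
pose L1 : {linear 'rV[R]_m -> 'rV[R]_(m + n)} := mulmxr (row_mx 1%:M 0).
pose L2 : {linear 'rV[R]_n -> 'rV[R]_(m + n)} := mulmxr (row_mx 0 1%:M).
have E u v : row_mx u v = L1 u + L2 v.
  rewrite /L1 /L2 /= !mul_mx_row !mulmx0 !mulmx1.
  by rewrite add_row_mx addr0 add0r.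
rewrite E; have -> : (fun x => row_mx (f x) (g x)) = fun x => L1 (f x) + L2 (g x).
  by apply/funext => x.
have c1 := @lin_rV_continuous R _ _ L1 a; have c2 := @lin_rV_continuous R _ _ L2 b.
by apply: cvgD; apply: continuous_cvg.
Qed.

Lemma prodm_atlas m n (M : @charted_space R m) (N : @charted_space R n) :
  atlas M -> atlas N -> atlas (prodm M N).
Proof.
move=> aM aN; split=> /=.
- move=> [x y] /=.
  have -> : dom x `*` dom y = (fst @^-1` dom x) `&` (snd @^-1` dom y) by [].
  apply: openI; apply: open_comp; try exact: open_dom.
  + by move=> z _; exact: cvg_fst.
  + by move=> z _; exact: cvg_snd.
- by move=> [x y]; split; exact: dom_self.
- move=> [x y] /=.
  suff -> : [set row_mx (crd x q.1) (crd y q.2) | q in dom x `*` dom y] =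
     lsubmx @^-1` (crd x @` dom x) `&` rsubmx @^-1` (crd y @` dom y).
    apply: openI; apply: open_comp; try exact: open_crd_dom.
    + by move=> z _; exact: continuous_lsubmx.
    + by move=> z _; exact: continuous_rsubmx.
  apply/seteqP; split=> [z [[a b] [/= da db] <-]|z [[a da az] [b db bz]]] /=.
    by rewrite row_mxKl row_mxKr; split; [exists a|exists b].
  by exists (a, b) => //=; rewrite az bz hsubmxK.
- by move=> [x y] [a b] [/= da db]; rewrite row_mxKl row_mxKr !crdK.
- move=> [x y] [a b] [/= da db]; apply: row_mx_cvg.
    apply: (@cvg_comp _ _ _ fst (crd x) _ (nbhs a)); first exact: cvg_fst.
    exact: crd_continuous.
  apply: (@cvg_comp _ _ _ snd (crd y) _ (nbhs b)); first exact: cvg_snd.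
  exact: crd_continuous.
- move=> [x y] [a b] [/= da db]; rewrite /prop_for /continuous_at row_mxKl row_mxKr.
  set z : 'rV[R]_(m + n) := row_mx (crd x a) (crd y b).
  have c1 : (lsubmx : 'rV[R]_(m + n) -> 'rV[R]_m) @ z --> crd x a.
    by have := @continuous_lsubmx R 1 m n z; rewrite /continuous_at row_mxKl.
  have c2 : (rsubmx : 'rV[R]_(m + n) -> 'rV[R]_n) @ z --> crd y b.
    by have := @continuous_rsubmx R 1 m n z; rewrite /continuous_at row_mxKr.
  have H1 := cvg_comp _ _ c1 (icrd_continuous aM da).
  have H2 := cvg_comp _ _ c2 (icrd_continuous aN db).
  exact: (cvg_pair H1 H2).
Qed.

(** [T] is the differential at [x], acting on row vectors, of a smooth local
extension of [f] off [A].  When [A] is [M x I], this is a derivative up to the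
endpoints of [I].  [T] is determined by [f] when [A] is a neighbourhood of [x],
and for curves on an interval by the uniqueness of one-sided limits. *)
Definition has_der m n (M : @charted_space R m) (N : @charted_space R n)
    (A : set M) (f : M -> N) (x : M) (T : 'M[R]_(m, n)) : Prop :=
  f @ within A (nbhs x) --> f x /\
  exists U (F : 'rV[R]_m -> 'rV[R]_n),
    [/\ open U /\ U (crd x x), U `<=` crd x @` dom x, Cinf U F,
        forall z, U z -> A (icrd x z) -> crd (f x) (f (icrd x z)) = F z &
        forall u, 'd F (crd x x) u = u *m T].

Lemma smooth_on_has_der m n (M : @charted_space R m) (N : @charted_space R n)
    (A : set M) (f : M -> N) x : smooth_on A f -> A x -> exists T, has_der A f x T.
Proof.
move=> H Ax; have [fx [U [F [oU Ux sU FC FE]]]] := H x Ax.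
exists (lin1_mx ('d F (crd x x))); split=> //; exists U, F; split=> // u.
by rewrite mul_rV_lin1.
Qed.

Lemma has_der_smooth_on m n (M : @charted_space R m) (N : @charted_space R n)
    (A : set M) (f : M -> N) :
  (forall x, A x -> exists T, has_der A f x T) -> smooth_on A f.
Proof.
move=> H x /H [T [fx [U [F [[oU Ux] sU FC FE _]]]]]; split=> //.
by exists U, F.
Qed.

(** Both derivatives use the chart at [f x], which makes the chain rule hold
without changes of charts. *)
Lemma has_der_comp m n p (M : @charted_space R m) (N : @charted_space R n)
    (P : @charted_space R p) (A : set M) (B : set N) (f : M -> N) (g : N -> P)
    x T T' : atlas M -> atlas N ->
  has_der A f x T -> has_der B g (f x) T' -> A x ->
  (\forall y \near x, A y -> B (f y)) ->
  has_der A (g \o f) x (T *m T').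
Proof.
move=> aM aN [fx [U [F [[oU Ux] sU FC FE dF]]]] [gx [U' [F' [[oU' Ux'] sU' FC' FE' dF']]]] Ax AB.
have Fx : F (crd x x) = crd (f x) (f x).
  by rewrite -FE // crdK //; exact: dom_self.
have dFx : differentiable F (crd x x) by exact: (FC 1).1.
have Fc : {for crd x x, continuous F} by exact: differentiable_continuous.
have fd : \forall y \near x, A y -> dom (f x) (f y).
  by have := fx _ (open_nbhs_nbhs (conj (open_dom aN (f x)) (dom_self aN (f x)))).
have ic : {for crd x x, continuous (icrd x)} by apply: icrd_continuous => //; exact: dom_self.
have ixx : icrd x (crd x x) = x by rewrite crdK //; exact: dom_self.
split.
  apply: cvg_trans gx => Q HQ.
  have H1 : \forall y \near x, A y -> B (f y) -> Q (g (f y)) by exact: fx HQ.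
  suff : \forall y \near x, A y -> Q (g (f y)) by [].
  by apply: filterS2 H1 AB => y H2 H3 Ay; apply: (H2 Ay); exact: H3.
pose G := [set z | A (icrd x z) -> dom (f x) (f (icrd x z)) /\ B (f (icrd x z))].
have nG : nbhs (crd x x) G.
  have : nbhs (icrd x (crd x x)) [set y | A y -> dom (f x) (f y) /\ B (f y)].
    by rewrite ixx; apply: filterS2 fd AB => y H1 H2 Ay; split; [exact: H1|exact: H2].
  exact: ic.
have nU : nbhs (crd x x) U by exact: (open_near oU Ux).
have nF : nbhs (crd x x) (F @^-1` U').
  by apply: Fc; rewrite Fx; exact: (open_near oU' Ux').
have [W [oW Wx] sW] : exists2 W, open_nbhs (crd x x) W & W `<=` U `&` (F @^-1` U') `&` G.
  have : nbhs (crd x x) (U `&` (F @^-1` U') `&` G) by apply: filterI => //; exact: filterI.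
  by rewrite nbhsE => -[W ? ?]; exists W.
exists W, (F' \o F); split=> //.
- by move=> z /sW [[/sU]].
- move=> k; apply: (Ck_comp oW _ _ (FC' k)); first by move=> z /sW [[]].
  by apply: Ck_sub (FC k) => z /sW [[]].
- move=> z /sW [[Uz U'z] Gz] Az; have [dz Bz] := Gz Az.
  have E := FE _ Uz Az; have E2 : icrd (f x) (F z) = f (icrd x z) by rewrite -E crdK.
  by have := FE' _ U'z; rewrite E2 => /(_ Bz).
move=> u; have dF'x : differentiable F' (F (crd x x)) by rewrite Fx; exact: (FC' 1).1.
have E := diff_comp dFx dF'x.
apply: (etrans (congr1 (@^~ u) E)) => /=.
by rewrite Fx dF' dF mulmxA.
Qed.

End HasDer.

Section HasDer2.
Context {R : realType}.

Lemma has_der_eq m n (M : @charted_space R m) (N : @charted_space R n)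
    (A A' : set M) (f g : M -> N) x T : atlas M ->
  has_der A f x T -> f x = g x -> (\forall y \near x, A' y -> A y /\ f y = g y) ->
  has_der A' g x T.
Proof.
move=> aM [fx [U [F [[oU Ux] sU FC FE dF]]]] fgx fg; split.
  rewrite -fgx => Q HQ.
  have H1 : \forall y \near x, A y -> Q (f y) by exact: fx HQ.
  suff : \forall y \near x, A' y -> Q (g y) by [].
  apply: filterS2 fg H1 => y H2 H3 A'y.
  by have [Ay <-] := H2 A'y; exact: H3.
have ixx : icrd x (crd x x) = x by rewrite crdK //; exact: dom_self.
have ic : {for crd x x, continuous (icrd x)} by apply: icrd_continuous => //; exact: dom_self.
pose G := [set z | A' (icrd x z) -> A (icrd x z) /\ f (icrd x z) = g (icrd x z)].
have nG : nbhs (crd x x) G.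
  have : nbhs (icrd x (crd x x)) [set y | A' y -> A y /\ f y = g y] by rewrite ixx.
  exact: ic.
have nU : nbhs (crd x x) U by exact: (open_near oU Ux).
have [W [oW Wx] sW] : exists2 W, open_nbhs (crd x x) W & W `<=` U `&` G.
  have : nbhs (crd x x) (U `&` G) by exact: filterI.
  by rewrite nbhsE => -[W ? ?]; exists W.
exists W, F; split=> //.
- by move=> z /sW [/sU].
- by move=> k; apply: Ck_sub (FC k) => z /sW [].
- move=> z /sW [Uz Gz] A'z; have [Az <-] := Gz A'z.
  by rewrite -fgx; exact: FE.
Qed.

Lemma has_der_subset m n (M : @charted_space R m) (N : @charted_space R n)
    (A A' : set M) (f : M -> N) x T : atlas M -> A' `<=` A ->
  has_der A f x T -> has_der A' f x T.
Proof.
move=> aM sA H; apply: (has_der_eq aM H) => //.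
by apply: nearW => y /sA.
Qed.

(** Projections, constants, the identity and affine maps all have this form. *)
Lemma has_der_coord m n (M : @charted_space R m) (N : @charted_space R n)
    (A : set M) (f : M -> N) x (T : 'M[R]_(m, n)) c : atlas M ->
  f @ within A (nbhs x) --> f x ->
  (forall y, dom x y -> A y -> crd (f x) (f y) = crd x y *m T + c) ->
  has_der A f x T.
Proof.
move=> aM fx fE; split=> //.
pose L : {linear 'rV[R]_m -> 'rV[R]_n} := mulmxr T.
have Lc : continuous L by exact: lin_rV_continuous.
exists (crd x @` dom x), (fun z => L z + c); split.
- by split; [exact: open_crd_dom|exists x => //; exact: dom_self].
- by [].
- move=> k; apply: CkD; first exact: open_crd_dom.
    exact: Ck_lin.
  exact: Ck_cst.
- by move=> z [y dy <-]; rewrite crdK // => Ay; rewrite fE.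
move=> u; have dL : is_diff (crd x x) L L.
  by apply: DiffDef; [exact: linear_differentiable|exact: diff_lin].
have E := @diff_val _ _ _ _ _ _ _ (is_diffD dL (is_diff_cst c (crd x x))).
by apply: (etrans (congr1 (@^~ u) E)); rewrite /GRing.add /= /GRing.zero /= addr0.
Qed.

Lemma has_der_id m (M : @charted_space R m) (A : set M) x : atlas M ->
  has_der A (@idfun M) x 1%:M.
Proof.
move=> aM; apply: (has_der_coord (c := 0) aM) => [|y _ _]; last by rewrite mulmx1 addr0.
exact: cvg_within.
Qed.

Lemma has_der_cst m n (M : @charted_space R m) (N : @charted_space R n)
    (A : set M) (c : N) x : atlas M -> has_der A (fun=> c) x 0.
Proof.
move=> aM; apply: (has_der_coord (c := crd c c) aM) => [|y _ _]; last by rewrite mulmx0 add0r.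
exact: cvg_cst.
Qed.

Lemma has_der_fst m n (M : @charted_space R m) (N : @charted_space R n)
    (A : set (prodm M N)) p : atlas M -> atlas N ->
  has_der A (fst : prodm M N -> M) p (col_mx 1%:M 0).
Proof.
move=> aM aN; apply: (has_der_coord (c := 0) (prodm_atlas aM aN)) => [|[y1 y2] _ _ /=].
  by apply: cvg_within_filter; exact: cvg_fst.
by rewrite mul_row_col mulmx1 mulmx0 !addr0.
Qed.

Lemma has_der_snd m n (M : @charted_space R m) (N : @charted_space R n)
    (A : set (prodm M N)) p : atlas M -> atlas N ->
  has_der A (snd : prodm M N -> N) p (col_mx 0 1%:M).
Proof.
move=> aM aN; apply: (has_der_coord (c := 0) (prodm_atlas aM aN)) => [|[y1 y2] _ _ /=].
  by apply: cvg_within_filter; exact: cvg_snd.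
by rewrite mul_row_col mulmx1 mulmx0 add0r addr0.
Qed.

Lemma has_der_pair k m n (P : @charted_space R k) (M : @charted_space R m)
    (N : @charted_space R n) (A : set P) (f : P -> M) (g : P -> N) x T T' :
  atlas P -> has_der A f x T -> has_der A g x T' ->
  has_der A ((fun y => (f y, g y)) : P -> prodm M N) x (row_mx T T').
Proof.
move=> aP [fx [U [F [[oU Ux] sU FC FE dF]]]] [gx [U' [F' [[oU' Ux'] sU' FC' FE' dF']]]].
split; first exact: (cvg_pair fx gx).
have oW : open (U `&` U') by exact: openI.
pose L1 : {linear 'rV[R]_m -> 'rV[R]_(m + n)} := mulmxr (row_mx 1%:M 0).
pose L2 : {linear 'rV[R]_n -> 'rV[R]_(m + n)} := mulmxr (row_mx 0 1%:M).
have L1c : continuous L1 by exact: lin_rV_continuous.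
have L2c : continuous L2 by exact: lin_rV_continuous.
have E u v : row_mx u v = L1 u + L2 v.
  rewrite /L1 /L2 /= !mul_mx_row !mulmx0 !mulmx1.
  by rewrite add_row_mx addr0 add0r.
exists (U `&` U'), (fun z => L1 (F z) + L2 (F' z)); split=> //.
- by move=> z [/sU].
- move=> j; apply: CkD => //; apply: Ck_comp_lin => //.
    by apply: Ck_sub (FC j) => z [].
  by apply: Ck_sub (FC' j) => z [].
- by move=> z [Uz U'z] Az /=; rewrite -FE // -FE' // E.
move=> u; rewrite mul_mx_row E -dF -dF'.
have /differentiableP d1 : differentiable F (crd x x) by exact: (FC 1).1.
have /differentiableP d2 : differentiable F' (crd x x) by exact: (FC' 1).1.
have dL1 : is_diff (F (crd x x)) L1 L1.
  by apply: DiffDef; [exact: linear_differentiable|exact: diff_lin].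
have dL2 : is_diff (F' (crd x x)) L2 L2.
  by apply: DiffDef; [exact: linear_differentiable|exact: diff_lin].
have EE := @diff_val _ _ _ _ _ _ _ (is_diffD (is_diff_comp d1 dL1) (is_diff_comp d2 dL2)).
exact: (congr1 (@^~ u) EE).
Qed.

Lemma has_der_mdiff m n (M : @charted_space R m) (N : @charted_space R n)
    (A : set M) (f : M -> N) x T u : atlas M ->
  nbhs x A -> has_der A f x T -> mdiff f x u = u *m T.
Proof.
move=> aM nA [fx [U [F [[oU Ux] sU FC FE dF]]]]; rewrite -dF.
have dFx : differentiable F (crd x x) by exact: (FC 1).1.
have ixx : icrd x (crd x x) = x by rewrite crdK //; exact: dom_self.
have ic : {for crd x x, continuous (icrd x)} by apply: icrd_continuous => //; exact: dom_self.
have nG : \forall z \near crd x x, A (icrd x z).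
  by have : nbhs (icrd x (crd x x)) A; [rewrite ixx|exact: ic].
have nU : \forall z \near crd x x, U z by exact: (open_near oU Ux).
have H : \forall z \near crd x x, F z = (crd (f x) \o f \o icrd x) z.
  by apply: filterS2 nU nG => z Uz Az /=; rewrite FE.
have [_ E] := diff_near_eq H dFx.
exact: (congr1 (@^~ u) E).
Qed.

Lemma mx_row_inj m n (T T' : 'M[R]_(m, n)) :
  (forall u : 'rV[R]_m, u *m T = u *m T') -> T = T'.
Proof. by move=> H; apply/row_matrixP => i; rewrite !rowE. Qed.

Lemma has_der_unique m n (M : @charted_space R m) (N : @charted_space R n)
    (A A' : set M) (f : M -> N) x T T' : atlas M -> nbhs x A -> nbhs x A' ->
  has_der A f x T -> has_der A' f x T' -> T = T'.
Proof.
move=> aM nA nA' H H'; apply: mx_row_inj => u.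
by rewrite -(has_der_mdiff u aM nA H) (has_der_mdiff u aM nA' H').
Qed.

Lemma has_der_dfun m (M : @charted_space R m) (A : set M) (f : M -> R) x T u :
  atlas M -> nbhs x A -> has_der (N := real_line) A f x T -> dfun f x u = (u *m T) 0 0.
Proof.
move=> aM nA [fx [U [F [[oU Ux] sU FC FE dF]]]]; rewrite -dF.
have dFx : differentiable F (crd x x) by exact: (FC 1).1.
have ixx : icrd x (crd x x) = x by rewrite crdK //; exact: dom_self.
have ic : {for crd x x, continuous (icrd x)} by apply: icrd_continuous => //; exact: dom_self.
have nG : \forall z \near crd x x, A (icrd x z).
  by have : nbhs (icrd x (crd x x)) A; [rewrite ixx|exact: ic].
have nU : \forall z \near crd x x, U z by exact: (open_near oU Ux).
have [L Lc LE] := coord_lin_continuous (R := R) (m := 1) (n := 1) 0 0.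
have dL := linear_differentiable (F (crd x x)) Lc.
have H : \forall z \near crd x x, (L \o F) z = (f \o icrd x) z.
  by apply: filterS2 nU nG => z Uz Az /=; rewrite LE -FE // mxE.
have [_ E] := diff_near_eq H (differentiable_comp dFx dL).
have E2 := diff_comp dFx dL.
have E3 : 'd L (F (crd x x)) = L :> (_ -> _) by exact: diff_lin.
apply: (etrans (congr1 (@^~ u) E)); apply: (etrans (congr1 (@^~ u) E2)).
by apply: (etrans (congr1 (@^~ _) E3)); rewrite LE.
Qed.

Lemma has_der_grad m (M : @charted_space R m) (A : set M) (f : M -> R) x T :
  atlas M -> nbhs x A -> has_der (N := real_line) A f x T -> grad f x = T^T.
Proof.
move=> aM nA H; apply/rowP => j.
by rewrite !mxE (has_der_dfun _ aM nA H) -rowE mxE.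
Qed.

End HasDer2.

(** * Velocities of curves and limits inside an interval *)

Section Vel.
Context {R : realType}.

Lemma dquot_cvg (V : normedModType R) (f : R -> V) (t : R) :
  differentiable f t -> dquot f t @ t^' --> 'd f t 1.
Proof.
move=> df; apply/cvgrPdist_le => e e0.
have H := diff_eps df e0.
have H2 : \forall s \near t, `|f s - f t - 'd f t (s - t)| <= e * `|s - t|.
  by rewrite (near_shift 0 t); apply: filterS H => h; rewrite /= subr0 addrK.
near=> s.
have st0 : s - t != 0 by rewrite subr_eq0; near: s; exact: nbhs_dnbhs_neq.
have Hs : `|f s - f t - 'd f t (s - t)| <= e * `|s - t|.
  by near: s; exact: cvg_within.
rewrite -(ler_pM2l (x := `|s - t|)) ?normr_gt0 // -normrZ mulrC.
rewrite mulrC [leRHS]mulrC; apply: le_trans Hs.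
have -> : (s - t) *: ('d f t 1 - dquot f t s) = - (f s - f t - 'd f t (s - t)).
  rewrite /dquot; have -> : 'd f t (s - t) = (s - t) *: 'd f t 1.
    by rewrite -linearZ /= /GRing.scale /= mulr1.
  have aux (a : R) (u v : V) : a != 0 -> a *: (u - a^-1 *: v) = - (v - a *: u).
    by move=> a0; rewrite scalerBr scalerA mulfV // scale1r opprB.
  exact: aux.
by rewrite normrN.
Unshelve. all: by end_near. Qed.

(** Properness is what makes limits inside [I] unique, also at an endpoint. *)
Lemma interval_within_proper (I : set R) t : is_interval I -> I t ->
  (exists2 t', I t' & t' != t) -> ProperFilter (within I t^').
Proof.
move=> iI It [t' It' tt'].
apply: Build_ProperFilter_ex => P HP.
have {}HP : \forall s \near t, s != t -> I s -> P s by [].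
have /nbhs_normP [e /= e0 He] := HP.
have d0 : 0 < `|t' - t| by rewrite normr_gt0 subr_eq0.
pose th := Num.min 1 (e / (2 * `|t' - t|)).
have th0 : 0 < th by rewrite lt_min ltr01 divr_gt0 // mulr_gt0.
have th1 : th <= 1 by rewrite ge_min lexx.
have the : th * `|t' - t| < e.
  have : th <= e / (2 * `|t' - t|) by rewrite ge_min lexx orbT.
  rewrite ler_pdivlMr ?mulr_gt0 // => H.
  by have := mulr_gt0 th0 d0; lra.
pose s := t + th * (t' - t).
exists s; apply: He.
- by rewrite /= /s opprD addrA subrr sub0r normrN normrM (gtr0_norm th0).
- have -> : (s == t) = (s - t == 0) by rewrite subr_eq0.
  by rewrite /s addrAC subrr add0r; apply: mulf_neq0; [rewrite gt_eqF|rewrite subr_eq0].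
have [tlt|tlt] := leP t t'.
  have u0 : 0 <= th * (t' - t) by rewrite mulr_ge0 ?subr_ge0 // ltW.
  have u1 : th * (t' - t) <= 1 * (t' - t) by rewrite ler_wpM2r // subr_ge0.
  by apply: (iI t t') => //; apply/andP; split; rewrite /s; lra.
have u0 : 0 <= th * (t - t') by rewrite mulr_ge0 ?subr_ge0 // ltW.
have u1 : th * (t - t') <= 1 * (t - t') by rewrite ler_wpM2r // subr_ge0 ltW.
by apply: (iI t' t) => //; apply/andP; split; rewrite /s; lra.
Qed.

(** The smooth extension of a curve off the interval has an ordinary derivative,
of which the difference quotients inside the interval are a restriction. *)
Lemma has_der_dquot (I : set R) m (M : @charted_space R m) (A : set R)
    (c : R -> M) t (T : 'rV[R]_m) :
  has_der (M := real_line) A c t T -> I t -> A t ->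
  (\forall s \near t, I s -> A s) -> velocity I c t T.
Proof.
move=> [ct [U [F [[oU Ut] sU FC FE dF]]]] It At IA.
rewrite /velocity.
pose cm (s : R) : 'rV[R]_1 := s *: const_mx 1.
have cmE s : const_mx s = cm s by apply/rowP => i; rewrite !mxE mulr1.
have dcm : is_diff t cm ( *:%R^~ (const_mx 1)) by exact: is_diff_scalel.
have crdt : @crd R 1 real_line t t = cm t by exact: cmE.
have dFt : differentiable F (cm t) by rewrite -crdt; exact: (FC 1).1.
have dG : differentiable (F \o cm) t by exact: differentiable_comp.
have E : 'd (F \o cm) t 1 = T.
  have E1 := diff_comp (@ex_diff _ _ _ _ _ _ _ dcm) dFt.
  have E2 := @diff_val _ _ _ _ _ _ _ dcm.
  apply: (etrans (congr1 (@^~ 1) E1)); apply: (etrans (congr1 ('d F (cm t)) (congr1 (@^~ 1) E2))).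
  rewrite scale1r -crdt dF; apply/rowP => i.
  by rewrite mxE big_ord1 mxE mul1r; congr (T _ _); exact/val_inj.
rewrite -E; have := dquot_cvg dG.
move=> H; have {}H : dquot (F \o cm) t @ within I t^' --> 'd (F \o cm) t 1.
  exact: cvg_within_filter.
apply: cvg_trans H; apply: near_eq_cvg.
have nU : \forall s \near t, U (cm s).
  have /differentiable_continuous : differentiable cm t by exact: ex_diff.
  apply; rewrite -crdt; exact: (open_near oU Ut).
have FEs s : U (cm s) -> A s -> F (cm s) = crd (c t) (c s).
  have is_s : @icrd R 1 real_line t (cm s) = s by rewrite /= -cmE mxE.
  by move=> Us As; have := FE _ Us; rewrite is_s => /(_ As).
suff : \forall s \near t, s != t -> I s ->
    dquot (F \o cm) t s = dquot (crd (c t) \o c) t s by [].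
apply: filterS2 nU IA => s Us IAs _ Is.
by rewrite /dquot /= (FEs _ Us (IAs Is)) (FEs t) // -crdt.
Qed.

Lemma velocity_unique (I : set R) m (M : @charted_space R m) (c : R -> M) t v v' :
  ProperFilter (within I t^') -> velocity I c t v -> velocity I c t v' -> v = v'.
Proof.
move=> PF H H'; exact: (cvg_unique _ H H').
Qed.

End Vel.

(** * Submanifolds and their tangent vectors *)

Section Slice.
Context {R : realType}.

Lemma near_all (T : topologicalType) (x : T) (P : T -> Prop) :
  (forall y, P y) -> \forall y \near x, P y.
Proof. exact: nearW. Qed.

(** Composed with the projection [delta_mx j j] the map is constantly 0, so its
derivative vanishes by uniqueness. *)
Lemma has_der_coord0 m d (X : @charted_space R m) (A : set X)
    (f : X -> @euclid R d) x T (j : 'I_d) (u : 'rV[R]_m) : atlas X -> A x -> nbhs x A ->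
  has_der A f x T -> (\forall y \near x, (f y : 'rV[R]_d) 0 j = 0) ->
  (u *m T) 0 j = 0.
Proof.
move=> aX Ax nA H f0.
pose E : @euclid R d -> @euclid R d := fun v => (v : 'rV[R]_d) *m delta_mx j j.
have EE (v : 'rV[R]_d) i : (v *m delta_mx j j) 0 i = v 0 j *+ (i == j).
  rewrite mxE (bigD1 j) //= big1 => [|l lj]; last by rewrite mxE (negbTE lj) mulr0.
  by rewrite mxE eqxx addr0 mulr_natr.
have Ec : continuous (E : 'rV[R]_d -> 'rV[R]_d).
  exact: (lin_rV_continuous (L := mulmxr (delta_mx j j))).
have HE : has_der setT E (f x) (delta_mx j j).
  apply: (has_der_coord (c := 0) (euclid_atlas d)) => [|y _ _ /=]; last by rewrite addr0.
  by apply: cvg_within_filter; exact: Ec.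
have H1 := has_der_comp aX (euclid_atlas d) H HE Ax (near_all _ (fun _ _ => I)).
pose c0 : X -> @euclid R d := fun=> (0 : 'rV[R]_d).
have H2 : has_der A c0 x (T *m delta_mx j j).
  apply: (has_der_eq aX H1).
    by apply/rowP => i; rewrite EE (nbhs_singleton f0) mul0rn mxE.
  apply: filterS f0 => y fy0 Ay; split=> //.
  by apply/rowP => i; rewrite EE fy0 mul0rn mxE.
have H3 : has_der A c0 x 0 := has_der_cst (N := @euclid R d) A (0 : 'rV[R]_d) x aX.
have H4 := has_der_unique aX nA nA H2 H3.
by have := EE (u *m T) j; rewrite -mulmxA H4 mulmx0 mxE eqxx.
Qed.

Lemma slice_chart_has_der d (N : @charted_space R d) (A S : set N) k W Psi iPsi x :
  atlas N -> slice_chart A S k W Psi iPsi -> W x ->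
  exists TP TI, [/\ has_der (N := euclid d) W Psi x TP,
    has_der (M := euclid d) (Psi @` W) iPsi (Psi x) TI, TP *m TI = 1%:M &
    forall v, mdiff (Psi : N -> euclid d) x v = v *m TP].
Proof.
move=> aN [oW sPsi oPW siPsi PK _] Wx.
have nW : nbhs x W by exact: (open_near oW Wx).
have PWx : (Psi @` W) (Psi x) by exists x.
have [TP HP] := smooth_on_has_der sPsi Wx.
have [TI HI] := smooth_on_has_der siPsi PWx.
exists TP, TI; split=> // [|v]; last by rewrite (has_der_mdiff v aN nW HP).
have H1 := has_der_comp aN (euclid_atlas d) HP HI Wx
  (near_all _ (fun y Wy => ex_intro2 _ _ y Wy erefl)).
have H2 : has_der W (@idfun N) x (TP *m TI).
  apply: (has_der_eq aN H1); first by rewrite /= PK.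
  by apply: nearW => y Wy; split; rewrite //= PK.
exact: (has_der_unique aN nW nW H2 (has_der_id W x aN)).
Qed.

(** Tangent vectors are defined through a chosen slice chart; this shows that
velocities of maps into [S] satisfy the equations of every slice chart. *)
Lemma slice_tangent d m (N : @charted_space R d) (A S : set N) k W Psi iPsi
    (X : @charted_space R m) (B : set X) (f : X -> N) x T (u : 'rV[R]_m) (j : 'I_d) :
  atlas N -> atlas X -> slice_chart A S k W Psi iPsi -> S `<=` A ->
  B x -> nbhs x B -> W (f x) -> has_der B f x T ->
  (\forall y \near x, S (f y)) -> (k <= j)%N ->
  mdiff (Psi : N -> euclid d) (f x) (u *m T) 0 j = 0.
Proof.
move=> aN aX sc SA Bx nB Wfx H Sf kj.
have [TP [TI [HP HI _ ->]]] := slice_chart_has_der aN sc Wfx.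
have [oW _ _ _ _ SE] := sc.
have Wf : \forall y \near x, B y -> W (f y).
  by have [fc _] := H; have := fc W (open_near oW Wfx).
have H1 := has_der_comp aX aN H HP Bx Wf.
rewrite -mulmxA; apply: (has_der_coord0 u aX Bx nB H1).
apply: filterS2 (filterI Wf nB) Sf => y [Wy By] Sy /=.
by have /SE := Wy By; move=> /(_ (SA _ Sy)) [+ _]; apply.
Qed.

Lemma row_tail_pid d k (w : 'rV[R]_d) :
  (forall j : 'I_d, (k <= j)%N -> w 0 j = 0) -> w *m pid_mx k = w.
Proof.
move=> H; apply/rowP => i; rewrite mxE (bigD1 i) //= big1 => [|l li].
  rewrite mxE eqxx /= addr0; have [ik|ki] := ltnP i k; first by rewrite mulr1.
  by rewrite H // mul0r.
by rewrite mxE (inj_eq val_inj) (negbTE li) mulr0.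
Qed.

(** The slice chart gives the parametrisation [z |-> iPsi (Psi x + z pi_k)] of [S],
where [pi_k] keeps the first [k] coordinates.  Since [A] may have a boundary
the parametrisation can leave [A]; only its points in [A] lie on [S]. *)
Lemma slice_param d (N : @charted_space R d) (A S : set N) k W Psi iPsi x :
  atlas N -> slice_chart A S k W Psi iPsi -> S `<=` A -> W x -> S x ->
  exists (th : @euclid R d -> N) TT (O : set (@euclid R d)),
    [/\ open O, O (0 : 'rV[R]_d), th (0 : 'rV[R]_d) = x & [/\ has_der O th (0 : 'rV[R]_d) TT,
      forall z, O z -> A (th z) -> S (th z) &
      forall u, (forall j : 'I_d, (k <= j)%N ->
          mdiff (Psi : N -> euclid d) x u 0 j = 0) ->
        exists w, u = w *m TT]].
Proof.
move=> aN sc SA Wx Sx.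
have [TP [TI [HP HI TPI PE]]] := slice_chart_has_der aN sc Wx.
have [oW sPsi oPW siPsi PK SE] := sc.
pose al : @euclid R d -> @euclid R d := fun z => Psi x + (z : 'rV[R]_d) *m pid_mx k.
have alc : continuous (al : 'rV[R]_d -> 'rV[R]_d).
  have C : Ck 0 setT (fun z : 'rV[R]_d => Psi x + z *m pid_mx k).
    apply: CkD; [exact: openT|exact: Ck_cst|].
    apply: (Ck_lin 0 setT (L := mulmxr (pid_mx k))); exact: lin_rV_continuous.
  by move=> z; exact: (C z).
have Hal : has_der setT al (0 : 'rV[R]_d) (pid_mx k).
  apply: (has_der_coord (c := Psi x) (euclid_atlas d)) => [|y _ _ /=]; last by rewrite addrC.
  by apply: cvg_within_filter; exact: (alc 0).
have al0 : al (0 : 'rV[R]_d) = Psi x by rewrite /al mul0mx addr0.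
pose O := al @^-1` (Psi @` W).
have oO : open O by exact: (open_comp (fun z _ => alc z) oPW).
have O0 : O (0 : 'rV[R]_d) by rewrite /O /= al0; exists x.
have HalO : has_der O al (0 : 'rV[R]_d) (pid_mx k) by exact: (has_der_subset (euclid_atlas d) _ Hal).
rewrite -al0 in HI.
have Hth := has_der_comp (euclid_atlas d) (euclid_atlas d) HalO HI O0 (near_all _ (fun y Oy => Oy)).
exists (iPsi \o al), (pid_mx k *m TI), O; split=> //; first by rewrite /= al0 PK.
split=> // [z [y Wy yz] Az|u Hu].
  rewrite /= -yz PK // in Az *; apply/(SE _ Wy Az) => j kj.
  rewrite yz /al mxE.
  have /(SE _ Wx (SA _ Sx)) /(_ _ kj) -> := Sx.
  rewrite add0r mxE big1 // => l _; rewrite mxE.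
  have [ll|] /= := eqVneq (l : nat) j; last by rewrite mulr0.
  by rewrite ll ltnNge kj /= mulr0.
exists (u *m TP); rewrite mulmxA row_tail_pid; last by move=> j kj; rewrite -PE Hu.
by rewrite -mulmxA TPI mulmx1.
Qed.

End Slice.

(** * Local sections and fibres of submersions *)

Section Sub.
Context {R : realType}.

Lemma has_der_near m n (M : @charted_space R m) (N : @charted_space R n)
    (A : set M) (f : M -> N) x T (P : set N) :
  has_der A f x T -> nbhs (f x) P -> \forall y \near x, A y -> P (f y).
Proof. by move=> [fx _] /fx. Qed.

(** Straightening the submersion in the charts at [x] and [f x]. *)
Lemma submersion_chart m n (X : @charted_space R m) (Y : @charted_space R n)
    (A : set X) (f : X -> Y) x (T : 'M[R]_(m, n)) :
  atlas X -> atlas Y -> nbhs x A -> has_der A f x T ->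
  (forall w : 'rV[R]_n, exists u, u *m T = w) ->
  exists (S : @euclid R m -> X) (O : set (@euclid R m)),
    [/\ open O, O (0 : 'rV[R]_m), S (0 : 'rV[R]_m) = x &
      has_der O S (0 : 'rV[R]_m) 1%:M /\
      forall z, O z -> [/\ A (S z), dom (f x) (f (S z)) &
        crd (f x) (f (S z)) = crd (f x) (f x) + (z : 'rV[R]_m) *m T]].
Proof.
move=> aX aY nA H surj.
have [fc [U [F [[oU Ux] sU FC FE dF]]]] := H.
have surj' w : exists u, 'd F (crd x x) u = w.
  by have [u uT] := surj w; exists u; rewrite dF.
have [V [s [oV Vx sC s0 [sE ds]]]] := submersion_straightening oU Ux FC surj'.
pose tr (z : 'rV[R]_m) := crd x x + z.
have trC : Cinf setT tr.
  by move=> k; apply: CkD; [exact: openT|exact: Ck_cst|exact: Ck_id].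
have tr0 : tr 0 = crd x x by rewrite /tr addr0.
have trc : continuous tr by move=> z; exact: (trC 0 z).
pose O1 := tr @^-1` V.
have oO1 : open O1 by exact: (open_comp (fun z _ => trc z) oV).
have O10 : O1 0 by rewrite /O1 /= tr0.
have stC : Cinf O1 (s \o tr).
  move=> k; apply: (Ck_comp oO1 _ _ (sC k)) => //.
  exact: Ck_sub (trC k).
pose S : @euclid R m -> X := fun z => icrd x (s (tr z)).
have xx : icrd x (crd x x) = x by rewrite crdK //; exact: dom_self.
have S0 : S (0 : 'rV[R]_m) = x by rewrite /S tr0 s0.
have stc : {for (0 : 'rV[R]_m), continuous (s \o tr)} by exact: (Ck_cont (stC 0)).
have Sc : {for (0 : 'rV[R]_m), continuous (S : 'rV[R]_m -> X)}.
  have ic : {for (s \o tr) 0, continuous (icrd x)}.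
    by rewrite /= tr0 s0; apply: icrd_continuous => //; exact: dom_self.
  exact: (@continuous_comp _ _ _ (s \o tr) (icrd x)).
have nS : \forall z \near (0 : 'rV[R]_m), A (S z) /\ dom (f x) (f (S z)).
  have nfx : nbhs (f x) (dom (f x)) by exact: (open_near (open_dom aY _) (dom_self aY _)).
  have H1 : nbhs (S (0 : 'rV[R]_m)) (fun y => A y /\ dom (f x) (f y)).
    rewrite S0; apply: filterS2 nA (has_der_near H nfx) => y Ay fy; split=> //; exact: fy.
  exact: Sc H1.
have [ O [oO O0] sO] : exists2 O, open_nbhs (0 : 'rV[R]_m) O &
    O `<=` O1 `&` [set z | A (S z) /\ dom (f x) (f (S z))].
  have : nbhs (0 : 'rV[R]_m) (O1 `&` [set z | A (S z) /\ dom (f x) (f (S z))]).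
    by apply: filterI nS; exact: (open_near oO1 O10).
  by rewrite nbhsE => -[ O ? ?]; exists O.
have crdS z : O z -> crd x (S z) = s (tr z).
  move=> /sO [/sE [/sU [y dy yE] _] _]; by rewrite /S -yE crdK.
have trS z : tr z - crd x x = z by rewrite /tr addrC addKr.
exists S, O; split; [exact: oO|exact: O0|exact: S0|split].
  split; first by apply: cvg_within_filter; exact: Sc.
  exists O, (s \o tr); split.
  - by split; [exact: oO|exact: O0].
  - by move=> z _; exists z.
  - by move=> k; apply: Ck_sub (stC k) => z /sO [].
  - by move=> z Oz _; rewrite S0; exact: crdS.
  move=> u; have dtr : is_diff (0 : 'rV[R]_m) tr (fun v => 0 + v).
    exact: (is_diffD (is_diff_cst (crd x x) 0) (is_diff_id 0)).
  have dtr1 : differentiable tr 0 by exact: ex_diff.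
  have ds1 : differentiable s (tr 0) by rewrite tr0; exact: (sC 1).1.
  apply: (etrans (congr1 (@^~ u) (diff_comp dtr1 ds1))) => /=.
  rewrite tr0 ds mulmx1.
  by apply: (etrans (congr1 (@^~ u) (@diff_val _ _ _ _ _ _ _ dtr))); rewrite add0r.
move=> z Oz; have [ O1z [ASz dS]] := sO z Oz; split=> //.
have [Us Fs] := sE _ O1z.
have -> : crd (f x) (f (S z)) = F (s (tr z)) by rewrite -(FE _ Us).
rewrite Fs dF trS; congr (_ + _); rewrite -FE // xx //; exact: nbhs_singleton nA.
Qed.

Lemma open_nbhs_sub (T : topologicalType) (x : T) (P : set T) : nbhs x P ->
  exists B, [/\ open B, B x & B `<=` P].
Proof. by rewrite nbhsE => -[B [oB Bx] sB]; exists B. Qed.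

(** In the straightened coordinates a linear right inverse of [T] is a section. *)
Lemma submersion_section m n (X : @charted_space R m) (Y : @charted_space R n)
    (A : set X) (f : X -> Y) x (T : 'M[R]_(m, n)) :
  atlas X -> atlas Y -> nbhs x A -> has_der A f x T ->
  (forall w : 'rV[R]_n, exists u, u *m T = w) ->
  exists (sg : Y -> X) (B : set Y) Tsg,
    [/\ open B, B (f x), sg (f x) = x, has_der B sg (f x) Tsg &
      forall y, B y -> A (sg y) /\ f (sg y) = y].
Proof.
move=> aX aY nA H surj.
have [S [ O [oO O0 S0 [HS SE]]]] := submersion_chart aX aY nA H surj.
have [bs bsE] : exists bs : 'I_n -> 'rV[R]_m, forall j, bs j *m T = delta_mx 0 j.
  by exists (fun j => sval (cid (surj (delta_mx 0 j)))) => j; case: cid.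
pose Bm : 'M[R]_(n, m) := \matrix_j bs j.
have BT : Bm *m T = 1%:M.
  by apply/row_matrixP => j; rewrite row_mul rowK bsE rowE mulmx1.
pose ka : Y -> @euclid R m := fun y => (crd (f x) y - crd (f x) (f x)) *m Bm.
have ka0 : ka (f x) = 0 by rewrite /ka subrr mul0mx.
have cc : {for f x, continuous (crd (f x))} by apply: crd_continuous => //; exact: dom_self.
have kac : {for f x, continuous ka}.
  have C : Ck 0 setT (fun z : 'rV[R]_n => z *m Bm + (- crd (f x) (f x) *m Bm)).
    apply: CkD; [exact: openT| |exact: Ck_cst].
    apply: (Ck_lin 0 setT (L := mulmxr Bm)); exact: lin_rV_continuous.
  have := continuous_comp cc (C (crd (f x) (f x)) I).
  rewrite /comp /=; congr (fun g : Y -> 'rV[R]_m => {for f x, continuous g}).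
  by apply/funext => y; rewrite /ka mulmxBl mulNmx.
have Hka : has_der setT ka (f x) Bm.
  apply: (has_der_coord (c := - crd (f x) (f x) *m Bm) aY).
    by apply: cvg_within_filter; exact: kac.
  by move=> y _ _; rewrite /= /ka mulmxBl mulNmx.
have nka : nbhs (f x) (ka @^-1` O).
  by apply: kac; rewrite ka0; exact: (open_near oO O0).
have nd : nbhs (f x) (dom (f x)) by exact: (open_near (open_dom aY _) (dom_self aY _)).
have [B [oB Bfx sB]] := open_nbhs_sub (filterI nka nd).
exists (S \o ka), B, (Bm *m 1%:M); split=> //.
- by rewrite /= ka0.
- apply: (has_der_subset (A := setT) aY) => //.
  rewrite -ka0 in HS.
  apply: (has_der_comp aY (euclid_atlas m) Hka HS) => //.
  by apply: filterS nka => y Oy _.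
move=> y /sB [Oy dy]; have [ASk dSk SkE] := SE _ Oy; split; first exact: ASk.
apply: (etrans (esym (crdK aY dSk))); apply: etrans (crdK aY dy); rewrite SkE.
by congr (icrd _ _); rewrite /ka -mulmxA BT mulmx1 addrC subrK.
Qed.

(** In the straightened coordinates the fibre is affine and contains the line
directed by [w]. *)
Lemma submersion_fiber m n (X : @charted_space R m) (Y : @charted_space R n)
    (A : set X) (f : X -> Y) x (T : 'M[R]_(m, n)) (w : 'rV[R]_m) :
  atlas X -> atlas Y -> nbhs x A -> has_der A f x T ->
  (forall w : 'rV[R]_n, exists u, u *m T = w) -> w *m T = 0 ->
  exists (c : @real_line R -> X) (B : set R),
    [/\ open B, B 0, c (0 : R) = x, has_der (M := real_line) B c (0 : R) w &
      forall t : R, B t -> A (c t) /\ f (c t) = f x].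
Proof.
move=> aX aY nA H surj wT.
have [S [ O [oO O0 S0 [HS SE]]]] := submersion_chart aX aY nA H surj.
pose ka : @real_line R -> @euclid R m := fun t => (const_mx t : 'rV[R]_1) *m w.
have ka0 : ka (0 : R) = 0.
  by rewrite /ka; have -> : const_mx 0 = 0 :> 'rV[R]_1 by []; rewrite mul0mx.
have kac : continuous (ka : R -> 'rV[R]_m).
  move=> t; apply: (@continuous_comp _ _ _ (fun t : R => const_mx t : 'rV[R]_1) (mulmxr w)).
    exact: const_mx1_continuous.
  exact: lin_rV_continuous.
have Hka : has_der setT ka (0 : R) w.
  apply: (has_der_coord (c := 0) real_line_atlas).
    by apply: cvg_within_filter; exact: (kac 0).
  by move=> y _ _; rewrite /= addr0.
have nka : nbhs (0 : R) (ka @^-1` O).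
  by apply: (kac 0); rewrite ka0; exact: (open_near oO O0).
have [B [oB B0 sB]] := open_nbhs_sub nka.
exists (S \o ka), B; split=> //.
- by rewrite /= ka0.
- apply: (has_der_subset (A := setT) real_line_atlas) => //.
  rewrite -ka0 in HS; rewrite -[w]mulmx1.
  apply: (has_der_comp real_line_atlas (euclid_atlas m) Hka HS) => //.
  by apply: filterS nka => y Oy _.
move=> t /sB Ot; have [ASk dSk SkE] := SE _ Ot; split; first exact: ASk.
apply: (etrans (esym (crdK aY dSk))); apply: etrans (crdK aY (dom_self aY _)).
by rewrite SkE; congr (icrd _ _); rewrite /ka -mulmxA wT mulmx0 addr0.
Qed.

End Sub.

(** * Smooth families of sections *)

Section Sec.
Context {R : realType}.

(** A smooth family of submanifolds is given by its total space, and each section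
is smooth separately; this is joint smoothness in [(y, t)].  The total space is
parametrised by a slice chart and mapped to [M x R] by [(f, t)].  This map is a
submersion: the image of [sec t] gives the tangent vectors [(a Ts, 0)], and the
family has a tangent vector with nonzero time component.  A local section of the
submersion exists by the inverse function theorem, and it equals the family of
sections because [f] is injective on each [L t]. *)
Lemma joint_section m n (G : @charted_space R m) (M : @charted_space R n)
    (I : set R) (L : R -> set G) (f : G -> M) (sec : R -> M -> G) t y :
  atlas G -> atlas M -> smooth f -> smooth_family I L ->
  (forall t, I t -> smooth (sec t)) ->
  (forall t y, I t -> L t (sec t y) /\ f (sec t y) = y) ->
  (forall t x, I t -> L t x -> sec t (f x) = x) -> I t ->
  exists T, has_der [set p : prodm M (@real_line R) | I p.2]
    ((fun p => sec p.2 p.1) : prodm M (@real_line R) -> G) (y, t) T.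
Proof.
move=> aG aM sf [k [[kd sub sl] _ subm]] ssec secP secU It.
have aR := @real_line_atlas R.
have aGR := prodm_atlas aG aR; have aMR := prodm_atlas aM aR.
pose p0 : prodm G (@real_line R) := (sec t y, t).
have p0S : total_set I L p0 by split=> //; exact: (secP t y It).1.
have [w [[W [Psi [iPsi [Wp0 sc wtan]]]] w1]] := subm p0 p0S.
have [th [TT [ O [oO O0 th0 [Hth thS thT]]]]] := slice_param aGR sc sub Wp0 p0S.
have [A HA] := smooth_on_has_der sf (x := sec t y) Logic.I.
have [Ts Hs] := smooth_on_has_der (ssec t It) (x := y) Logic.I.
have nT (T : topologicalType) (x : T) : nbhs x setT by exact: nearT.
have Hfst := has_der_fst setT p0 aG aR; have Hsnd := has_der_snd setT p0 aG aR.
have Hf := has_der_comp aGR aG Hfst HA Logic.I (near_all _ (fun _ _ => Logic.I)).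
have Hq0 := has_der_pair aGR Hf Hsnd.
rewrite -th0 in Hq0.
have Hq := has_der_comp (euclid_atlas _) aGR Hth Hq0 O0 (near_all _ (fun _ _ => Logic.I)).
set q := (X in has_der O X _ _) in Hq.
set Tq := (X in has_der O _ _ X) in Hq.
have q0 : q (0 : 'rV[R]_(m + 1)) = (y, t).
  by rewrite /q /= th0 /= (secP t y It).2.
have AsT : Ts *m A = 1%:M.
  have H := has_der_comp aM aG Hs HA Logic.I (near_all _ (fun _ _ => Logic.I)).
  have H2 : has_der setT (@idfun M) y (Ts *m A).
    apply: (has_der_eq aM H) => /=; first by rewrite (secP t y It).2.
    by apply: near_all => z _; split=> //=; rewrite (secP t z It).2.
  exact: (has_der_unique aM (nT _ _) (nT _ _) H2 (has_der_id _ _ aM)).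
have surj (v : 'rV[R]_(n + 1)) : exists u, u *m Tq = v.
  (* the curve y' |-> (sec t y', t) is tangent to the total space *)
  have Hc := has_der_pair aM Hs (has_der_cst (N := @real_line R) setT t y aM).
  have ctan (a : 'rV[R]_n) : exists z : 'rV[R]_(m + 1), row_mx (a *m Ts) (0 : 'rV[R]_1) = z *m TT.
    apply: thT => j kj.
    have := slice_tangent a aGR aM sc sub Logic.I (nT _ _) (Wp0 : W ((fun y => (sec t y, t)) y)) Hc _ kj.
    rewrite mul_mx_row mulmx0; apply.
    by apply: near_all => z; split=> //=; exact: (secP t z It).1.
  have [zw zwE] := thT w wtan.
  have w1' : (rsubmx w) 0 0 != 0.
    move: w1; rewrite (has_der_mdiff w aGR (nT _ _) Hsnd).
    by rewrite -{1}[w]hsubmxK mul_row_col mulmx0 mulmx1 add0r.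
  have wE : w = row_mx (lsubmx w) (rsubmx w) by rewrite hsubmxK.
  move: (lsubmx w) (rsubmx w) wE w1' => wl wr wE w1'.
  pose b : R := rsubmx v 0 0 / wr 0 0.
  have [z zE] := ctan (lsubmx v - b *: (wl *m A)).
  exists (z + b *: zw).
  rewrite /Tq mulmxA mulmxDl -scalemxAl -zE -zwE.
  rewrite wE scale_row_mx add_row_mx add0r.
  rewrite mul_mx_row mulmxA !mul_row_col !mulmx0 !mulmx1 addr0 add0r.
  rewrite mulmxDl -mulmxA AsT mulmx1 -scalemxAl subrK.
  rewrite -[RHS]hsubmxK; congr row_mx; apply/rowP => i.
  by rewrite !ord1 mxE /b -mulrA mulVf ?mulr1.
have nO : nbhs (0 : 'rV[R]_(m + 1)) O by exact: (open_near oO O0).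
have [sg [B [Tsg [oB B0 sg0 Hsg sgE]]]] := submersion_section (euclid_atlas _) aMR nO Hq surj.
rewrite -sg0 in Hth.
have Hths := has_der_comp aMR (euclid_atlas _) Hsg Hth B0 (near_all _ (fun y By => (sgE y By).1)).
have Hfst2 := has_der_fst setT ((th \o sg) (q (0 : 'rV[R]_(m + 1)))) aG aR.
have Hall := has_der_comp aMR aGR Hths Hfst2 B0 (near_all _ (fun _ _ => Logic.I)).
rewrite q0 in Hall B0.
eexists; apply: (has_der_eq aMR Hall).
  by rewrite /= -q0 sg0 th0.
have nB : nbhs ((y, t) : prodm M (@real_line R)) B by exact: (open_near oB B0).
apply: filterS nB => -[y' t'] Bp It'; split=> //=.
have [Osg qsg] := sgE _ Bp.
have fth : f (th (sg (y', t'))).1 = y' by exact: (congr1 fst qsg).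
have tth : (th (sg (y', t'))).2 = t' by exact: (congr1 snd qsg).
have [] := thS _ Osg; rewrite /= tth // => _ Lx.
by rewrite -[in RHS]fth secU.
Qed.

(** [s o f] is the identity on [L], so every tangent vector lies in the image of
[Ts]; conversely [s] takes its values in [L]. *)
Lemma tangent_section m n (G : @charted_space R m) (M : @charted_space R n)
    (L : set G) k (f : G -> M) (s : M -> G) y Ts A u :
  atlas G -> atlas M -> submanifold k L -> (forall y, L (s y)) ->
  (forall x, L x -> s (f x) = x) -> f (s y) = y ->
  has_der setT s y Ts -> has_der setT f (s y) A ->
  tangent k L (s y) u <-> exists a, u = a *m Ts.
Proof.
move=> aG aM [kd sub sl] Ls sf fsy Hs HA.
have nT (T : topologicalType) (x : T) : nbhs x setT by exact: nearT.
split=> [[W [Psi [iPsi [Ws sc ut]]]]|[a ->]]; last first.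
  have [W [Psi [iPsi [Ws sc]]]] := sl _ (Ls y).
  exists W, Psi, iPsi; split=> // j kj.
  apply: (slice_tangent _ aG aM sc sub Logic.I (nT _ _) Ws Hs _ kj).
  exact: near_all.
have [th [TT [ O [oO O0 th0 [Hth thS thT]]]]] := slice_param aG sc sub Ws (Ls y).
have [w ->] := thT u ut.
rewrite -th0 in HA.
have nO : nbhs (0 : 'rV[R]_m) O by exact: (open_near oO O0).
have H1 := has_der_comp (euclid_atlas _) aG Hth HA O0 (near_all _ (fun _ _ => Logic.I)).
have E : (f \o th) (0 : 'rV[R]_m) = y by rewrite /= th0.
rewrite -E in Hs.
have H2 := has_der_comp (euclid_atlas _) aM H1 Hs O0 (near_all _ (fun _ _ => Logic.I)).
have H3 : has_der O th (0 : 'rV[R]_m) (TT *m A *m Ts).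
  apply: (has_der_eq (euclid_atlas _) H2) => /=; first by rewrite th0 fsy.
  by apply: near_all => z Oz; split=> //; rewrite sf //; exact: thS.
have E2 := has_der_unique (euclid_atlas _) nO nO Hth H3.
by exists (w *m TT *m A); rewrite {1}E2 !mulmxA.
Qed.

End Sec.

(** * The symplectic form on the source and target fibres *)

Section Grpd.
Context {R : realType}.

Definition diff_mx m n (M : @charted_space R m) (N : @charted_space R n) (f : M -> N)
    (x : M) : 'M[R]_(m, n) :=
  lin1_mx ('d (crd (f x) \o f \o icrd x : 'rV[R]_m -> 'rV[R]_n) (crd x x)).

Lemma diff_mxE m n (M : @charted_space R m) (N : @charted_space R n) (f : M -> N) x u :
  mdiff f x u = u *m diff_mx f x.
Proof. by rewrite mul_rV_lin1. Qed.

Lemma nbhsT (T : topologicalType) (x : T) : nbhs x setT.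
Proof. exact: filterT. Qed.

Lemma has_der_diff_mx m n (M : @charted_space R m) (N : @charted_space R n)
    (A : set M) (f : M -> N) x T : atlas M -> nbhs x A -> has_der A f x T ->
  T = diff_mx f x.
Proof.
by move=> aM nA H; apply: mx_row_inj => u; rewrite -diff_mxE (has_der_mdiff u aM nA H).
Qed.

Lemma smooth_has_der m n (M : @charted_space R m) (N : @charted_space R n)
    (f : M -> N) x : atlas M -> smooth f -> has_der setT f x (diff_mx f x).
Proof.
move=> aM sf; have [T HT] := smooth_on_has_der sf (x := x) Logic.I.
by rewrite -(has_der_diff_mx aM (nbhsT x) HT).
Qed.

(** A rank count: [La] is injective from the kernel of [Ae] to that of [Ag], and
both have dimension [m - n], so every vector [v] of the kernel of [Ag] has the
form [w *m La], for which the formula is known. *)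
Lemma kernel_pairing m n (Oe Og : 'rV[R]_m -> 'rV[R]_m -> R) (Ae Ag B : 'M[R]_(m, n))
    (La : 'M[R]_m) (ta : 'rV[R]_n -> 'rV[R]_m) :
  (forall w : 'rV[R]_n, exists u, u *m Ae = w) ->
  (forall w : 'rV[R]_n, exists u, u *m Ag = w) ->
  (forall w : 'rV[R]_m, w *m Ae = 0 -> w *m La *m Ag = 0) ->
  (forall w : 'rV[R]_m, w *m Ae = 0 -> w *m La = 0 -> w = 0) ->
  (forall (w q : 'rV[R]_m), w *m Ae = 0 -> Og (w *m La) q = Oe w (ta (q *m B))) ->
  forall v q q' : 'rV[R]_m, v *m Ag = 0 -> q *m B = q' *m B -> Og v q = Og v q'.
Proof.
move=> sAe sAg LaA Lainj Lform v q q' vA qq'.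
have rk (A : 'M[R]_(m, n)) : (forall w : 'rV[R]_n, exists u, u *m A = w) -> \rank A = n.
  move=> sA; apply/eqP; rewrite -[_ == _]/(row_full A); apply/row_fullP.
  have [bs bsE] : exists bs : 'I_n -> 'rV[R]_m, forall j, bs j *m A = delta_mx 0 j.
    by exists (fun j => sval (cid (sA (delta_mx 0 j)))) => j; case: cid.
  exists (\matrix_j bs j).
  by apply/row_matrixP => j; rewrite row_mul rowK bsE rowE mulmx1.
have r1 : \rank (kermx Ae *m La) = \rank (kermx Ae).
  rewrite -[RHS](mxrank_mul_ker (kermx Ae) La).
  suff -> : (kermx Ae :&: kermx La)%MS = 0 by rewrite mxrank0 addn0.
  apply/eqP; rewrite -submx0; apply/row_subP => i.
  have := row_sub i (kermx Ae :&: kermx La)%MS; rewrite sub_capmx.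
  case/andP => /sub_kermxP H1 /sub_kermxP H2.
  by rewrite (Lainj _ H1 H2) sub0mx.
have sub : (kermx Ae *m La <= kermx Ag)%MS.
  apply/row_subP => i; apply/sub_kermxP; rewrite row_mul.
  by apply: LaA; apply/sub_kermxP; exact: row_sub.
have eqK : (kermx Ag <= kermx Ae *m La)%MS.
  by rewrite -(geq_leqif (mxrank_leqif_sup sub)) r1 !mxrank_ker !rk.
have /submxP [d vd] : (v <= kermx Ae *m La)%MS.
  by apply: submx_trans eqK; apply/sub_kermxP.
have dA : (d *m kermx Ae) *m Ae = 0 by rewrite -mulmxA mulmx_ker mulmx0.
by rewrite vd mulmxA !Lform // qq'.
Qed.

Lemma tangent_der m d (X : @charted_space R m) (N : @charted_space R d) k
    (S : set N) (B : set X) (f : X -> N) x p T (u : 'rV[R]_m) :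
  atlas X -> atlas N -> submanifold k S -> has_der B f x T -> B x -> nbhs x B ->
  (\forall y \near x, S (f y)) -> f x = p -> tangent k S p (u *m T).
Proof.
move=> aX aN [_ sub sl] H Bx nB Sf <-.
have [W [Psi [iPsi [Wp sc]]]] := sl _ (nbhs_singleton Sf).
exists W, Psi, iPsi; split=> // j kj.
exact: (slice_tangent _ aN aX sc sub Bx nB Wp H Sf kj).
Qed.

Lemma form_cubeE m (G : @charted_space R m) (Om : form2 G)
    (p : prodm (prodm G G) G) u1 u2 u3 v1 v2 v3 : atlas G ->
  form_cube Om p (row_mx (row_mx u1 u2) u3) (row_mx (row_mx v1 v2) v3) =
  Om p.1.1 u1 v1 + Om p.1.2 u2 v2 - Om p.2 u3 v3.
Proof.
move=> aG; have aGG := prodm_atlas aG aG; have aGGG := prodm_atlas aGG aG.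
have H1 := has_der_fst setT p aGG aG; have H3 := has_der_snd setT p aGG aG.
have H11 := has_der_comp aGGG aGG H1 (has_der_fst setT p.1 aG aG) Logic.I (near_all _ (fun _ _ => Logic.I)).
have H12 := has_der_comp aGGG aGG H1 (has_der_snd setT p.1 aG aG) Logic.I (near_all _ (fun _ _ => Logic.I)).
have E1 a b c : mdiff ((fun q => q.1.1) : prodm (prodm G G) G -> G) p (row_mx (row_mx a b) c) = a.
  rewrite (has_der_mdiff _ aGGG (nbhsT _) H11) mulmxA.
  by do 2 rewrite mul_row_col mulmx1 mulmx0 addr0.
have E2 a b c : mdiff ((fun q => q.1.2) : prodm (prodm G G) G -> G) p (row_mx (row_mx a b) c) = b.
  rewrite (has_der_mdiff _ aGGG (nbhsT _) H12) mulmxA.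
  by rewrite mul_row_col mulmx1 mulmx0 addr0 mul_row_col mulmx1 mulmx0 add0r.
have E3 a b c : mdiff ((fun q => q.2) : prodm (prodm G G) G -> G) p (row_mx (row_mx a b) c) = c.
  by rewrite (has_der_mdiff _ aGGG (nbhsT _) H3) mul_row_col mulmx0 mulmx1 add0r.
by rewrite /form_cube /pullback !E1 !E2 !E3.
Qed.

Section Kernels.
Variables (m n : nat) (G : @charted_space R m) (M : @charted_space R n).
Variables (D : groupoid_data G M) (Om : form2 G).
Hypotheses (aG : atlas G) (aM : atlas M).
Hypothesis HD : local_symplectic_groupoid D Om.

Let aGG := prodm_atlas aG aG.
Let aGGG := prodm_atlas aGG aG.
Let aR := @real_line_atlas R.

Lemma symp_lin x a u v w : Om x (a *: u + v) w = a * Om x u w + Om x v w.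
Proof. by have [_ [H _ _ _ _] _] := HD; exact: H. Qed.

Lemma symp0l x v : Om x 0 v = 0.
Proof. by have := symp_lin x (-1) 0 0 v; rewrite scaler0 addr0 mulN1r addNr. Qed.

Lemma cube_isotropic k (p : prodm (prodm G G) G) u1 u2 u3 v1 v2 v3 :
  (forall x, mul_graph D x -> forall u, tangent k (mul_graph D) x u <->
     (forall v, tangent k (mul_graph D) x v -> form_cube Om x u v = 0)) ->
  mul_graph D p ->
  tangent k (mul_graph D) p (row_mx (row_mx u1 u2) u3) ->
  tangent k (mul_graph D) p (row_mx (row_mx v1 v2) v3) ->
  Om p.1.1 u1 v1 + Om p.1.2 u2 v2 = Om p.2 u3 v3.
Proof.
move=> lag gp tu tv; apply/eqP; rewrite -subr_eq0 -form_cubeE //; apply/eqP.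
exact: (lag p gp _).1 tu _ tv.
Qed.

Lemma submersion_surj (f : G -> M) x (w : 'rV[R]_n) : submersion f ->
  exists u, u *m diff_mx f x = w.
Proof. by move=> [_ /(_ x w) [u uE]]; exists u; rewrite -diff_mxE. Qed.

(** Vectors tangent to the source fibre at [g] pair only with the part of a vector
seen by the target.  All of this is read off from the isotropy of the
multiplication graph at [(g, 1, g)]: tangent vectors [(0, w, w La)], coming from
the products [g c(t)] with a curve [c] in the source fibre of the unit, are
paired with [(q, 1_* tgt_* q, q)], coming from [g = g 1].  This expresses
[Om g (w La) q] through the value of [Om] at the unit on [w] and
[1_* tgt_* q].  The map [w |-> w La] is injective because the second factor can
move freely near the unit: if [w La = 0], then pairing with the resulting
tangent vectors shows that [w] is orthogonal to everything. *)
Lemma src_kernel g (sb : M -> G) (v q q' : 'rV[R]_m) :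
  smooth sb -> (forall y, tgt D (sb y) = y) -> sb (tgt D g) = g ->
  v *m diff_mx (src D) g = 0 -> q *m diff_mx (tgt D) g = q' *m diff_mx (tgt D) g ->
  Om g v q = Om g v q'.
Proof.
move=> ssb sbK sbg.
have [[subs subt su su_s su_t [ O [oO mdE]] mdu smul mulst mulu _ _] [_ _ nd _ _] [k [sgr lag]]] := HD.
pose x := tgt D g; pose e := uni D x.
have mdge : muldom D (g, e) by exact: (mdu g).2.
have mge : Defs.mul D g e = g by exact: (mulu g).2.
pose p0 : prodm (prodm G G) G := ((g, e), g).
have gp0 : mul_graph D p0 by split=> //=; rewrite mge.
have Hs y := smooth_has_der (f := src D) y aG subs.1.
have Ht y := smooth_has_der (f := tgt D) y aG subt.1.
have Hu y := smooth_has_der (f := uni D) y aM su.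
have [ME HM] := smooth_on_has_der smul mdge.
pose La := dsubmx ME.
have LaE (w : 'rV[R]_m) : row_mx 0 w *m ME = w *m La.
  by rewrite -[ME]vsubmxK mul_row_col mul0mx add0r.
(* differential of q |-> (q, 1_(tgt q), q), a map into the graph *)
have ta (z : 'rV[R]_m) : tangent k (mul_graph D) p0
    (row_mx (row_mx z (z *m diff_mx (tgt D) g *m diff_mx (uni D) x)) z).
  have H1 := has_der_comp aG aM (Ht g) (Hu x) Logic.I (near_all _ (fun _ _ => Logic.I)).
  have H2 := has_der_pair aG (has_der_pair aG (has_der_id setT g aG) H1) (has_der_id setT g aG).
  have := tangent_der z aG aGGG sgr H2 Logic.I (nbhsT _) _ (erefl p0).
  rewrite !mul_mx_row !mulmx1 mulmxA; apply.
  by apply: near_all => y; split=> /=; [exact: (mdu y).2|rewrite (mulu y).2].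
(* the products of g with curves in the source fibre of the unit *)
have curve (w : 'rV[R]_m) : w *m diff_mx (src D) e = 0 ->
    tangent k (mul_graph D) p0 (row_mx (row_mx 0 w) (w *m La)) /\
    w *m La *m diff_mx (src D) g = 0.
  move=> wA.
  have [c [B [oB B0 c0 Hc cE]]] := submersion_fiber aG aM (nbhsT _) (Hs e)
    (fun w => submersion_surj e w subs) wA.
  have nB : nbhs (0 : R) B by exact: (open_near oB B0).
  have Hgc := has_der_pair aR (has_der_cst (M := @real_line R) B g (0 : R) aR) Hc.
  have md_c : \forall t \near (0 : R), B t -> muldom D (g, c t).
    have nO : nbhs ((g, c 0) : prodm G G) O.
      by apply: (open_near oO); move: mdge; rewrite mdE c0 => -[].
    have := has_der_near Hgc nO; apply: filterS => t H Bt; rewrite mdE.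
    by split; [exact: H|rewrite /= (cE _ Bt).2 su_s].
  have E0 : (g, c 0) = (g, e) by rewrite c0.
  rewrite -E0 in HM.
  have Hm := has_der_comp aR aGG Hgc HM B0 md_c.
  rewrite LaE in Hm.
  have mgc0 : Defs.mul D g (c (0 : R)) = g by rewrite c0.
  split.
    have H2 := has_der_pair aR Hgc Hm.
    have := tangent_der (1%:M : 'rV[R]_1) aR aGGG sgr H2 B0 nB.
    rewrite mul1mx; apply; last by rewrite /= mgc0 c0.
    by apply: filterS2 md_c nB => t H Bt; split=> //; exact: H.
  have H3 := has_der_comp aR aG Hm (Hs _) B0 (near_all _ (fun _ _ => Logic.I)).
  have H4 : has_der (M := @real_line R) B (fun=> src D g) (0 : R) (w *m La *m diff_mx (src D) g).
    rewrite -[in diff_mx _ _]mgc0; apply: (has_der_eq aR H3); first by rewrite /= mgc0.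
    by apply: filterS md_c => t H Bt; split=> //=; rewrite (mulst _ _ (H Bt)).1.
  exact: (has_der_unique aR nB nB H4 (has_der_cst (M := @real_line R) B (src D g) (0 : R) aR)).
(* the products sb (src q) q are defined near the unit, with q arbitrary; the
   graph thus has tangent vectors with any second component *)
have sbe : sb (src D e) = g by rewrite su_s.
have [C HC] : exists C, has_der setT (sb \o src D) e C.
  by eexists; exact: (has_der_comp aG aM (Hs e) (smooth_has_der (src D e) aM ssb) Logic.I (near_all _ (fun _ _ => Logic.I))).
have [E tc] : exists E : 'M[R]_m, forall u : 'rV[R]_m, tangent k (mul_graph D) p0
    (row_mx (row_mx (u *m C) u) (u *m E)).
  have H1 := has_der_pair aG HC (has_der_id setT e aG).
  have E0 : ((sb \o src D) e, idfun e) = (g, e) by rewrite /= sbe.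
  rewrite -E0 in HM.
  have md_c : \forall q \near e, setT q -> muldom D ((sb \o src D) q, q).
    have nO : nbhs (((sb \o src D) e, idfun e) : prodm G G) O.
      by apply: (open_near oO); move: mdge; rewrite mdE E0 => -[].
    have := has_der_near H1 nO; apply: filterS => t H Bt; rewrite mdE.
    by split; [exact: H|rewrite /= sbK].
  have H2 := has_der_comp aG aGG H1 HM Logic.I md_c.
  have H3 := has_der_pair aG H1 H2.
  exists (row_mx C 1%:M *m ME) => u.
  have := tangent_der u aG aGGG sgr H3 Logic.I (nbhsT _).
  rewrite !mul_mx_row mulmx1; apply; last by rewrite /= sbe mge.
  by apply: filterS md_c => t H; split=> //; exact: H.
apply: (@kernel_pairing m n (Om e) (Om g) (diff_mx (src D) e) (diff_mx (src D) g) (diff_mx (tgt D) g) La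
    (fun a => a *m diff_mx (uni D) x)).
- by move=> w; exact: submersion_surj.
- by move=> w; exact: submersion_surj.
- by move=> w /curve [].
- move=> w wA wLa; have [tw _] := curve w wA; rewrite wLa in tw.
  apply: (nd e) => u.
  by have := cube_isotropic lag gp0 tw (tc u); rewrite /= !symp0l add0r.
move=> w z wA; have [tw _] := curve w wA.
by have := cube_isotropic lag gp0 tw (ta z); rewrite /= !symp0l add0r.
Qed.

(** The mirror image of the previous argument, at the point [(1, g, g)] of the
graph. *)
Lemma tgt_kernel g (sa : M -> G) (v q q' : 'rV[R]_m) :
  smooth sa -> (forall y, src D (sa y) = y) -> sa (src D g) = g ->
  v *m diff_mx (tgt D) g = 0 -> q *m diff_mx (src D) g = q' *m diff_mx (src D) g ->
  Om g v q = Om g v q'.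
Proof.
move=> ssa saK sag.
have [[subs subt su su_s su_t [ O [oO mdE]] mdu smul mulst mulu _ _] [_ _ nd _ _] [k [sgr lag]]] := HD.
pose x := src D g; pose e := uni D x.
have mdeg : muldom D (e, g) by exact: (mdu g).1.
have meg : Defs.mul D e g = g by exact: (mulu g).1.
pose p0 : prodm (prodm G G) G := ((e, g), g).
have gp0 : mul_graph D p0 by split=> //=; rewrite meg.
have Hs y := smooth_has_der (f := src D) y aG subs.1.
have Ht y := smooth_has_der (f := tgt D) y aG subt.1.
have Hu y := smooth_has_der (f := uni D) y aM su.
have [ME HM] := smooth_on_has_der smul mdeg.
pose La := usubmx ME.
have LaE (w : 'rV[R]_m) : row_mx w 0 *m ME = w *m La.
  by rewrite -[ME]vsubmxK mul_row_col mul0mx addr0.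
have ta (z : 'rV[R]_m) : tangent k (mul_graph D) p0
    (row_mx (row_mx (z *m diff_mx (src D) g *m diff_mx (uni D) x) z) z).
  have H1 := has_der_comp aG aM (Hs g) (Hu x) Logic.I (near_all _ (fun _ _ => Logic.I)).
  have H2 := has_der_pair aG (has_der_pair aG H1 (has_der_id setT g aG)) (has_der_id setT g aG).
  have := tangent_der z aG aGGG sgr H2 Logic.I (nbhsT _) _ (erefl p0).
  rewrite !mul_mx_row !mulmx1 mulmxA; apply.
  by apply: near_all => y; split=> /=; [exact: (mdu y).1|rewrite (mulu y).1].
have curve (w : 'rV[R]_m) : w *m diff_mx (tgt D) e = 0 ->
    tangent k (mul_graph D) p0 (row_mx (row_mx w 0) (w *m La)) /\
    w *m La *m diff_mx (tgt D) g = 0.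
  move=> wA.
  have [c [B [oB B0 c0 Hc cE]]] := submersion_fiber aG aM (nbhsT _) (Ht e)
    (fun w => submersion_surj e w subt) wA.
  have nB : nbhs (0 : R) B by exact: (open_near oB B0).
  have Hgc := has_der_pair aR Hc (has_der_cst (M := @real_line R) B g (0 : R) aR).
  have md_c : \forall t \near (0 : R), B t -> muldom D (c t, g).
    have nO : nbhs ((c 0, g) : prodm G G) O.
      by apply: (open_near oO); move: mdeg; rewrite mdE c0 => -[].
    have := has_der_near Hgc nO; apply: filterS => t H Bt; rewrite mdE.
    by split; [exact: H|rewrite /= (cE _ Bt).2 su_t].
  have E0 : (c 0, g) = (e, g) by rewrite c0.
  rewrite -E0 in HM.
  have Hm := has_der_comp aR aGG Hgc HM B0 md_c.
  rewrite LaE in Hm.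
  have mgc0 : Defs.mul D (c (0 : R)) g = g by rewrite c0.
  split.
    have H2 := has_der_pair aR Hgc Hm.
    have := tangent_der (1%:M : 'rV[R]_1) aR aGGG sgr H2 B0 nB.
    rewrite mul1mx; apply; last by rewrite /= mgc0 c0.
    by apply: filterS2 md_c nB => t H Bt; split=> //; exact: H.
  have H3 := has_der_comp aR aG Hm (Ht _) B0 (near_all _ (fun _ _ => Logic.I)).
  have H4 : has_der (M := @real_line R) B (fun=> tgt D g) (0 : R) (w *m La *m diff_mx (tgt D) g).
    rewrite -[in diff_mx _ _]mgc0; apply: (has_der_eq aR H3); first by rewrite /= mgc0.
    by apply: filterS md_c => t H Bt; split=> //=; rewrite (mulst _ _ (H Bt)).2.
  exact: (has_der_unique aR nB nB H4 (has_der_cst (M := @real_line R) B (tgt D g) (0 : R) aR)).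
have sae : sa (tgt D e) = g by rewrite su_t.
have [C HC] : exists C, has_der setT (sa \o tgt D) e C.
  by eexists; exact: (has_der_comp aG aM (Ht e) (smooth_has_der (tgt D e) aM ssa) Logic.I (near_all _ (fun _ _ => Logic.I))).
have [E tc] : exists E : 'M[R]_m, forall u : 'rV[R]_m, tangent k (mul_graph D) p0
    (row_mx (row_mx u (u *m C)) (u *m E)).
  have H1 := has_der_pair aG (has_der_id setT e aG) HC.
  have E0 : (idfun e, (sa \o tgt D) e) = (e, g) by rewrite /= sae.
  rewrite -E0 in HM.
  have md_c : \forall q \near e, setT q -> muldom D (q, (sa \o tgt D) q).
    have nO : nbhs ((idfun e, (sa \o tgt D) e) : prodm G G) O.
      by apply: (open_near oO); move: mdeg; rewrite mdE E0 => -[].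
    have := has_der_near H1 nO; apply: filterS => t H Bt; rewrite mdE.
    by split; [exact: H|rewrite /= saK].
  have H2 := has_der_comp aG aGG H1 HM Logic.I md_c.
  have H3 := has_der_pair aG H1 H2.
  exists (row_mx 1%:M C *m ME) => u.
  have := tangent_der u aG aGGG sgr H3 Logic.I (nbhsT _).
  rewrite !mul_mx_row mulmx1; apply; last by rewrite /= sae meg.
  by apply: filterS md_c => t H; split=> //; exact: H.
apply: (@kernel_pairing m n (Om e) (Om g) (diff_mx (tgt D) e) (diff_mx (tgt D) g) (diff_mx (src D) g) La
    (fun a => a *m diff_mx (uni D) x)).
- by move=> w; exact: submersion_surj.
- by move=> w; exact: submersion_surj.
- by move=> w /curve [].
- move=> w wA wLa; have [tw _] := curve w wA; rewrite wLa in tw.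
  apply: (nd e) => u.
  by have := cube_isotropic lag gp0 tw (tc u); rewrite /= !symp0l !addr0.
move=> w z wA; have [tw _] := curve w wA.
by have := cube_isotropic lag gp0 tw (ta z); rewrite /= !symp0l addr0.
Qed.

End Kernels.
End Grpd.

(** * Smooth functions with prescribed gradient *)

Section Flat.
Context {R : realType}.

(** The family [s^-a e^(-1/s)], extended by 0, is closed under differentiation up
to polynomial coefficients, so smoothness of [e^(-1/s)] is proved by induction
for all [a] at once. *)
Definition flat (a : nat) (s : R) : R :=
  if 0 < s then s^-1 ^+ a * expR (- s^-1) else 0.

Lemma flat_bound a (s : R) : `|flat a s| <= (a.+2)`!%:R * s ^+ 2.
Proof.
rewrite /flat; case: ifPn => [s0|_]; last by rewrite normr0 mulr_ge0 ?exprn_even_ge0.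
have u0 : 0 < s^-1 by rewrite invr_gt0.
rewrite ger0_norm; last by rewrite mulr_ge0 ?expR_ge0 // exprn_ge0 // ltW.
have F0 : 0 < (a.+2)`!%:R :> R by rewrite ltr0n fact_gt0.
have H : s^-1 ^+ a.+2 <= (a.+2)`!%:R * expR (s^-1).
  have := expR_ge1Dxn (a.+1) (ltW u0).
  rewrite -ler_pdivrMl // mulrC; lra.
have E : s^-1 ^+ a = s^-1 ^+ a.+2 * s ^+ 2.
  by rewrite -[a.+2]addn2 exprD -mulrA -exprMn mulVf ?gt_eqF // expr1n mulr1.
have P0 : 0 <= s ^+ 2 * expR (- s^-1) by rewrite mulr_ge0 ?expR_ge0 ?exprn_even_ge0.
have := ler_wpM2r P0 H.
have -> : (a.+2)`!%:R * expR s^-1 * (s ^+ 2 * expR (- s^-1)) = (a.+2)`!%:R * s ^+ 2.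
  by rewrite mulrACA expRxMexpNx_1 mulr1.
by rewrite (mulrA (s^-1 ^+ a.+2)) -E.
Qed.

Lemma flat_diff a (s : R) : differentiable (flat a) s /\
  forall v, 'd (flat a) s v = (flat a.+2 s - a%:R * flat a.+1 s) * v.
Proof.
have [s0|s0|->] := ltgtP s 0.
- have H : \forall y \near s, (fun=> 0 : R) y = flat a y.
    apply: filterS (lt_nbhsl s0) => y y0.
    by rewrite /flat ltNge (ltW y0).
  have [d1 d2] := diff_near_eq H (differentiable_cst 0 s); split=> // v.
  rewrite d2 -[fun _ => _]/(cst _) diff_cst /flat !ltNge !(ltW s0) /=.
  by rewrite mulr0 subrr mul0r.
- pose f (y : R) := y^-1 ^+ a * expR (- y^-1).
  have H : \forall y \near s, f y = flat a y.
    by apply: filterS (lt_nbhsr s0) => y y0; rewrite /flat y0.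
  have sn : s != 0 by rewrite gt_eqF.
  have di : is_derive s (1 : R) (fun y : R => y^-1) (- s ^- 2).
    apply: DeriveDef; first exact: derivableV.
    by rewrite deriveV // derive_id /GRing.scale /= mulr1.
  have de : is_derive (- s^-1) (1 : R) (@expR R) (expR (- s^-1)) by exact: is_derive_expR.
  have dni : is_derive s (1 : R) (fun y : R => - y^-1) (s ^- 2).
    have := is_deriveN di; rewrite opprK; exact.
  have dc : is_derive s (1 : R) (fun y : R => expR (- y^-1)) (s ^- 2 * expR (- s^-1)).
    by rewrite mulrC; have := @is_derive1_comp R (@expR R) (fun y : R => - y^-1) s _ _ de dni; apply.
  have df : is_derive s (1 : R) f (flat a.+2 s - a%:R * flat a.+1 s).
    have -> : f = (fun y : R => y^-1) ^+ a * (fun y : R => expR (- y^-1)).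
      by rewrite exprfctE; apply/funext => y.
    apply: (is_derive_eq (is_deriveM (is_deriveX a di) dc)).
    rewrite /flat s0 exprfctE /GRing.scale /= -!exprVn.
    case: a {f H} => [|a]; first by rewrite expr0 !mul0r mulr0 addr0 subr0 mul1r.
    rewrite !exprS; ring.
  have dd : differentiable f s by apply/derivable1_diffP; exact: ex_derive.
  have [d1 d2] := diff_near_eq H dd; split=> // v.
  rewrite d2 (deriv1E (@ex_derive _ _ _ _ _ _ _ df)) derive1E.
  by rewrite (@derive_val _ _ _ _ _ _ _ df) /GRing.scale /= mulrC.
have fl0 b : flat b 0 = 0 by rewrite /flat ltxx.
have [|e e0|d1 d2] := @diff_epsP R R R (flat a) 0 (GRing.null_fun R) _ _.
- by move=> x; exact: cvg_cst.
- have C0 : 0 < (a.+2)`!%:R :> R by rewrite ltr0n fact_gt0.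
  apply/nbhs_normP; exists (e / (a.+2)`!%:R); first by rewrite /= divr_gt0.
  move=> h; rewrite /= sub0r normrN ltr_pdivlMr // => he.
  rewrite addr0 fl0 !subr0; apply: (le_trans (flat_bound a h)).
  rewrite -real_normK ?num_real // expr2 mulrA ler_wpM2r //.
  by rewrite mulrC ltW.
by split=> // v; rewrite d2 !fl0 mulr0 subrr mul0r.
Qed.

Lemma Ck_flat k (V : normedModType R) (U : set V) a (f : V -> R) : open U ->
  Ck k U f -> Ck k U (fun x => flat a (f x)).
Proof.
move=> oU; elim: k a => [|k IH] a Ff.
  move=> x Ux; apply: (@continuous_comp _ _ _ f (flat a)); first exact: Ff.
  exact/differentiable_continuous/(flat_diff a _).1.
have [f1 f2] := Ff; split=> [x Ux|v].
  by apply: (@differentiable_comp _ _ _ _ f (flat a)) (f1 _ Ux) _; exact: (flat_diff a _).1.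
have H1 := IH a.+2 (CkW Ff); have H2 := IH a.+1 (CkW Ff).
have H3 := CkM oU (Ck_cst k U (- a%:R : R)) H2.
apply: (Ck_eq oU _ (CkM oU (CkD oU H1 H3) (f2 v))) => x Ux.
have [d1 d2] := flat_diff a (f x).
have E := diff_comp (f1 _ Ux) d1.
by apply: esym; apply: (etrans (congr1 (@^~ v) E)); rewrite /= d2 mulNr.
Qed.

End Flat.

Section Bump.
Context {R : realType}.

Lemma has_der_chart n (M : @charted_space R n) (x y : M) : smooth_manifold M ->
  dom x y -> exists T, has_der (N := euclid n) (dom x) (crd x) y T.
Proof.
move=> sM dxy; have aM := smooth_manifold_atlas sM.
have [_ _ _ _ _ _ _ trans] := sM.
have yy : icrd y (crd y y) = y by rewrite crdK //; exact: dom_self.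
have ic : {for crd y y, continuous (icrd y)} by apply: icrd_continuous => //; exact: dom_self.
have n1 : nbhs (crd y y) (icrd y @^-1` dom x).
  by apply: ic; rewrite yy; exact: (open_near (open_dom aM x) dxy).
have n2 : nbhs (crd y y) (crd y @` dom y).
  have H : (crd y @` dom y) (crd y y) by exists y => //; exact: dom_self.
  exact: (open_near (@open_crd_dom _ _ _ aM y) H).
have [U [oU Uy sU]] := open_nbhs_sub (filterI n1 n2).
have tC : Cinf U (crd x \o icrd y).
  move=> k; apply: Ck_sub (trans y x k) => z /sU [dz [y' dy' yz]].
  by exists y' => //; split=> //; move: dz; rewrite /= -yz crdK.
exists (lin1_mx ('d (crd x \o icrd y) (crd y y))); split.
  by apply: cvg_within_filter; exact: crd_continuous.
exists U, (crd x \o icrd y); split=> //.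
- by move=> z /sU [].
- by move=> u; rewrite mul_rV_lin1.
Qed.

Lemma has_der_scalar n (chi : 'rV[R]_n -> R) (z : 'rV[R]_n) : Cinf setT chi ->
  exists T, has_der (M := euclid n) (N := real_line) setT chi z T /\
    forall u, 'd chi z u = (u *m T) 0 0.
Proof.
move=> chiC.
pose F (z : 'rV[R]_n) : 'rV[R]_1 := const_mx (chi z).
have FC : Cinf setT F.
  move=> k; apply: Ck_rV => [|j]; first exact: openT.
  by apply: (Ck_eq openT _ (chiC k)) => v _; rewrite mxE.
have H : has_der (M := euclid n) (N := real_line) setT chi z (lin1_mx ('d F z)).
  split; first by apply: cvg_within_filter; exact: (chiC 0 z I).
  exists setT, F; split=> //.
  - by split; [exact: openT|].
  - by move=> v _; exists v.
  - by move=> u; rewrite mul_rV_lin1.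
exists (lin1_mx ('d F z)); split=> // u.
exact: (has_der_dfun u (euclid_atlas n) (nbhsT _) H).
Qed.

(** The linear coordinate [z_j - z0_j] multiplied by a cutoff that equals 1 at [z0]
and is supported in the ball.  Since the coordinate vanishes at [z0], the
derivative of the cutoff there does not contribute. *)
Lemma bump_coord n (z0 : 'rV[R]_n) (r : R) (j : 'I_n) : 0 < r ->
  exists chi : 'rV[R]_n -> R, [/\ Cinf setT chi,
    forall z, ~ (`|z - z0| <= r) -> chi z = 0 &
    forall u, 'd chi z0 u = u 0 j].
Proof.
move=> r0.
pose q (z : 'rV[R]_n) : R := r ^+ 2 + (-1) * \sum_(i < n) (z 0 i - z0 0 i) * (z 0 i - z0 0 i).
have cC k i : Ck k setT (fun z : 'rV[R]_n => z 0 i - z0 0 i).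
  apply: (CkD openT); last exact: Ck_cst.
  apply: (Ck_coord 0 i openT); exact: Ck_id.
have qC k : Ck k setT q.
  apply: (CkD openT); first exact: Ck_cst.
  apply: (CkM openT); first exact: Ck_cst.
  apply: (Ck_sum _ openT) => i; apply: (CkM openT); exact: cC.
pose c : R := (flat 0 (r ^+ 2))^-1.
pose ka (z : 'rV[R]_n) : R := c * flat 0 (q z).
have kaC k : Ck k setT ka.
  apply: (CkM openT); first exact: Ck_cst.
  exact: (Ck_flat 0 openT (qC k)).
have ka0 : ka z0 = 1.
  rewrite /ka /q big1 => [|i _]; last by rewrite subrr mulr0.
  rewrite mulr0 addr0 /c mulVf // /flat exprn_gt0 // expr0 mul1r.
  by rewrite gt_eqF // expR_gt0.
exists (fun z => ka z *: (z 0 j - z0 0 j : R)); split.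
- by move=> k; apply: (CkS openT); [exact: kaC|exact: cC].
- move=> z zr; suff -> : ka z = 0 by rewrite scale0r.
  rewrite /ka /flat; case: ifPn => [q0|_]; last by rewrite mulr0.
  case: zr; apply: rV_norm_le => [|i]; first exact: ltW.
  have r0' : r \in Num.nneg by rewrite nnegrE ltW.
  rewrite !mxE -ler_sqr //.
  rewrite real_normK ?num_real //.
  have : (z 0 i - z0 0 i) ^+ 2 <= \sum_(i < n) (z 0 i - z0 0 i) * (z 0 i - z0 0 i).
    rewrite (bigD1 i) //= -expr2 lerDl sumr_ge0 // => l _; rewrite -expr2; exact: sqr_ge0.
  by move: q0; rewrite /q; lra.
move=> u; have d1 := (kaC 1%N).1 z0 I; have d2 := (cC 1%N j).1 z0 I.
have [_ ->] := diff_scale d1 d2.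
have [L Lc LE] := coord_lin_continuous (R := R) (m := 1) (n := n) 0 j.
have dL : is_diff z0 L L.
  by apply: DiffDef; [exact: linear_differentiable|exact: diff_lin].
have E := @diff_val _ _ _ _ _ _ _ (is_diffD dL (is_diff_cst (- z0 0 j) z0)).
have -> : 'd (fun z : 'rV[R]_n => z 0 j - z0 0 j) z0 u = u 0 j.
  have -> : (fun z : 'rV[R]_n => z 0 j - z0 0 j) = (L : 'rV[R]_n -> R) + (cst (- z0 0 j) : 'rV[R]_n -> R).
    by apply/funext => z; rewrite /GRing.add /= LE.
  apply: (etrans (congr1 (@^~ u) E)).
  by rewrite /GRing.add /= LE /GRing.zero /= addr0.
by rewrite subrr ka0 scale1r scaler0 addr0.
Qed.

(** The function is a cut-off coordinate of the chart at [x], extended by zero.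
The extension is smooth because the compact image of the support is closed in
the Hausdorff space [M]. *)
Lemma smooth_fun_grad n (M : @charted_space R n) (x : M) (j : 'I_n) :
  smooth_manifold M -> exists2 F : M -> R, smooth_fun F & grad F x = delta_mx 0 j.
Proof.
move=> sM; have aM := smooth_manifold_atlas sM.
have [hM _ _ _ _ _ _ _] := sM.
set z0 := crd x x.
have nz : nbhs z0 (crd x @` dom x).
  have H : (crd x @` dom x) (crd x x) by exists x => //; exact: dom_self.
  exact: (open_near (@open_crd_dom _ _ _ aM x) H).
have /nbhs_normP [e /= e0 He] := nz.
pose r := e / 2.
have r0 : 0 < r by rewrite divr_gt0.
have Br z : `|z - z0| <= r -> (crd x @` dom x) z.
  move=> zr; apply: He; rewrite /= distrC; apply: (le_lt_trans zr).
  by rewrite ltr_pdivrMr // ltr_pMr // ltr1n.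
have [chi [chiC chi0 dchi]] := bump_coord z0 j r0.
pose K := icrd x @` [set z | `|z - z0| <= r].
have Kcl : closed K.
  apply: compact_closed => //; apply: continuous_compact.
    apply: continuous_in_subspaceT => z; rewrite inE => /Br [y dy <-].
    exact: icrd_continuous.
  apply: bounded_closed_compact; last exact: closed_norm_ball.
  exists (r + `|z0|); split; first exact: num_real.
  move=> b hb z /= zr; apply: le_trans (ltW hb).
  have {1}-> : z = (z - z0) + z0 by rewrite subrK.
  by apply: (le_trans (ler_normD _ _)); rewrite lerD2r.
pose F (y : M) : R := if pselect (dom x y) then chi (crd x y) else 0.
have FE y : dom x y -> F y = chi (crd x y).
  by rewrite /F; case: pselect.
have F0 y : ~ K y -> F y = 0.
  rewrite /F; case: pselect => // dy nK; apply: chi0 => H; apply: nK.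
  by exists (crd x y) => //; rewrite crdK.
have Fdom y : dom x y -> forall T, has_der (N := euclid n) (dom x) (crd x) y T ->
    exists T', has_der (N := real_line) setT F y (T *m T') /\
      forall u, 'd chi (crd x y) u = (u *m T') 0 0.
  move=> dy T HT; have [T' [HT' T'E]] := has_der_scalar (crd x y) chiC.
  exists T'; split=> //.
  have H := has_der_comp aM (euclid_atlas n) HT HT' dy (near_all _ (fun _ _ => I)).
  apply: (has_der_eq aM H) => /=; first by rewrite FE.
  have nd : nbhs y (dom x) by exact: (open_near (open_dom aM x) dy).
  by apply: filterS nd => y' dy' _; rewrite FE.
exists F.
  apply: has_der_smooth_on => y _.
  have [dy|ndy] := pselect (dom x y).
    have [T HT] := has_der_chart sM dy; have [T' [H _]] := Fdom y dy T HT.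
    by exists (T *m T').
  have nKy : ~ K y by move=> [z zr yz]; apply: ndy; have [y' dy' E] := Br _ zr; rewrite -yz -E crdK.
  have nK : nbhs y (~` K).
    exact: (open_near (closed_openC Kcl) nKy).
  exists 0; apply: (has_der_eq aM (has_der_cst (N := real_line) setT 0 y aM)).
    by rewrite F0.
  by apply: filterS nK => y' nK' _; rewrite F0.
have Hx : has_der (N := euclid n) (dom x) (crd x) x 1%:M.
  apply: (has_der_coord (c := 0) aM) => [|y _ _]; last by rewrite mulmx1 addr0.
  by apply: cvg_within_filter; apply: crd_continuous => //; exact: dom_self.
have [T' [H T'E]] := Fdom x (dom_self aM x) _ Hx.
rewrite (has_der_grad aM (nbhsT _) H) mul1mx; apply/rowP => i.
rewrite mxE; have := T'E (delta_mx 0 i); rewrite dchi -rowE => E.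
by move: E; rewrite [in RHS]mxE => <-; rewrite !mxE eqxx /= eq_sym.
Qed.

End Bump.

(** * The Magnus series and Taylor expansions in time *)

Section Magnus.
Context {R : realType}.
Variables (n : nat) (M : @charted_space R n) (pi : M -> 'M[R]_n).

Lemma grad0 (x : M) : grad (fun=> 0 : R) x = 0.
Proof.
apply/rowP => j; rewrite !mxE /dfun.
rewrite -[_ \o _]/(cst (0 : R)).
exact: (congr1 (@^~ (delta_mx 0 j)) (diff_cst (0 : R) (crd x x))).
Qed.

Lemma pbracket0l F (x : M) : pbracket pi (fun=> 0) F x = 0.
Proof. by rewrite /pbracket grad0 !mul0mx mxE. Qed.

Lemma pbracket0r F (x : M) : pbracket pi F (fun=> 0) x = 0.
Proof. by rewrite /pbracket grad0 trmx0 mulmx0 mxE. Qed.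

Lemma skew_form (A : 'M[R]_n) (u v : 'rV[R]_n) : A^T = - A ->
  (u *m A *m v^T) 0 0 = - (v *m A *m u^T) 0 0.
Proof.
move=> As; have -> : (u *m A *m v^T) 0 0 = (u *m A *m v^T)^T 0 0 by rewrite [RHS]mxE.
by rewrite !trmx_mul trmxK As mulmxA mulmxN mulNmx mxE.
Qed.

Lemma pbracket_skew F K (x : M) : (pi x)^T = - pi x ->
  pbracket pi F K x = - pbracket pi K F x.
Proof. by move=> s; exact: skew_form. Qed.

Lemma pbracketxx F (x : M) : (pi x)^T = - pi x -> pbracket pi F F x = 0.
Proof.
by move=> s; have := pbracket_skew F F s; move: (pbracket _ _ _ _) => z zE; lra.
Qed.

Lemma bernoulli0 : bernoulli 0 = 1 :> R.
Proof. by rewrite /bernoulli /= big_ord0 mulr0 subr0. Qed.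

(** The order-[k] hypothesis on the Magnus series passes to [h] without inverting
the series.  By strong induction the coefficients of [h] below [j] are those of
the constant [H], so each term with [i >= 1] in the recursion for the
coefficient [j + 1] is built from brackets of [H] with [H] or 0, hence
vanishes.  The term [i = 0] is the coefficient of [h] itself. *)
Lemma magnus_taylor (I : set R) (h : R -> M -> R) (S : nat -> M -> R) (H : M -> R) k :
  (forall x, (pi x)^T = - pi x) ->
  magnus_series I pi h S -> series_eq_upto k S (monomial 1%N H) ->
  forall j, (j < k)%N -> forall x, taylor I h j x = monomial 0%N H j x.
Proof.
move=> skew [_ S0 SE] SH.
have S0' : S 0%N = fun=> 0 by apply/funext.
elim/ltn_ind => j IH jk x.
have th i : (i < j)%N -> taylor I h i = if i == 0%N then H else fun=> 0.
  move=> ij; apply/funext => y; rewrite IH // ?(ltn_trans ij) //.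
  by rewrite /monomial; case: ifP.
have Sa a : (a <= k)%N -> S a = if a == 1%N then H else fun=> 0.
  by move=> ak; apply/funext => y; rewrite SH // /monomial; case: ifP.
have ad0 i : forall j', (j' <= j)%N -> iter i.+1 (ad_series pi S) (taylor I h) j' = fun=> 0.
  elim: i => [|i IHi] j' j'j; apply/funext => y;
    rewrite iterS; apply: big1 => -[a aj'] _; rewrite [nat_of_ord _]/=.
    have ak : (a <= k)%N by move: aj' j'j jk; clear; lia.
    case: a aj' ak => [|a] aj' ak; first by rewrite S0' pbracket0l.
    rewrite Sa // [iter 0 _ _]/= th; last by move: aj' j'j; clear; lia.
    by case: ifP => _; case: ifP => _; rewrite ?pbracket0l ?pbracket0r ?pbracketxx.
  rewrite IHi; first exact: pbracket0r.
  by move: aj' j'j; clear; lia.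
have := SE j x; rewrite big_ord_recl [X in _ + X]big1 => [|i _]; last first.
  by rewrite [nat_of_ord _]/= /bump leq0n add1n ad0 // mulr0.
rewrite /= expr0 bernoulli0 divr1 !mul1r addr0 => <-.
rewrite SH // /monomial; case: j {IH th ad0} jk => [|j] jk; first by rewrite /= mul1r.
by rewrite /= mulr0.
Qed.

End Magnus.

Section Taylor.
Context {R : realType}.

Lemma diff_real (F : R -> R) s t : 'd F s t = t * 'd F s 1.
Proof.
have E : t = t *: (1 : R) by rewrite /GRing.scale /= mulr1.
exact: (etrans (congr1 ('d F s) E) (linearZZ ('d F s) t 1)).
Qed.

Definition Dt (F : R -> R) : R -> R := fun s => 'd F s 1.

Lemma Dt_Cinf (U : set R) (F : R -> R) i : Cinf U F -> Cinf U (iter i Dt F).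
Proof.
move=> FC; elim: i => [//|i IH] k /=; exact: (IH k.+1).2.
Qed.

(** Derivatives inside [I] are computed by any smooth extension off [I]. *)
Lemma dt_seq (I U : set R) (f : R -> R) (G : nat -> R -> R) i t :
  (forall t, I t -> ProperFilter (within I t^')) -> open U ->
  (forall i t, U t -> differentiable (G i) t /\ 'd (G i) t 1 = G i.+1 t) ->
  (forall t, I t -> U t -> f t = G 0%N t) -> I t -> U t ->
  dt I i f t = G i t.
Proof.
move=> PF oU dG fG; elim: i t => [|i IH] t It Ut /=; first exact: fG.
apply: cvg_lim => //; first exact: PF.
have [d1 d2] := dG i t Ut.
have H1 : dquot (G i) t @ within I t^' --> G i.+1 t.
  by rewrite -d2; apply: cvg_within_filter; exact: dquot_cvg.
apply: cvg_trans H1; apply: near_eq_cvg.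
have nU := open_near oU Ut.
suff : \forall s \near t, s != t -> I s -> dquot (G i) t s = dquot (dt I i f) t s by [].
by apply: filterS nU => s Us _ Is; rewrite /dquot !IH.
Qed.

(** [G i] is the derivative of order [i] of [G 0].  The mean value theorem carries
the bound on the derivative of order [p] down, one order and one factor [t] at a
time. *)
Lemma taylor_up p (G : nat -> R -> R) (r C : R) :
  (forall i t, (i < p)%N -> `|t| < r -> differentiable (G i) t /\ 'd (G i) t 1 = G i.+1 t) ->
  (forall i, (i < p)%N -> G i 0 = 0) -> (forall t, `|t| < r -> `|G p t| <= C) ->
  forall t, `|t| < r -> `|G 0%N t| <= C * `|t| ^+ p.
Proof.
elim: p G => [|p IH] G dG G0 GC t tr; first by rewrite expr0 mulr1 GC.
have := IH (fun i => G i.+1) (fun i t ip => dG i.+1 t ip) (fun i ip => G0 i.+1 ip) GC.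
move=> H1; rewrite -[X in `|X|]subr0 -[X in _ - X](G0 0%N) //.
apply: mean_value_le => s /andP[s0 s1].
rewrite !subr0 add0r /=.
have str : `|s *: t| <= `|t|.
  by rewrite normrZ ger0_norm // -[leRHS]mul1r ler_wpM2r.
have [d1 d2] := dG 0%N (s *: t) (ltn0Sn p) (le_lt_trans str tr).
split=> //; have -> : 'd (G 0%N) (s *: t) t = t * G 1%N (s *: t).
  by rewrite -d2; exact: diff_real.
rewrite normrM exprS mulrCA; apply: ler_wpM2l => //.
apply: (le_trans (H1 _ (le_lt_trans str tr))).
have C0 : 0 <= C by apply: (le_trans (normr_ge0 (G p.+1 t))); exact: GC.
by apply: ler_wpM2l => //; apply: lerXn2r; rewrite ?nnegrE.
Qed.

(** The divided powers, normalised so that each is the derivative of the next. *)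
Definition divpow (a : nat) (t : R) : R := t ^+ a / a`!%:R.

Lemma divpow_diff a t : differentiable (divpow a.+1) t /\ 'd (divpow a.+1) t 1 = divpow a t.
Proof.
have d1 := is_diffX a (is_diff_id t).
have E : divpow a.+1 = (a.+1)`!%:R^-1 *: (@id R ^+ a.+1).
  by apply/funext => s; rewrite /divpow mulrC exprfctE.
have d2 := is_diffZ ((a.+1)`!%:R^-1) d1.
rewrite E; split; first exact: ex_diff.
have -> := congr1 (@^~ 1) (@diff_val _ _ _ _ _ _ _ d2).
have -> : ((a.+1)`!%:R^-1 *: ((a.+1%:R * t ^+ a) *: @id R)) 1
    = (a.+1)`!%:R^-1 * (a.+1%:R * t ^+ a * 1) by [].
rewrite mulr1 /divpow factS natrM invfM.
have n0 : a.+1%:R != 0 :> R by rewrite pnatr_eq0.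
have f0 : a`!%:R != 0 :> R by rewrite pnatr_eq0 -lt0n fact_gt0.
move: n0 f0; move: (a.+1%:R : R) (a`!%:R : R) (t ^+ a) => p q z p0 q0.
by field; rewrite p0 q0.
Qed.

(** The converse of the previous estimate, for a bound that holds only for times in
[I].  If [c] is the first nonzero derivative, of order [i < p], then the
function minus [c t^i / i!] is at most [e |t|^i] with [e = |c| / (2 i!)], so
the function is at least [e |t|^i], which contradicts [O(t^p)]. *)
Lemma taylor_down p (G : nat -> R -> R) (I : set R) (C r : R) i :
  ProperFilter (within I 0^') -> 0 < r ->
  (forall i t, `|t| < r -> differentiable (G i) t /\ 'd (G i) t 1 = G i.+1 t) ->
  (\forall t \near 0, I t -> `|G 0%N t| <= C * `|t| ^+ p) ->
  (i < p)%N -> G i 0 = 0.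
Proof.
move=> PF r0 dG GC; elim/ltn_ind: i => i IH ip.
apply/eqP; apply: contraT => c0; set c := G i 0 in c0 *.
pose G' j t := G j t - c * divpow (i - j) t.
pose e := `|c| / (i`!%:R * 2).
have F0 : 0 < i`!%:R :> R by rewrite ltr0n fact_gt0.
have e0 : 0 < e by rewrite divr_gt0 ?normr_gt0 // mulr_gt0.
have C' : exists2 r', 0 < r' <= r & forall t, `|t| < r' -> `|G i t - c| <= e.
  have r00 : `|0 : R| < r by rewrite normr0.
  have /differentiable_continuous/cvgrPdist_le/(_ e e0) := (dG i 0 r00).1.
  move=> /nbhs_normP [d /= d0 Hd].
  exists (Num.min d r); first by rewrite lt_min d0 r0 ge_min lexx orbT.
  move=> t; rewrite lt_min => /andP[td _].
  by rewrite distrC; apply: Hd; rewrite /= sub0r normrN.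
have [r' /andP[r'0 r'r] Hr'] := C'.
have up : forall t, `|t| < r' -> `|G' 0%N t| <= e * `|t| ^+ i.
  apply: taylor_up => [j t ji tr'|j ji|t tr'].
  - have [d1 d2] := dG j t (lt_le_trans tr' r'r).
    have [m1 m2] := divpow_diff (i - j.+1)%N t.
    have E : (i - j)%N = (i - j.+1).+1 by lia.
    have /differentiableP d1' := d1; have /differentiableP m1' := m1.
    have dd := is_diffB d1' (is_diffZ c m1').
    have GE : G' j = G j - c *: divpow (i - j.+1).+1.
      by apply/funext => s; rewrite /G' E.
    rewrite GE; split; first exact: ex_diff.
    apply: (etrans (congr1 (@^~ 1) (@diff_val _ _ _ _ _ _ _ dd))).
    by rewrite /G' -d2 -m2.
  - rewrite /G' IH // ?(ltn_trans ji) // /divpow.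
    have -> : (i - j)%N = (i - j.+1).+1 by lia.
    by rewrite expr0n mul0r mulr0 subrr.
  - by rewrite /G' subnn /divpow expr0 divr1 mulr1; exact: Hr'.
(* a small nonzero time in the interval *)
have Cp : 0 < `|C| + 1 by rewrite ltr_wpDl.
pose d := Num.min r' (Num.min 1 (e / (`|C| + 1))).
have d0 : 0 < d by rewrite !lt_min r'0 ltr01 divr_gt0.
have nd : \forall t \near (0 : R), `|t| < d.
  by apply/nbhs_normP; exists d => [//|t]; rewrite /= sub0r normrN.
have nn : within I 0^' (fun t => [/\ t != 0, I t, `|t| < d & `|G 0%N t| <= C * `|t| ^+ p]).
  suff : \forall t \near (0 : R), t != 0 -> I t -> [/\ t != 0, I t, `|t| < d & `|G 0%N t| <= C * `|t| ^+ p] by [].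
  by apply: filterS2 nd GC => t td tC t0 It; split=> //; exact: tC.
have [t [t0 It td tC]] := filter_ex nn.
move: td; rewrite !lt_min => /and3P[tr' t1 te].
have := up t tr'; rewrite /G' subn0 => Hup.
have tp : 0 < `|t| by rewrite normr_gt0.
have H1 : `|c * divpow i t| <= C * `|t| ^+ p + e * `|t| ^+ i.
  have -> : c * divpow i t = G 0%N t - (G 0%N t - c * divpow i t) by rewrite opprB addrC subrK.
  by apply: (le_trans (ler_normB _ _)); apply: lerD.
have H2 : C * `|t| ^+ p <= `|C| * `|t| * `|t| ^+ i.
  apply: (le_trans (y := `|C| * `|t| ^+ p)); first by rewrite ler_wpM2r ?exprn_ge0 ?ler_norm.
  rewrite -mulrA -exprS ler_wpM2l //.
  by apply: ler_wiXn2l => //; exact: ltW.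
have H3 : `|c * divpow i t| = 2 * e * `|t| ^+ i.
  rewrite /divpow /e !normrM normfV normrX (ger0_norm (ltW F0)).
  by field; rewrite gt_eqF.
have tip : 0 < `|t| ^+ i by rewrite exprn_gt0.
have H4 : 2 * e * `|t| ^+ i <= (`|C| * `|t| + e) * `|t| ^+ i by rewrite mulrDl; lra.
move: H4; rewrite ler_pM2r // => H4.
move: te; rewrite ltr_pdivlMr // => te.
have H5 : 0 < `|t| * 1 by rewrite mulr1.
lra.
Qed.

Lemma line_diff (V : normedModType R) (G : V -> R) (a e : V) (t : R) :
  differentiable G (a + t *: e) ->
  differentiable (fun t : R => G (a + t *: e)) t /\
  'd (fun t : R => G (a + t *: e)) t 1 = 'd G (a + t *: e) e.
Proof.
move=> /differentiableP dG.
have dl := is_diffD (is_diff_cst a t) (is_diff_scalel t e).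
have dc := is_diff_comp dl dG.
split; first exact: ex_diff.
apply: (etrans (congr1 (@^~ 1) (@diff_val _ _ _ _ _ _ _ dc))).
by rewrite /GRing.add /= /GRing.zero /= scale1r add0r.
Qed.

Lemma row_mx_norm_lt m n (u : 'rV[R]_m) (v : 'rV[R]_n) (r : R) :
  `|u| < r -> `|v| < r -> `|row_mx u v| < r.
Proof.
move=> ur vr; apply: (@le_lt_trans _ _ (Num.max `|u| `|v|)); last by rewrite gt_max ur vr.
apply: rV_norm_le => [|j]; first by rewrite le_max normr_ge0.
rewrite mxE; case: (fintype.split j) => l.
  by rewrite le_max rV_coord_le.
by rewrite le_max rV_coord_le orbT.
Qed.

(** The time derivative of [P] is that of [h] at the moving point [psi t].  The higher
derivatives of [P] would involve those of [psi]; instead the vanishing for [h] gives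
[d_t h = O(t^(k-1))] uniformly near [x], which transports along [psi] as a bound
and is turned back into vanishing derivatives of [P]. *)
Lemma taylor_transport n (M : @charted_space R n) (I : set R) (h : R -> M -> R)
    (P : R -> R) (psi : R -> M) x k :
  atlas M -> (forall t, I t -> ProperFilter (within I t^')) -> I 0 ->
  (exists T, has_der (M := prodm M real_line) (N := real_line) [set p | I p.2]
     (fun p => h p.2 p.1) (x, 0) T) ->
  (forall y i, (0 < i < k)%N -> dt I i (fun t => h t y) 0 = 0) ->
  (exists T, has_der (M := real_line) (N := real_line) I P (0 : R) T) ->
  psi @ within I (nbhs 0) --> x ->
  (forall t, I t -> dt I 1 P t = dt I 1 (fun s => h s (psi t)) t) ->
  forall i, (0 < i < k)%N -> dt I i P 0 = 0.
Proof.
move=> aM PF I0 [T [_ [U [F [[oU Ux] sU FC FE _]]]]] hT [TP [_ [UP [FP [[oUP UPx] sUP FPC FPE _]]]]] psic PE i /andP[i0 ik].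
have kE : k = k.-1.+1 by rewrite prednK // (ltn_trans i0).
have oB (r : R) : open [set t : R | `|t| < r].
  have -> : [set t : R | `|t| < r] = ball 0 r.
    by rewrite -ball_normE; apply/funext => t; rewrite /= sub0r normrN.
  exact: ball_open.
(* time derivatives of h in the chart at x *)
pose e : 'rV[R]_(n + 1) := row_mx 0 (const_mx 1).
pose DE (f : 'rV[R]_(n + 1) -> R) p := 'd f p e.
pose E j := iter j DE (fun p => F p 0 0).
have EC j : Cinf U (E j).
  elim: j => [|j IH] l /=; first exact: (Ck_coord 0 0 oU (FC l)).
  exact: (IH l.+1).2.
pose lin z (t : R) := row_mx z 0 + t *: e.
have linE z t : lin z t = row_mx z (const_mx t).
  rewrite /lin /e scale_row_mx scaler0 add_row_mx addr0 add0r; congr row_mx.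
  by apply/rowP => l; rewrite !mxE mulr1.
set z0 := crd x x.
have Up0 : U (lin z0 0) by rewrite linE.
pose p0 := lin z0 0.
pose C : R := `|E k p0| + 1.
have [r r0 Hr] : exists2 r : R, 0 < r & forall p, `|p - p0| < r -> U p /\ `|E k p| <= C.
  have H1 : \forall p \near p0, `|E k p| <= C.
    have /cvgrPdist_le /(_ 1 ltr01) := Ck_cont (EC k 0%N) Up0.
    apply: filterS => p pE; rewrite /C.
    have -> : E k p = E k p0 - (E k p0 - E k p) by rewrite opprB addrC subrK.
    by apply: (le_trans (ler_normB _ _)); rewrite lerD2l.
  have H2 : \forall p \near p0, U p /\ `|E k p| <= C.
    by apply: filterS2 (open_near oU Up0) H1.
  have /nbhs_normP [r /= r0 Hr] := H2.
  by exists r => // p pr; apply: Hr; rewrite /= distrC.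
have box z t : `|z - z0| < r -> `|t| < r -> U (lin z t) /\ `|E k (lin z t)| <= C.
  move=> zr tr; apply: Hr; rewrite /p0 !linE opp_row_mx add_row_mx.
  apply: row_mx_norm_lt => //; apply: le_lt_trans tr.
  by apply: rV_norm_le => // l; rewrite !mxE subr0.
have dline z j t : `|z - z0| < r -> `|t| < r ->
    differentiable (fun s : R => E j (lin z s)) t /\
    'd (fun s : R => E j (lin z s)) t 1 = E j.+1 (lin z t).
  by move=> zr tr; apply: line_diff; apply: ((EC j) 1%N).1; exact: (box _ _ zr tr).1.
have hE y t : dom x y -> `|crd x y - z0| < r -> `|t| < r -> I t ->
    h t y = E 0%N (lin (crd x y) t).
  move=> dy yr tr It; have [Ul _] := box _ _ yr tr.
  have := FE _ Ul; rewrite linE /= row_mxKl row_mxKr mxE crdK // => /(_ It) /= <-.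
  by rewrite mxE.
have hder y j t : dom x y -> `|crd x y - z0| < r -> `|t| < r -> I t ->
    dt I j (fun t => h t y) t = E j (lin (crd x y) t).
  move=> dy yr tr It.
  apply: (@dt_seq I [set t : R | `|t| < r] _ (fun j t => E j (lin (crd x y) t))) => //.
  - by move=> j' t' t'r; exact: dline.
  - by move=> t' It' t'r; exact: hE.
(* the first time derivative is small to order k - 1, uniformly *)
have small y t : dom x y -> `|crd x y - z0| < r -> `|t| < r ->
    `|E 1%N (lin (crd x y) t)| <= C * `|t| ^+ k.-1.
  move=> dy yr tr.
  apply: (@taylor_up k.-1 (fun j t => E j.+1 (lin (crd x y) t)) r C) => //.
  - by move=> j t' _ t'r; exact: dline.
  - move=> j jk; rewrite -hder ?normr0 //; apply: hT.
    by rewrite ltn0Sn /= kE ltnS.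
  - by move=> t' t'r; rewrite -kE; exact: (box _ _ yr t'r).2.
(* the smooth extension of P *)
pose cm (s : R) : 'rV[R]_1 := 0 + s *: const_mx 1.
have cmE s : cm s = const_mx s.
  by apply/rowP => l; rewrite !mxE mulr1 add0r.
have cmC l : Ck l setT cm.
  apply: (CkD openT); first exact: Ck_cst.
  apply: (CkS openT); [exact: Ck_id|exact: Ck_cst].
have cmc : continuous cm by move=> s; exact: (cmC 0%N s).
pose V := cm @^-1` UP.
have oV : open V by exact: (open_comp (fun z _ => cmc z) oUP).
have V0 : V 0 by rewrite /V /= cmE.
pose FP0 (s : R) : R := FP (cm s) 0 0.
have FP0C : Cinf V FP0.
  move=> l; apply: (Ck_coord 0 0 oV (f := fun s => FP (cm s))).
  by apply: (Ck_comp oV _ _ (FPC l)) => //; exact: Ck_sub (cmC l).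
have PFE t : I t -> V t -> P t = FP0 t.
  move=> It Vt; have := FPE _ Vt.
  have -> : @icrd R 1 real_line 0 (cm t) = t by rewrite /= cmE mxE.
  by move=> /(_ It); rewrite /FP0 => <-; rewrite mxE.
pose G j := iter j Dt FP0.
have GV j t : V t -> differentiable (G j) t /\ 'd (G j) t 1 = G j.+1 t.
  by move=> Vt; split=> //; apply: (Dt_Cinf j FP0C 1%N).1.
have PG j t : I t -> V t -> dt I j P t = G j t.
  by move=> It Vt; apply: (dt_seq (U := V)).
have /nbhs_normP [rP /= rP0 HrP] := open_near oV V0.
have dG j t : `|t| < rP -> differentiable (G j.+1) t /\ 'd (G j.+1) t 1 = G j.+2 t.
  by move=> tr; apply: GV; apply: HrP; rewrite /= sub0r normrN.
have nearG : \forall t \near (0 : R), I t -> `|G 1%N t| <= C * `|t| ^+ k.-1.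
  have nd : nbhs x [set y | dom x y /\ `|crd x y - z0| < r].
    have H1 : nbhs x (dom x) by exact: (open_near (open_dom aM x) (dom_self aM x)).
    have H2 : nbhs x [set y | `|crd x y - z0| < r].
      have /cvgrPdist_lt /(_ r r0) := crd_continuous aM (dom_self aM x).
      by apply: filterS => y; rewrite distrC.
    by apply: filterS2 H1 H2.
  have npsi : \forall t \near (0 : R), I t -> dom x (psi t) /\ `|crd x (psi t) - z0| < r.
    exact: psic nd.
  have nr : \forall t \near (0 : R), `|t| < r.
    by apply/nbhs_normP; exists r => [//|t]; rewrite /= sub0r normrN.
  have nV := open_near oV V0.
  apply: filterS3 npsi nr nV => t Hpsi tr Vt It.
  have [dp pr] := Hpsi It.
  by rewrite -PG // PE // hder //; exact: small.
have i1k : (i.-1 < k.-1)%N by rewrite -ltnS -kE prednK.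
have := @taylor_down k.-1 (fun j => G j.+1) I C rP i.-1 (PF 0 I0) rP0 dG nearG i1k.
by rewrite prednK // -PG.
Qed.

End Taylor.

(** * Hamiltonian vectors at a point of a Lagrangian bisection *)

Section Y.
Context {R : realType}.

Lemma mul0_value m p (P : 'M[R]_(m, p)) (Q : 'cV[R]_p) :
  ((0 : 'rV[R]_m) *m P *m Q) 0 0 = 0.
Proof. by rewrite !mul0mx mxE. Qed.

(** A coordinate of a vector is its value on a function whose gradient is the
corresponding basis covector. *)
Lemma row_coord_test m n (u : 'rV[R]_m) (B : 'M[R]_(m, n)) (v w : 'rV[R]_n) j :
  w = delta_mx 0 j ->
  (- u *m B *m w^T) 0 0 = - (v *m w^T) 0 0 -> (u *m B) 0 j = v 0 j.
Proof.
have col1 (z : 'rV[R]_n) : (z *m (delta_mx 0 j : 'rV[R]_n)^T) 0 0 = z 0 j.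
  by rewrite trmx_delta -colE mxE.
by move=> ->; rewrite 2!mulNmx [LHS]mxE !col1 => /oppr_inj.
Qed.

Section Linear.
Variables (m n : nat) (Om : 'rV[R]_m -> 'rV[R]_m -> R).
Hypothesis lin : forall a u v w, Om (a *: u + v) w = a * Om u w + Om v w.
Hypothesis nd : forall u, (forall v, Om u v = 0) -> u = 0.
Variables (Sg : 'M[R]_(n, m)) (A B : 'M[R]_(m, n)) (Ps : 'M[R]_n).
Hypothesis SA : Sg *m A = 1%:M.
Hypothesis SBP : Sg *m B *m Ps = 1%:M.
Hypothesis iso : forall a b, Om (a *m Sg) (b *m Sg) = 0.
Hypothesis kA : forall u q q', u *m A = 0 -> q *m B = q' *m B -> Om u q = Om u q'.
Hypothesis kB : forall u q q', u *m B = 0 -> q *m A = q' *m A -> Om u q = Om u q'.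

Let linB u v w : Om (u - v) w = Om u w - Om v w.
Proof. by rewrite addrC -scaleN1r lin mulN1r addrC. Qed.

Let PSB : Ps *m (Sg *m B) = 1%:M.
Proof. exact: mulmx1C. Qed.

Let PSBf p (q : 'M[R]_(p, m)) : q *m B *m Ps *m Sg *m B = q *m B.
Proof. by rewrite -!mulmxA PSB mulmx1. Qed.

(** A form on the tangent space of the bisection determines the pairing with a
vector of the source fibre: each [q] may be replaced by the tangent vector of the
bisection with the same image under the target. *)
Lemma src_fibre_form v (eta : 'cV[R]_n) : v *m A = 0 ->
  (forall w, Om v (w *m Sg) = (w *m eta) 0 0) ->
  forall q, Om v q = (q *m B *m (Ps *m eta)) 0 0.
Proof.
move=> vA H q; rewrite (kA (q' := q *m B *m Ps *m Sg) vA) ?PSBf // H.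
by rewrite mulmxA.
Qed.

(** [X] is the Hamiltonian vector of a function of the target.  Its pairing with
[X - (X A) Sg], which is tangent to the source fibre, shows that the two
coincide, so [X] is tangent to the source fibre; subtracting the tangent vector
of the bisection with the same image under the target gives the Hamiltonian
vector of the corresponding function of the source. *)
Lemma ham_transfer X (f : 'cV[R]_n) :
  (forall q, Om X q = - (q *m B *m f) 0 0) ->
  X *m A = 0 /\
  forall q, Om (X - X *m B *m Ps *m Sg) q = - (q *m A *m (Sg *m B *m f)) 0 0.
Proof.
move=> HX; split.
  have X'A : (X - X *m A *m Sg) *m A = 0.
    by rewrite mulmxBl -[X *m A *m Sg *m A]mulmxA SA mulmx1 subrr.
  suff E : X - (X - X *m A *m Sg) = 0.
    have {}E : X *m A *m Sg = 0 by move: E; rewrite opprB addrC subrK.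
    by rewrite -[X *m A]mulmx1 -SA mulmxA E mul0mx.
  apply: nd => q; rewrite linB (kA (q' := q *m B *m Ps *m Sg) X'A) ?PSBf //.
  by rewrite linB iso subr0 !HX PSBf subrr.
move=> q.
have ZB : (X - X *m B *m Ps *m Sg) *m B = 0 by rewrite mulmxBl PSBf subrr.
rewrite (kB (q' := q *m A *m Sg) ZB); last by rewrite -[RHS]mulmxA SA mulmx1.
by rewrite linB iso subr0 HX !mulmxA.
Qed.

Lemma ham_transfer_value (X : 'rV[R]_m) (f : 'cV[R]_n) : X *m A = 0 ->
  ((X - X *m B *m Ps *m Sg) *m A *m (Sg *m B *m f)) 0 0 = - (X *m B *m f) 0 0.
Proof.
move=> XA; rewrite mulmxBl XA sub0r mulNmx [LHS]mxE; congr (- (_ 0 0)).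
rewrite -(mulmxA (X *m B *m Ps)) SA mulmx1 mulmxA -(mulmxA (X *m B) Ps).
by rewrite PSB mulmx1.
Qed.

(** The converse transfer: the two Hamiltonian vectors exist together. *)
Lemma ham_transfer_inv Z (f : 'cV[R]_n) :
  (forall q, Om Z q = - (q *m A *m (Sg *m B *m f)) 0 0) ->
  exists X, forall q, Om X q = - (q *m B *m f) 0 0.
Proof.
move=> HZ; exists (Z - Z *m A *m Sg) => q.
have XA : (Z - Z *m A *m Sg) *m A = 0.
  by rewrite mulmxBl -[Z *m A *m Sg *m A]mulmxA SA mulmx1 subrr.
rewrite (kA (q' := q *m B *m Ps *m Sg) XA) ?PSBf //.
rewrite linB iso subr0 HZ -[X in X *m (Sg *m B *m f)]mulmxA SA mulmx1.
by rewrite !mulmxA PSBf.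
Qed.

End Linear.

Lemma symp_hamE m (G : @charted_space R m) (Om : form2 G) (F : G -> R) x u :
  (forall a u v w, Om x (a *: u + v) w = a * Om x u w + Om x v w) ->
  (forall u, (forall v, Om x u v = 0) -> u = 0) ->
  (forall v, Om x u v = - dfun F x v) -> symp_ham Om F x = u.
Proof.
move=> lin nd H; apply: xget_unique => [|v Hv] //.
apply/eqP; rewrite -subr_eq0; apply/eqP/nd => w.
have -> : Om x (v - u) w = Om x v w - Om x u w.
  by rewrite addrC -scaleN1r lin mulN1r addrC.
by rewrite Hv H subrr.
Qed.

(** The bracket is defined with the default value 0 when no Hamiltonian vector
exists. *)
Lemma symp_ham_none m (G : @charted_space R m) (Om : form2 G) (F : G -> R) x :
  (forall u, ~ forall v, Om x u v = - dfun F x v) -> symp_ham Om F x = 0.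
Proof. by move=> H; apply: xgetPN => u Hu; apply: (H u). Qed.

(** The sections are defined by choice of a preimage, which is unique on [L]. *)
Lemma diffeo_from_section m n (G : @charted_space R m) (M : @charted_space R n)
    (L : set G) (f : G -> M) (u : M -> G) :
  let s := fun y => xget (u y) [set g | L g /\ f g = y] in
  diffeo_from L f ->
  [/\ smooth s, forall y, L (s y) /\ f (s y) = y & forall x, L x -> s (f x) = x].
Proof.
move=> s [_ [s' [ss' Ls' fs' s'f]]].
have sE : s = s'.
  apply/funext => y; rewrite /s.
  have [] := @xgetPex _ (u y) [set g | L g /\ f g = y] (ex_intro _ (s' y) (conj (Ls' y) (fs' y))).
  by move=> Lg fg; apply: (etrans (esym (s'f _ Lg))); rewrite fg.
by rewrite sE; split=> // y; split=> //; exact: fs'.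
Qed.

Lemma smooth_comp m n p (M : @charted_space R m) (N : @charted_space R n)
    (P : @charted_space R p) (f : M -> N) (g : N -> P) : atlas M -> atlas N ->
  smooth f -> smooth g -> smooth (g \o f).
Proof.
move=> aM aN sf sg; apply: has_der_smooth_on => x _; exists (diff_mx f x *m diff_mx g (f x)).
exact: (has_der_comp aM aN (smooth_has_der x aM sf) (smooth_has_der _ aN sg) Logic.I
  (near_all _ (fun _ _ => Logic.I))).
Qed.

Lemma diff_mx_comp m n p (M : @charted_space R m) (N : @charted_space R n)
    (P : @charted_space R p) (f : M -> N) (g : N -> P) x : atlas M -> atlas N ->
  smooth f -> smooth g -> diff_mx (g \o f) x = diff_mx f x *m diff_mx g (f x).
Proof.
move=> aM aN sf sg; apply: esym; apply: (has_der_diff_mx aM (nbhsT _)).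
exact: (has_der_comp aM aN (smooth_has_der x aM sf) (smooth_has_der _ aN sg) Logic.I
  (near_all _ (fun _ _ => Logic.I))).
Qed.

Lemma diff_mx_id m (M : @charted_space R m) x : atlas M -> diff_mx (@idfun M) x = 1%:M.
Proof. by move=> aM; apply/esym/(has_der_diff_mx aM (nbhsT _))/has_der_id. Qed.

Lemma dfun_diff_mx m (M : @charted_space R m) (F : M -> R) x u : atlas M ->
  smooth_fun F -> dfun F x u = (u *m diff_mx (N := real_line) F x) 0 0.
Proof. by move=> aM sF; exact: (has_der_dfun u aM (nbhsT _) (smooth_has_der x aM sF)). Qed.

Lemma grad_diff_mx m (M : @charted_space R m) (F : M -> R) x : atlas M ->
  smooth_fun F -> grad F x = (diff_mx (N := real_line) F x)^T.
Proof. by move=> aM sF; exact: (has_der_grad aM (nbhsT _) (smooth_has_der x aM sF)). Qed.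

Lemma grad_comp m n (M : @charted_space R m) (N : @charted_space R n)
    (f : M -> N) (F : N -> R) x : atlas M -> atlas N -> smooth f -> smooth_fun F ->
  (grad (F \o f) x)^T = diff_mx f x *m (grad F (f x))^T.
Proof.
move=> aM aN sf sF; rewrite (grad_diff_mx x aM (smooth_comp aM aN sf sF)).
by rewrite (grad_diff_mx _ aN sF) !trmxK; exact: diff_mx_comp.
Qed.

Section Time.
Variables (n : nat) (M : @charted_space R n) (I : set R).
Hypothesis aM : atlas M.
Let aR := @real_line_atlas R.
Let MI : set (prodm M (@real_line R)) := [set p | I p.2].

Lemma has_der_fix_time m (N : @charted_space R m) (f : R -> M -> N) y t T : I t ->
  has_der MI ((fun p => f p.2 p.1) : prodm M (@real_line R) -> N) (y, t) T ->
  has_der setT (f t) y (usubmx T).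
Proof.
move=> It H.
have Hc := has_der_pair aM (has_der_id setT y aM) (has_der_cst (N := @real_line R) setT t y aM).
have H1 := has_der_comp aM (prodm_atlas aM aR) Hc H Logic.I (near_all _ (fun _ _ => It)).
move: H1; rewrite -{1}[T]vsubmxK mul_row_col mul1mx mul0mx addr0; exact.
Qed.

(** The chain rule for [s |-> f s (c s)]; the rows of [T] split into the space and
time parts of the derivative. *)
Lemma has_der_curve_time m (N : @charted_space R m) (f : R -> M -> N) (c : R -> M) t T v
    (J : set R) :
  I t -> J t -> has_der (M := real_line) (J `&` I) c t v ->
  has_der MI ((fun p => f p.2 p.1) : prodm M (@real_line R) -> N) (c t, t) T ->
  has_der (M := real_line) (J `&` I) (fun s => f s (c s)) t (v *m usubmx T + dsubmx T).
Proof.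
move=> It Jt Hv H.
have Hc := has_der_pair aR Hv (has_der_id (M := @real_line R) (J `&` I) t aR).
have H1 := has_der_comp aR (prodm_atlas aM aR) Hc H (conj Jt It) (near_all _ (fun _ h => proj2 h)).
move: H1; rewrite -{1}[T]vsubmxK mul_row_col mul1mx; exact.
Qed.

Lemma has_der_time m (N : @charted_space R m) (f : R -> M -> N) y t T :
  I t ->
  has_der MI ((fun p => f p.2 p.1) : prodm M (@real_line R) -> N) (y, t) T ->
  has_der (M := real_line) (setT `&` I) (f^~ y) t (dsubmx T).
Proof.
move=> It H; have Hc := has_der_cst (M := @real_line R) (setT `&` I) y t aR.
by have := has_der_curve_time It Logic.I Hc H; rewrite mul0mx add0r.
Qed.

End Time.

Lemma has_der_velocity (I J : set R) m (M : @charted_space R m) (c : R -> M) t T :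
  open J -> J t -> I t ->
  has_der (M := real_line) (J `&` I) c t T -> velocity I c t T.
Proof.
move=> oJ Jt It H; apply: (has_der_dquot H It (conj Jt It)).
by apply: filterS (open_near oJ Jt) => s Js Is.
Qed.

Lemma has_der_dt1 (I : set R) (f : R -> R) (t : R) T :
  ProperFilter (within I t^') -> I t ->
  has_der (M := real_line) (N := real_line) (setT `&` I) f t T -> dt I 1 f t = T 0 0.
Proof.
move=> PF It H; have := has_der_velocity openT Logic.I It H.
rewrite /velocity => V; apply: cvg_lim => //.
have [L Lc LE] := coord_lin_continuous (R := R) (m := 1) (n := 1) 0 0.
have := cvg_comp _ _ V (Lc T); rewrite LE; apply: cvg_trans.
apply: near_eq_cvg; apply: nearW => s.
by rewrite /= LE /dquot !mxE.
Qed.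

End Y.

(** * The integrator defined by a family of Lagrangian bisections *)

Section Main.
Context {R : realType}.
Variables (I : set R) (HI : is_interval I) (I0 : I 0)
  (I_nondegenerate : exists2 t, I t & t != 0).
Variables (n m : nat) (M : @charted_space R n) (G : @charted_space R m).
Hypotheses (HM : smooth_manifold M) (HG : smooth_manifold G).
Variables (pi : M -> 'M[R]_n) (Hpi : poisson pi).
Variables (D : groupoid_data G M) (Omega : form2 G).
Hypothesis HD : local_symplectic_groupoid D Omega.
Hypothesis Hint : integrates D Omega pi.
Variables (L : R -> set G) (HL : smooth_lagrangian_bisections D Omega I L).
Hypothesis HL0 : L 0 = range (uni D).
Variables (h : R -> M -> R) (Hh : variation_functions I D Omega L h).

Let aM := smooth_manifold_atlas HM.
Let aG := smooth_manifold_atlas HG.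
Let aR := @real_line_atlas R.
Let aMR := prodm_atlas aM aR.
Let MI : set (prodm M (@real_line R)) := [set p | I p.2].

Let sec t : M -> G := src_section D (L t).
Let tsec t (x : M) : G := xget (uni D x) [set g | L t g /\ tgt D g = x].
Let phi t : M -> M := induced_map D (L t).
Let psi t : M -> M := src D \o tsec t.
Let g t : M -> R := h t \o psi t.

Lemma skew_pi x : (pi x)^T = - pi x.
Proof. by have [H _ _] := Hpi; exact: H. Qed.

Lemma within_proper t : I t -> ProperFilter (within I t^').
Proof.
move=> It; apply: interval_within_proper => //.
have [-> |t0] := eqVneq t 0; first exact: I_nondegenerate.
by exists 0 => //; rewrite eq_sym.
Qed.

Lemma sub_src : submersion (src D).
Proof. by have [[H _ _ _ _ _ _ _ _ _ _ _] _ _] := HD. Qed.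
Lemma sub_tgt : submersion (tgt D).
Proof. by have [[_ H _ _ _ _ _ _ _ _ _ _] _ _] := HD. Qed.
Let src_smooth : smooth (src D) := sub_src.1.
Let tgt_smooth : smooth (tgt D) := sub_tgt.1.

Lemma secP t : I t -> [/\ smooth (sec t), forall y, L t (sec t y) /\ src D (sec t y) = y &
  forall x, L t x -> sec t (src D x) = x].
Proof. by move=> It; have [[_ H _] _] := HL.2 t It; exact: diffeo_from_section. Qed.

Lemma tsecP t : I t -> [/\ smooth (tsec t), forall y, L t (tsec t y) /\ tgt D (tsec t y) = y &
  forall x, L t x -> tsec t (tgt D x) = x].
Proof. by move=> It; have [[_ _ H] _] := HL.2 t It; exact: diffeo_from_section. Qed.

Lemma phiK t y : I t -> psi t (phi t y) = y.
Proof.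
move=> It; have [_ S1 _] := secP It; have [_ _ T2] := tsecP It.
rewrite /psi /phi /induced_map /= -/(sec t) T2; first exact: (S1 y).2.
exact: (S1 y).1.
Qed.

Lemma psiK t x : I t -> phi t (psi t x) = x.
Proof.
move=> It; have [_ _ S2] := secP It; have [_ T1 _] := tsecP It.
rewrite /psi /phi /induced_map /= -/(sec t) S2; first exact: (T1 x).2.
exact: (T1 x).1.
Qed.

Lemma phi0 x : phi 0 x = x.
Proof.
have [[_ _ _ us ut _ _ _ _ _ _ _] _ _] := HD.
have [_ S1 _] := secP I0; have [Ls sx] := S1 x.
rewrite /phi /induced_map /= -/(sec 0) -[RHS]sx; move: Ls; rewrite HL0 => -[z _ <-].
by rewrite us ut.
Qed.

Lemma sec_der t y : I t -> exists T,
  has_der MI ((fun p => sec p.2 p.1) : prodm M (@real_line R) -> G) (y, t) T.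
Proof.
move=> It; apply: (joint_section y aG aM src_smooth HL.1) => // [s Is|s z Is|s z Is].
- by have [] := secP Is.
- by have [_ H _] := secP Is.
- by have [_ _ H] := secP Is; exact: H.
Qed.

Lemma tsec_der t y : I t -> exists T,
  has_der MI ((fun p => tsec p.2 p.1) : prodm M (@real_line R) -> G) (y, t) T.
Proof.
move=> It; apply: (joint_section y aG aM tgt_smooth HL.1) => // [s Is|s z Is|s z Is].
- by have [] := tsecP Is.
- by have [_ H _] := tsecP Is.
- by have [_ _ H] := tsecP Is; exact: H.
Qed.

Lemma phi_der t y T : I t ->
  has_der MI ((fun p => sec p.2 p.1) : prodm M (@real_line R) -> G) (y, t) T ->
  has_der MI ((fun p => phi p.2 p.1) : prodm M (@real_line R) -> M) (y, t)
    (T *m diff_mx (tgt D) (sec t y)).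
Proof.
move=> It H; exact: (has_der_comp aMR aG H (smooth_has_der (sec t y) aG tgt_smooth) It
  (near_all _ (fun _ _ => Logic.I))).
Qed.

Lemma psi_der t y : I t -> exists T,
  has_der MI ((fun p => psi p.2 p.1) : prodm M (@real_line R) -> M) (y, t) T.
Proof.
move=> It; have [T H] := tsec_der y It; exists (T *m diff_mx (src D) (tsec t y)).
exact: (has_der_comp aMR aG H (smooth_has_der (tsec t y) aG src_smooth) It
  (near_all _ (fun _ _ => Logic.I))).
Qed.

Lemma h_der t y : I t -> exists T,
  has_der (N := real_line) MI ((fun p => h p.2 p.1) : prodm M (@real_line R) -> R) (y, t) T.
Proof.
move=> It; have [T HT] := smooth_on_has_der (x := ((y, t) : prodm M (@real_line R))) Hh.1 It.
by exists T; exact: HT.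
Qed.

Lemma g_der t x Tp Th : I t ->
  has_der MI ((fun p => psi p.2 p.1) : prodm M (@real_line R) -> M) (x, t) Tp ->
  has_der (N := real_line) MI ((fun p => h p.2 p.1) : prodm M (@real_line R) -> R)
    (psi t x, t) Th ->
  has_der (N := real_line) MI ((fun p => g p.2 p.1) : prodm M (@real_line R) -> R)
    (x, t) (Tp *m usubmx Th + col_mx 0 1%:M *m dsubmx Th).
Proof.
move=> It Hp Hh'.
have H1 := has_der_pair aMR Hp (has_der_snd MI ((x, t) : prodm M (@real_line R)) aM aR).
have H2 := has_der_comp aMR aMR H1 Hh' It (near_all _ (fun _ h => h)).
move: H2; rewrite -{1}[Th]vsubmxK mul_row_col; exact.
Qed.

Lemma phi_smooth t : I t -> smooth (phi t).
Proof. by move=> It; have [H _ _] := secP It; exact: (smooth_comp aM aG H tgt_smooth). Qed.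

Lemma psi_smooth t : I t -> smooth (psi t).
Proof. by move=> It; have [H _ _] := tsecP It; exact: (smooth_comp aM aG H src_smooth). Qed.

Lemma ht_smooth t : I t -> smooth_fun (h t).
Proof.
move=> It; apply: has_der_smooth_on => y _; have [T H] := h_der y It.
by exists (usubmx T); exact: (has_der_fix_time aM It H).
Qed.

Lemma gt_smooth t : I t -> smooth_fun (g t).
Proof. by move=> It; exact: (smooth_comp aM aM (psi_smooth It) (ht_smooth It)). Qed.

Section Point.
Variables (t : R) (It : I t) (y : M).
Let g0 := sec t y.
Let x := phi t y.
Let Sg := diff_mx (sec t) y.
Let A := diff_mx (src D) g0.
Let B := diff_mx (tgt D) g0.
Let Ps := diff_mx (psi t) x.

Lemma form_linear a u v w : Omega g0 (a *: u + v) w = a * Omega g0 u w + Omega g0 v w.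
Proof. exact: symp_lin HD _ _ _ _ _. Qed.

Lemma form_nondegenerate u : (forall v, Omega g0 u v = 0) -> u = 0.
Proof. by have [_ [_ _ H _ _] _] := HD; exact: H. Qed.

Lemma diff_mx_phi : diff_mx (phi t) y = Sg *m B.
Proof. by have [H _ _] := secP It; exact: diff_mx_comp aM aG H tgt_smooth. Qed.

Lemma section_src : Sg *m A = 1%:M.
Proof.
have [H S1 _] := secP It; rewrite -(diff_mx_comp y aM aG H src_smooth) -(diff_mx_id y aM).
by congr (diff_mx _ y); apply/funext => z /=; rewrite (S1 z).2.
Qed.

Lemma section_tgt : Sg *m B *m Ps = 1%:M.
Proof.
rewrite -diff_mx_phi -(diff_mx_comp y aM aM (phi_smooth It) (psi_smooth It)) -(diff_mx_id y aM).
by congr (diff_mx _ y); apply/funext => z /=; rewrite phiK.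
Qed.

Lemma bisection_isotropic a b : Omega g0 (a *m Sg) (b *m Sg) = 0.
Proof.
have [_ [k [sk lag]]] := HL.2 t It; have [H S1 S2] := secP It.
have tanE u := tangent_section u aG aM sk (fun z => (S1 z).1) S2 (S1 y).2
  (smooth_has_der y aM H) (smooth_has_der g0 aG src_smooth).
apply: (lag g0 (S1 y).1 _).1; first by apply/tanE; exists a.
by apply/tanE; exists b.
Qed.

Lemma form_src_fibre u q q' : u *m A = 0 -> q *m B = q' *m B -> Omega g0 u q = Omega g0 u q'.
Proof.
have [H T1 T2] := tsecP It; have [_ S1 _] := secP It.
apply: (src_kernel aG aM HD (sb := tsec t) H); first by move=> z; exact: (T1 z).2.
by apply: T2; exact: (S1 y).1.
Qed.

Lemma form_tgt_fibre u q q' : u *m B = 0 -> q *m A = q' *m A -> Omega g0 u q = Omega g0 u q'.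
Proof.
have [H S1 S2] := secP It.
apply: (tgt_kernel aG aM HD (sa := sec t) H); first by move=> z; exact: (S1 z).2.
by apply: S2; exact: (S1 y).1.
Qed.

Lemma dfun_tgt F u : smooth_fun F -> dfun (F \o tgt D) g0 u = (u *m B *m (grad F x)^T) 0 0.
Proof.
move=> sF; have sFt := smooth_comp aG aM tgt_smooth sF.
by rewrite (dfun_diff_mx g0 u aG sFt) (diff_mx_comp g0 aG aM tgt_smooth sF) mulmxA (grad_diff_mx _ aM sF) trmxK.
Qed.

Lemma dfun_src F u : smooth_fun F ->
  dfun (F \o phi t \o src D) g0 u = (u *m A *m (Sg *m B *m (grad F x)^T)) 0 0.
Proof.
move=> sF; have sp := phi_smooth It; have sFp := smooth_comp aM aM sp sF.
have sFs := smooth_comp aG aM src_smooth sFp.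
have gy : src D g0 = y by have [_ S1 _] := secP It; exact: (S1 y).2.
rewrite (dfun_diff_mx g0 u aG sFs) (diff_mx_comp g0 aG aM src_smooth sFp) gy.
by rewrite (diff_mx_comp y aM aM sp sF) diff_mx_phi mulmxA (grad_diff_mx _ aM sF) trmxK.
Qed.

(** The source is Poisson and the target anti-Poisson, so both brackets of the
statement are symplectic brackets at the point [g0] of the bisection, up to
sign.  The transfer of Hamiltonian vectors along the bisection identifies them.
If one of the Hamiltonian vectors does not exist, neither does the other, and
both brackets are 0 by convention. *)
Lemma phi_poisson F K : smooth_fun F -> smooth_fun K ->
  pbracket pi (F \o phi t) (K \o phi t) y = pbracket pi F K x.
Proof.
move=> sF sK; have sp := phi_smooth It.
have sFp := smooth_comp aM aM sp sF; have sKp := smooth_comp aM aM sp sK.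
have gy : src D g0 = y by have [_ S1 _] := secP It; exact: (S1 y).2.
have [Ps1 Pt1] := Hint.
have Es := Ps1 _ _ sFp sKp g0; rewrite gy mul1r in Es.
have Et := Pt1 _ _ sF sK g0; rewrite mulN1r -[tgt D g0]/x in Et.
rewrite -Es -[RHS]opprK -Et.
have [[X HX]|nX] := pselect (exists X, forall q,
    Omega g0 X q = - (q *m B *m (grad F x)^T) 0 0).
  have [XA HZ] := ham_transfer form_linear form_nondegenerate section_src section_tgt bisection_isotropic form_src_fibre form_tgt_fibre HX.
  have HX' v : Omega g0 X v = - dfun (F \o tgt D) g0 v.
    by rewrite HX; congr (- _); exact: esym (dfun_tgt _ sF).
  set Z := X - _ in HZ.
  have HZ' v : Omega g0 Z v = - dfun (F \o phi t \o src D) g0 v.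
    by rewrite HZ; congr (- _); exact: esym (dfun_src _ sF).
  have EX := congr1 (dfun (K \o tgt D) g0) (symp_hamE form_linear form_nondegenerate HX').
  have EZ := congr1 (dfun (K \o phi t \o src D) g0) (symp_hamE form_linear form_nondegenerate HZ').
  apply: (etrans EZ); apply: etrans (congr1 -%R (esym EX)).
  apply: (etrans (dfun_src _ sK)); apply: etrans (congr1 -%R (esym (dfun_tgt _ sK))).
  exact: (ham_transfer_value section_src section_tgt _ XA).
have nX' u : ~ forall v, Omega g0 u v = - dfun (F \o tgt D) g0 v.
  move=> HX; apply: nX; exists u => q; rewrite HX; congr (- _); exact: dfun_tgt.
have nZ' u : ~ forall v, Omega g0 u v = - dfun (F \o phi t \o src D) g0 v.
  move=> HZ; apply: nX.
  apply: (ham_transfer_inv form_linear section_src section_tgt bisection_isotropic form_src_fibre (Z := u)) => q.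
  by rewrite HZ; congr (- _); exact: dfun_src.
have EX := congr1 (dfun (K \o tgt D) g0) (symp_ham_none nX').
have EZ := congr1 (dfun (K \o phi t \o src D) g0) (symp_ham_none nZ').
apply: (etrans EZ); apply: etrans (congr1 -%R (esym EX)).
apply: (etrans (dfun_src _ sK)); apply: etrans (congr1 -%R (esym (dfun_tgt _ sK))).
exact: (etrans (mul0_value _ _) (esym (etrans (congr1 -%R (mul0_value _ _)) (oppr0 _)))).
Qed.

(** The source of [sec t y] is [y] at all times, so its velocity is tangent to the
source fibre. *)
Lemma velocity_kernel T :
  has_der MI ((fun p => sec p.2 p.1) : prodm M (@real_line R) -> G) (y, t) T ->
  usubmx T = Sg /\ dsubmx T *m A = 0.
Proof.
move=> H; split.
  by have H1 := has_der_fix_time aM It H; exact: (has_der_diff_mx aM (nbhsT y) H1).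
have H1 := has_der_time aM It H.
have H2 := has_der_comp aR aG H1 (smooth_has_der g0 aG src_smooth) (conj Logic.I It)
  (near_all _ (fun _ _ => Logic.I)).
have H3 : has_der (M := real_line) (setT `&` I) (fun=> y) t (dsubmx T *m A).
  apply: (has_der_eq aR H2).
    by have [_ S1 _] := secP It; exact: (S1 y).2.
  apply: near_all => s [_ Is]; split=> //=.
  by have [_ S1 _] := secP Is; rewrite (S1 y).2.
have H4 := has_der_cst (M := @real_line R) (setT `&` I) y t aR.
exact: (velocity_unique (within_proper It) (has_der_velocity openT Logic.I It H3)
  (has_der_velocity openT Logic.I It H4)).
Qed.

(** The variation form is defined with an arbitrary representative [V] of the
normal variation.  A curve in the family with velocity [V] has the form
[s |-> sec s (src (c s))], so [V] differs from the velocity of the section by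
the vector [(V A) Sg] tangent to the bisection, which is isotropic. *)
Lemma variation_velocity T w :
  has_der MI ((fun p => sec p.2 p.1) : prodm M (@real_line R) -> G) (y, t) T ->
  Omega g0 (dsubmx T) (w *m Sg) = (w *m (grad (h t) y)^T) 0 0.
Proof.
move=> H; have [TS TA] := velocity_kernel H; have [sS S1 S2] := secP It.
have gy : src D g0 = y := (S1 y).2.
have nv0 : normal_variation I L t g0 (dsubmx T).
  have H1 := has_der_time aM It H.
  exists setT, (fun s => sec s y); split=> //.
  - by split=> //; exact: openT.
  - apply: has_der_smooth_on => s [_ Is]; have [Ts Hs] := sec_der y Is.
    by exists (dsubmx Ts); exact: (has_der_time aM Is Hs).
  - by move=> s _ Is; have [_ S _] := secP Is; exact: (S y).1.
  - exact: (has_der_velocity openT Logic.I It H1).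
have [J [c [[oJ Jt] sc cL ct Vc]]] := @xgetPex _ 0 (normal_variation I L t g0) (ex_intro _ _ nv0).
set V := xget 0 _ in Vc.
have VE : V = V *m A *m Sg + dsubmx T.
  have [Tc Hc] := smooth_on_has_der sc (conj Jt It).
  have TcV : Tc = V.
    exact: (velocity_unique (within_proper It) (has_der_velocity oJ Jt It Hc) Vc).
  rewrite TcV in Hc.
  have Hs : has_der setT (src D) (c t) A by rewrite ct; exact: smooth_has_der.
  have H1 := has_der_comp aR aG Hc Hs (conj Jt It) (near_all _ (fun _ _ => Logic.I)).
  have E0 : (src D \o c) t = y by rewrite /= ct.
  rewrite -E0 in H.
  have H2 := has_der_curve_time (f := sec) aM It Jt H1 H.
  have H3 : has_der (M := real_line) (J `&` I) c t (V *m A *m usubmx T + dsubmx T).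
    apply: (has_der_eq aR H2); first by rewrite /= ct gy.
    apply: near_all => s [Js Is]; split=> //=.
    by have [_ _ S] := secP Is; rewrite S //; exact: cL.
  rewrite TS in H3.
  exact: (velocity_unique (within_proper It) Vc (has_der_velocity oJ Jt It H3)).
have := Hh.2 t It y w; rewrite /xi /variation_form -/(sec t y) -/g0 -/V diff_mxE -/Sg.
rewrite VE -[V *m A *m Sg]scale1r form_linear bisection_isotropic mulr0 add0r => <-.
by rewrite (dfun_diff_mx y w aM (ht_smooth It)) (grad_diff_mx _ aM (ht_smooth It)) trmxK.
Qed.

(** The velocity [v] of the section pairs with any [q] as [dg_t (tgt_* q)], so [- v]
is the Hamiltonian vector of [g_t o tgt].  Since the target is anti-Poisson, the
image of [v] under the target acts on functions as [{g_t, .}], and functions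
with prescribed gradient at [x] separate vectors. *)
Lemma velocity_ham T :
  has_der MI ((fun p => sec p.2 p.1) : prodm M (@real_line R) -> G) (y, t) T ->
  dsubmx T *m B = ham pi (g t) x.
Proof.
move=> H; have [TS TA] := velocity_kernel H.
have fib := src_fibre_form section_tgt form_src_fibre TA (fun w => variation_velocity w H).
have sg := gt_smooth It.
have gradg : (grad (g t) x)^T = Ps *m (grad (h t) y)^T.
  exact: (etrans (grad_comp x aM aM (psi_smooth It) (ht_smooth It))
    (congr1 (fun z => Ps *m (grad (h t) z)^T) (phiK y It))).
have hamV : symp_ham Omega (g t \o tgt D) g0 = - dsubmx T.
  apply: (symp_hamE form_linear form_nondegenerate) => v.
  have -> : Omega g0 (- dsubmx T) v = - Omega g0 (dsubmx T) v.
    have := form_linear (-1) (dsubmx T) 0 v; rewrite scaleN1r addr0 => ->.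
    by rewrite (symp0l HD) addr0 mulN1r.
  rewrite fib; congr (- _).
  exact: (esym (etrans (dfun_tgt v sg) (congr1 (fun z => (v *m B *m z) 0 0) gradg))).
apply/rowP => j; have [K sK gK] := smooth_fun_grad x j HM.
have Et := etrans (Hint.2 _ _ sg sK g0) (mulN1r _).
have E1 := congr1 (dfun (K \o tgt D) g0) hamV.
have E3 := etrans (esym (dfun_tgt _ sK)) (etrans (esym E1) Et).
exact: (row_coord_test gK E3).
Qed.

End Point.

Lemma phi_velocity t y : I t -> velocity I (fun s => phi s y) t (ham pi (g t) (phi t y)).
Proof.
move=> It; have [T H] := sec_der y It.
rewrite -(velocity_ham It H).
have H1 := has_der_time aM It (phi_der It H).
have E : dsubmx (T *m diff_mx (tgt D) (sec t y)) = dsubmx T *m diff_mx (tgt D) (sec t y).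
  by rewrite -{1}[T]vsubmxK mul_col_mx col_mxKd.
by rewrite -E; exact: (has_der_velocity openT Logic.I It H1).
Qed.

(** [g_t = h_t o psi_t], and the motion of [psi_t] contributes the derivative of
[g_t] along the vector field [X_(g_t)], up to sign, that is, the bracket of
[g_t] with itself. *)
Lemma g_time t x : I t -> dt I 1 (fun s => g s x) t = dt I 1 (fun s => h s (psi t x)) t.
Proof.
move=> It; set y := psi t x.
have [T H] := sec_der y It; have [Tp Hp] := psi_der x It; have [Th Hh'] := h_der y It.
have xy : phi t y = x by exact: psiK.
have H1 := has_der_time aM It (g_der It Hp Hh').
have H2 := has_der_time aM It Hh'.
rewrite (has_der_dt1 (within_proper It) It H1) (has_der_dt1 (within_proper It) It H2).
have E1 : dsubmx (Tp *m usubmx Th + col_mx 0 1%:M *m dsubmx Th) =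
    dsubmx Tp *m usubmx Th + dsubmx Th.
  by rewrite -{1}[Tp]vsubmxK !mul_col_mx mul0mx mul1mx add_col_mx col_mxKd.
(* the time derivative of psi (phi y) = y *)
have HB := has_der_time aM It (phi_der It H).
rewrite -xy in Hp.
have Hc := has_der_curve_time (f := psi) aM It Logic.I HB Hp.
have Hc' : has_der (M := real_line) (setT `&` I) (fun=> y) t
    (dsubmx (T *m diff_mx (tgt D) (sec t y)) *m usubmx Tp + dsubmx Tp).
  apply: (has_der_eq aR Hc); first by rewrite phiK.
  by apply: near_all => s [_ Is]; rewrite phiK.
have W0 := velocity_unique (within_proper It) (has_der_velocity openT Logic.I It Hc')
  (has_der_velocity openT Logic.I It (has_der_cst (M := @real_line R) (setT `&` I) y t aR)).
have E2 : dsubmx (T *m diff_mx (tgt D) (sec t y)) = ham pi (g t) x.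
  rewrite -{1}[T]vsubmxK mul_col_mx col_mxKd -xy; exact: velocity_ham.
have UT : usubmx Tp = diff_mx (psi t) x.
  rewrite xy in Hp.
  by have H3 := has_der_fix_time aM It Hp; exact: (has_der_diff_mx aM (nbhsT x) H3).
have Uh : usubmx Th = diff_mx (N := real_line) (h t) y.
  by have H3 := has_der_fix_time aM It Hh'; exact: (has_der_diff_mx aM (nbhsT y) H3).
have Dp : dsubmx Tp = - (ham pi (g t) x *m diff_mx (psi t) x).
  by apply/eqP; rewrite -addr_eq0 addrC -UT -E2 W0.
have gg : grad (g t) x = (diff_mx (psi t) x *m diff_mx (N := real_line) (h t) y)^T.
  rewrite (grad_diff_mx _ aM (gt_smooth It)).
  by rewrite (diff_mx_comp x aM aM (psi_smooth It) (ht_smooth It)).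
rewrite E1 mxE Dp Uh mulNmx -mulmxA -[X in _ *m X]trmxK -gg.
suff -> : (- (ham pi (g t) x *m (grad (g t) x)^T)) 0 0 = 0 by rewrite add0r.
by rewrite mxE; have := pbracketxx (g t) (skew_pi x); rewrite /pbracket /ham => ->; rewrite oppr0.
Qed.

Lemma magnus_poisson_integrator (H : M -> R) k (Mag : nat -> M -> R) : (1 <= k)%N ->
  magnus_series I pi h Mag -> series_eq_upto k Mag (monomial 1%N H) ->
  hamiltonian_poisson_integrator I pi H k phi.
Proof.
move=> k1 HMag HMagk.
have mt := magnus_taylor skew_pi HMag HMagk.
split.
- apply: has_der_smooth_on => -[y t] It; have [T HT] := sec_der y It.
  by exists (T *m diff_mx (tgt D) (sec t y)); exact: phi_der.
- move=> t It; split; first exact: phi_smooth.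
  exists (psi t); split; first exact: psi_smooth.
    by move=> y; exact: phiK.
  by move=> x; exact: psiK.
- by move=> t It F K sF sK y; rewrite mul1r; exact: phi_poisson.
exists g; split.
- apply: has_der_smooth_on => -[x t] It; have [Tp Hp] := psi_der x It.
  have [Th Hh'] := h_der (psi t x) It.
  by eexists; exact: (g_der It Hp Hh').
- have psi00 x : psi 0 x = x by rewrite -{1}(phi0 x) phiK.
  move=> j jk x.
  have jk' : (j < k)%N by rewrite -(prednK k1) ltnS.
  case: j jk jk' => [|j] jk jk'.
    by have := mt 0%N jk' x; rewrite /taylor /= /g /= psi00.
  rewrite /monomial /= /taylor.
  suff -> : dt I j.+1 (fun t => g t x) 0 = 0 by rewrite mul0r.
  have [Tp Hp] := psi_der x I0; have [Th Hh'] := h_der (psi 0 x) I0.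
  apply: (taylor_transport (h := h) (psi := fun t => psi t x) (x := x) (k := k) aM within_proper I0).
  + by have := h_der x I0.
  + move=> y i /andP[i0 ik]; have := mt i ik y; rewrite /taylor /monomial.
    case: i i0 ik => // i _ ik /eqP; rewrite mulf_eq0 invr_eq0.
    by rewrite pnatr_eq0 -[_ == 0%N]negbK -lt0n fact_gt0 orbF => /eqP.
  + have H1 := has_der_time aM I0 (g_der I0 Hp Hh').
    by rewrite setTI in H1; eexists; exact: H1.
  + have [H1 _] := has_der_time aM I0 Hp.
    by rewrite setTI psi00 in H1.
  + by move=> t It; exact: g_time.
  + by rewrite jk'.
- exact: phi0.
- by move=> x t It; exact: phi_velocity.
Qed.

End Main.

Unset Implicit Arguments.
Set Strict Implicit.
Set Printing Implicit Defensive.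

Theorem theorem2p26 (R : realType)
    (I : set R) (HI : is_interval I) (I0 : I 0)
    (I_nondegenerate : exists2 t, I t & t != 0)
    (n m : nat) (M : @charted_space R n) (G : @charted_space R m)
    (HM : smooth_manifold M) (HG : smooth_manifold G)
    (pi : M -> 'M[R]_n) (Hpi : poisson pi)
    (D : groupoid_data G M) (Omega : form2 G)
    (HD : local_symplectic_groupoid D Omega)
    (Hint : integrates D Omega pi)
    (H : M -> R) (HH : smooth_fun H)
    (k : nat) (Hk : (1 <= k)%N)
    (L : R -> set G)
    (HL : smooth_lagrangian_bisections D Omega I L)
    (HLexact : exact_family D Omega I L)
    (HL0 : L 0 = range (uni D))
    (h : R -> M -> R) (Hh : variation_functions I D Omega L h)
    (Mag : nat -> M -> R) (HMag : magnus_series I pi h Mag)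
    (HMagk : series_eq_upto k Mag (monomial 1%N H)) :
  hamiltonian_poisson_integrator I pi H k (fun t => induced_map D (L t)).
Proof.
exact: (magnus_poisson_integrator HI I0 I_nondegenerate HM HG Hpi HD Hint HL
  HL0 Hh Hk HMag HMagk).
Qed.
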